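(* For $G=SU(n)$, the construction of the basic gerbe $(\mathcal V,L,t)$ with transition line bundles $L_{ij}=\theta_{ij}^*(L_{\mu_j-\mu_i})\to V_{ij}$ over the standard open cover $\mathcal V=\{V_i\}_{i=1}^n$ is equivalent to the Gawedzki–Reis construction of the basic gerbe over $SU(n)$, whose line bundles are $E_{ij}\to V_{ij}$ ($i<j$): for $i<j$ one has $$L_{ij}=\theta_{ij}^*(L_{\mu_j-\mu_i})=E_{ij}.$$
   Context: Every $A\in SU(n)$ is conjugate to $\operatorname{diag}(e^{2\pi\sqrt{-1}\lambda_1(A)},\dots,e^{2\pi\sqrt{-1}\lambda_n(A)})$ with real $\lambda_i(A)$ normalized by $\sum_i\lambda_i(A)=0$ and $\lambda_1(A)\ge\dots\ge\lambda_n(A)\ge\lambda_1(A)-1$. Let $T$ be the diagonal maximal torus, with Lie algebra $\mathfrak t\cong\{\lambda\in\mathbb R^n:\sum\lambda_i=0\}$, identified with $\mathfrak t^*$ by the basic inner product, which is induced from the standard inner product on $\mathbb R^n$ (standard basis $e_1,\dots,e_n$); $\exp\lambda=\operatorname{diag}(e^{2\pi\sqrt{-1}\lambda_i})$. The fundamental alcove is $\mathfrak A=\{\lambda\in\mathfrak t:\lambda_1\ge\dots\ge\lambda_n\ge\lambda_1-1\}$, and $q:SU(n)\to\mathfrak A$ is $A\mapsto(\lambda_1(A),\dots,\lambda_n(A))$. For $1\le i<n$ put $\mathfrak A_i=\{\lambda\in\mathfrak A:\lambda_i>\lambda_{i+1}\}$, and $\mathfrak A_n=\{\lambda\in\mathfrak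 A:\lambda_n>\lambda_1-1\}$; $V_i=q^{-1}(\mathfrak A_i)$, $V_{ij}=V_i\cap V_j$, $V_{ijk}=V_i\cap V_j\cap V_k$. The vertices of $\mathfrak A$ are $\mu_i=\sum_{k=1}^ie_k-\frac in\sum_{k=1}^ne_k$, $i=1,\dots,n$. Basic gerbe: for a weight $\mu$ with stabilizer $G_\mu$, $L_\mu=G\times_{G_\mu}\mathbb C_\mu$, a line bundle over the orbit $G\cdot\mu$, where $\mathbb C_\mu$ is the 1-dimensional $G_\mu$-representation with infinitesimal character $\mu$. The map $\theta_{ij}:V_{ij}\to G\cdot(\mu_j-\mu_i)$ is the $G$-equivariant map with $\theta_{ij}(\exp\xi)=\mu_j-\mu_i$ for $\xi\in\mathfrak A_i\cap\mathfrak A_j$. Over $V_{ijk}$, $(\delta L)_{ijk}=L_{jk}L_{ik}^{-1}L_{ij}$ is the pull-back of the line bundle defined by the weight $(\mu_k-\mu_j)-(\mu_k-\mu_i)+(\mu_j-\mu_i)=0$, hence canonically trivial, and $t_{ijk}=1$ is the trivial section. Gawedzki–Reis gerbe: over the set $SU(n)^{reg}$ of matrices all of whose eigenvalues have multiplicity one, let $E_k$ ($k=1,\dots,n$) be the equivariant line bundle of eigenlines for the eigenvalue $e^{2\pi\sqrt{-1}\lambda_k(A)}$. For $i<j$, the tensor product $E_{i+1}\otimes\dots\otimes E_j\to SU(n)^{reg}$ extends to a line bundle $E_{ij}\to V_{ij}$. For $i<j<k$ there is a canonical isomorphism $E_{ij}\otimes E_{jk}\cong E_{ik}$ over $V_{ijk}$;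 these line bundles and isomorphisms define a gerbe representing the generator of $H^3(SU(n),\mathbb Z)$. *)

(* Defs.v *)
(* R : realType is an arbitrary model of the reals and C = R[i].  Line
   bundles, isomorphisms, ... are topological and G-equivariant, where
   G = SU(n) acts on itself by conjugation.  Indices are 0-based: the ordinal
   i : 'I_n stands for the index i + 1 of the usual numbering 1..n. *)
From HB Require Import structures.
From mathcomp Require Import all_boot all_order all_algebra all_real_closed.
From mathcomp Require Import all_classical all_reals all_analysis.

Set Implicit Arguments.
Unset Strict Implicit.
Unset Printing Implicit Defensive.

Import Order.TTheory GRing.Theory Num.Theory.
Import numFieldNormedType.Exports.

Local Open Scope classical_set_scope.
Local Open Scope ring_scope.
Local Open Scope quotient_scope.

(* R[i], seen as a numClosedFieldType so as to get its norm topology *)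
Definition Cplx (R : realType) : numClosedFieldType := R[i].

Section SpecialUnitary.
Variables (R : realType) (n : nat).
Local Notation C := (Cplx R).

(* the type underlying this set carries the subspace topology of 'M[C]_n *)
Definition SU : set 'M[C]_n := [set A | A \is unitarymx /\ \det A = 1].

Lemma SU_mulP (g h : SU) : set_val g *m set_val h \in SU.
Proof.
have [/= gU gD] := set_mem (valP g); have [/= hU hD] := set_mem (valP h).
by apply/mem_set; split; [exact: mul_unitarymx | rewrite det_mulmx gD hD mulr1].
Qed.

Lemma SU_invP (g : SU) : invmx (set_val g) \in SU.
Proof.
have [/= gU gD] := set_mem (valP g); apply/mem_set; split.
  by rewrite invmx_unitary// trmxC_unitary.
by rewrite det_inv gD invr1.
Qed.

Lemma SU_oneP : (1%:M : 'M[C]_n) \in SU.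
Proof.
apply/mem_set; split; last by rewrite det1.
by apply/unitarymxP; rewrite mul1mx trmx1 map_mx1.
Qed.

Definition SU_mul (g h : SU) : SU := SigSub (SU_mulP g h).
Definition SU_inv (g : SU) : SU := SigSub (SU_invP g).
Definition SU_one : SU := SigSub SU_oneP.
Definition SU_conj (g A : SU) : SU := SU_mul (SU_mul g A) (SU_inv g).

(* adjoint action on matrices *)
Definition Adj (g : SU) (X : 'M[C]_n) : 'M[C]_n :=
  set_val g *m X *m invmx (set_val g).

(* e^(2 pi sqrt(-1) x) *)
Definition expi (x : R) : C := (cos (2 * pi * x) +i* sin (2 * pi * x))%C.

(* exp : t -> T, as a matrix *)
Definition expt (xi : 'rV[R]_n) : 'M[C]_n := diag_mx (map_mx expi xi).

(* An element mu of t = t^* seen as a real diagonal matrix; the (co)adjoint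
   orbit of mu is its orbit under Adj. *)
Definition dmx (mu : 'rV[R]_n) : 'M[C]_n :=
  diag_mx (map_mx (real_complex R : R -> C) mu).

Definition trace0 (xi : 'rV[R]_n) : Prop := \sum_k xi 0 k = 0.

(* basic inner product *)
Definition dot (mu xi : 'rV[R]_n) : R := \sum_k mu 0 k * xi 0 k.

(* xi_i - xi_(i+1) for i < n, and xi_n - (xi_1 - 1) for i = n
   (ordS is the cyclic successor) *)
Definition gap (xi : 'rV[R]_n) (i : 'I_n) : R :=
  xi 0 i - xi 0 (ordS i) + (i.+1 == n)%:R.

Definition alcove : set 'rV[R]_n :=
  [set xi | trace0 xi /\ forall i, 0 <= gap xi i].

Definition alcove_at (i : 'I_n) : set 'rV[R]_n :=
  alcove `&` [set xi | 0 < gap xi i].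

(* q A = (lambda_1 A, ..., lambda_n A) *)
Definition q (A : SU) : 'rV[R]_n :=
  xget 0 [set xi | alcove xi /\ exists g, set_val A = Adj g (expt xi)].

Definition V (i : 'I_n) : set SU := q @^-1` alcove_at i.

Definition vertex (i : 'I_n) : 'rV[R]_n :=
  \row_k ((k <= i)%N%:R - i.+1%:R / n%:R).

(* the G-equivariant map with exp xi |-> mu_j - mu_i for xi in A_i n A_j *)
Definition theta (i j : 'I_n) (A : SU) : 'M[C]_n :=
  xget 0 [set Y | exists g xi, [/\ alcove_at i xi, alcove_at j xi,
    set_val A = Adj g (expt xi) & Y = Adj g (dmx (vertex j - vertex i))]].

Definition regular : set SU :=
  [set A | forall a, root (char_poly (set_val A)) a ->
           mup a (char_poly (set_val A)) = 1%N].

End SpecialUnitary.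

Arguments SU : clear implicits.
Arguments SU_one : clear implicits.
Arguments regular : clear implicits.
Arguments V R {n} i.
Arguments vertex R {n} i.
Arguments theta R {n} i j A.

Section Bundles.
Variables (R : realType) (n : nat).
Local Notation C := (Cplx R).
Local Notation G := (SU R n).

(* Data of a G-equivariant line bundle over (a subset of) X.  The total space
   is the subspace btotal of bspace.  In a one-dimensional vector space the
   addition is determined by the multiplication by scalars
   (a v + b v = (a + b) v), so only the latter is recorded, and a map between
   lines is linear as soon as it is homogeneous. *)
Record bundle (X : Type) := Bundle {
  bspace : topologicalType;
  btotal : set bspace;
  bproj : bspace -> X;
  bscale : C -> bspace -> bspace;
  bact : G -> bspace -> bspace }.

Arguments btotal {X} b _.

Record is_line_bundle (B : set G) (L : bundle G) : Prop := IsLineBundle {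
  bproj_base : forall v, btotal L v -> B (bproj v);
  bproj_cont : {within btotal L, continuous (@bproj _ L)};
  bscale_total : forall z v, btotal L v -> btotal L (bscale z v);
  bscale_proj : forall z v, btotal L v -> bproj (bscale z v) = bproj v;
  bscale1 : forall v, btotal L v -> bscale 1 v = v;
  bscaleA : forall a b v, btotal L v ->
    bscale a (bscale b v) = bscale (a * b) v;
  bscale_cont : {within [set zv : C * bspace L | btotal L zv.2],
    continuous (fun zv : C * bspace L => bscale zv.1 zv.2)};
  (* local triviality: (A, z) |-> z s(A) is a homeomorphism from
     (U n B) x C to the part of the total space over U, with inverse
     v |-> (bproj v, c v) *)
  bloc_triv : forall A, B A -> exists (U : set G) (s : G -> bspace L)
      (c : bspace L -> C),
    [/\ nbhs A U,
        forall A', U A' -> B A' ->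
          [/\ btotal L (s A'), bproj (s A') = A' &
              forall z, c (bscale z (s A')) = z],
        forall v, btotal L v -> U (bproj v) ->
          bscale (c v) (s (bproj v)) = v,
        {within U `&` B, continuous s} &
        {within btotal L `&` [set v | U (bproj v)], continuous c}];
  bact_total : forall g v, btotal L v -> btotal L (bact g v);
  bact_proj : forall g v, btotal L v ->
    bproj (bact g v) = SU_conj g (bproj v);
  bact_scale : forall g z v, btotal L v ->
    bact g (bscale z v) = bscale z (bact g v);
  bact1 : forall v, btotal L v -> bact (SU_one R n) v = v;
  bactM : forall g h v, btotal L v ->
    bact (SU_mul g h) v = bact g (bact h v);
  bact_cont : {within [set gv : G * bspace L | btotal L gv.2],
    continuous (fun gv : G * bspace L => bact gv.1 gv.2)} }.

(* phi is an isomorphism of G-equivariant line bundles over the same base *)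
Definition bundle_iso (L M : bundle G) (phi : bspace L -> bspace M) : Prop :=
  [/\ forall v, btotal L v -> btotal M (phi v) /\ bproj (phi v) = bproj v,
      forall z v, btotal L v -> phi (bscale z v) = bscale z (phi v),
      forall g v, btotal L v -> phi (bact g v) = bact g (phi v),
      {within btotal L, continuous phi} &
      exists psi : bspace M -> bspace L,
        [/\ forall w, btotal M w -> btotal L (psi w),
            forall v, btotal L v -> psi (phi v) = v,
            forall w, btotal M w -> phi (psi w) = w &
            {within btotal M, continuous psi}]].

(* points (A, (v_k)_k) of the fibre product over B of the bundles L_k *)
Definition fibre_product (K : finType) (B : set G) (L : K -> bundle G) :
    set (G * prod_topology (fun k => bspace (L k))) :=
  [set p | B p.1 /\ forall k, btotal (L k) (p.2 k) /\ bproj (p.2 k) = p.1].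

Arguments fibre_product {K} B L _.

(* m induces an isomorphism, over B, from the tensor product of the line
   bundles L_k to M: by the universal property of the tensor product, an
   equivariant bundle map (x)_k L_k -> M is an equivariant, continuous,
   fibrewise multilinear map (v_k)_k |-> m A v; as (x)_k L_k and M have
   rank one, it is an isomorphism iff it is fibrewise onto. *)
Definition tensor_iso (K : finType) (B : set G) (L : K -> bundle G)
    (M : bundle G) (m : G -> (forall k, bspace (L k)) -> bspace M) : Prop :=
  [/\ forall A v, fibre_product B L (A, v) ->
        btotal M (m A v) /\ bproj (m A v) = A,
      forall A v k z, fibre_product B L (A, v) ->
        m A (fun l => if l == k then bscale z (v l) else v l)
        = bscale z (m A v),
      forall g A v, fibre_product B L (A, v) ->
        m (SU_conj g A) (fun k => bact g (v k)) = bact g (m A v),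
      {within fibre_product B L, continuous
        (fun p : G * prod_topology (fun k => bspace (L k)) => m p.1 p.2)} &
      forall A w, B A -> btotal M w -> bproj w = A ->
        exists v, fibre_product B L (A, v) /\ m A v = w].

(* restriction to B of the pull-back of L by f : G -> X *)
Definition pullback (X : Type) (B : set G) (f : G -> X) (L : bundle X) :
    bundle G :=
  @Bundle G (G * bspace L)%type
    [set p | [/\ B p.1, btotal L p.2 & bproj p.2 = f p.1]]
    fst
    (fun z p => (p.1, bscale z p.2))
    (fun g p => (SU_conj g p.1, bact g p.2)).

(* A gerbe over G in the sense of Chatterjee and Hitchin: line bundles L_ij
   over V_ij for i < j, and for i < j < k a nowhere vanishing section t_ijk
   of L_jk L_ik^-1 L_ij over V_ijk, given as the isomorphism
   L_ij (x) L_jk -> L_ik, u (x) v |-> gprod u v, that it amounts to (t_ijk = 1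
   when gprod multiplies coordinates).  The condition delta t = 1 over V_ijkl
   is the associativity of gprod. *)
Record gerbe := Gerbe {
  gline : 'I_n -> 'I_n -> bundle G;
  gprod : forall i j k,
    bspace (gline i j) -> bspace (gline j k) -> bspace (gline i k) }.

Arguments gprod : clear implicits.

Definition is_gerbe (U : 'I_n -> set G) (L : gerbe) : Prop :=
  [/\ (forall i, open (U i)) /\ \bigcup_i U i = setT,
      forall i j : 'I_n, (i < j)%N -> is_line_bundle (U i `&` U j) (gline L i j),
      forall i j k : 'I_n, (i < j < k)%N ->
        @tensor_iso bool (U i `&` U j `&` U k)
          (fun b => if b then gline L i j else gline L j k) (gline L i k)
          (fun _ v => gprod L i j k (v true) (v false)) &
      forall i j k l : 'I_n, (i < j < k)%N -> (k < l)%N ->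
        forall (u : bspace (gline L i j)) (v : bspace (gline L j k))
               (w : bspace (gline L k l)),
        btotal (gline L i j) u -> btotal (gline L j k) v ->
        btotal (gline L k l) w ->
        bproj u = bproj v -> bproj v = bproj w ->
        gprod L i k l (gprod L i j k u v) w
        = gprod L i j l u (gprod L j k l v w)].

(* isomorphism of gerbes over the same cover, G-equivariant *)
Definition gerbe_iso (L M : gerbe)
    (phi : forall i j, bspace (gline L i j) -> bspace (gline M i j)) : Prop :=
  (forall i j : 'I_n, (i < j)%N -> bundle_iso (@phi i j)) /\
  (forall i j k : 'I_n, (i < j < k)%N ->
     forall (u : bspace (gline L i j)) (v : bspace (gline L j k)),
     btotal (gline L i j) u -> btotal (gline L j k) v -> bproj u = bproj v ->
     phi i k (gprod L i j k u v) = gprod M i j k (phi i j u) (phi j k v)).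

End Bundles.

Arguments btotal {R n X} b _.
Arguments gprod {R n} g i j k _ _.

Section BasicGerbe.
Variables (R : realType) (n : nat).
Local Notation C := (Cplx R).
Local Notation G := (SU R n).
Implicit Type mu : 'rV[R]_n.

Definition stab mu : set G := [set h | Adj h (dmx mu) = dmx mu].

(* chi is the character by which G_mu acts on C_mu *)
Definition is_character mu (chi : G -> C) : Prop :=
  [/\ {within stab mu, continuous chi},
      forall g h, stab mu g -> stab mu h -> chi (SU_mul g h) = chi g * chi h &
      forall xi (h : G), trace0 xi -> set_val h = expt xi ->
        chi h = expi (dot mu xi)].

(* unique on G_mu, and existing, when mu is a weight; 1 if none exists *)
Definition weight_char mu : G -> C := xget (fun=> 1) (is_character mu).

Lemma SU_mulA : associative (@SU_mul R n).
Proof. by move=> f g h; apply: val_inj; rewrite /= mulmxA. Qed.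

Lemma SU_mulg1 : right_id (SU_one R n) (@SU_mul R n).
Proof. by move=> g; apply: val_inj; rewrite /= mulmx1. Qed.

Lemma SU_unit (g : G) : set_val g \in unitmx.
Proof. by have [/= _ gD] := set_mem (valP g); rewrite unitmxE gD unitr1. Qed.

Lemma SU_mulgV (g : G) : SU_mul g (SU_inv g) = SU_one R n.
Proof. by apply: val_inj; rewrite /= mulmxV// SU_unit. Qed.

Lemma AdjM (g h : G) X : Adj (SU_mul g h) X = Adj g (Adj h X).
Proof.
have ghU : set_val g *m set_val h \in unitmx by rewrite unitmx_mul !SU_unit.
have ghV : invmx (set_val g *m set_val h)
    = invmx (set_val h) *m invmx (set_val g).
  rewrite -[RHS]mul1mx -(mulVmx ghU) -!mulmxA mulKVmx ?SU_unit//.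
  by rewrite mulmxV ?SU_unit// mulmx1.
by rewrite /Adj/= [invmx _]ghV !mulmxA.
Qed.

Lemma Adj1 X : Adj (SU_one R n) X = X.
Proof. by rewrite /Adj/= mul1mx invmx1 mulmx1. Qed.

Lemma stab1 mu : stab mu (SU_one R n).
Proof. exact: Adj1. Qed.

Lemma stabM mu g h : stab mu g -> stab mu h -> stab mu (SU_mul g h).
Proof. by rewrite /stab/= AdjM => gS ->. Qed.

Lemma stabV mu g : stab mu g -> stab mu (SU_inv g).
Proof.
rewrite /stab/= => gS; rewrite -[in LHS]gS -AdjM.
suff -> : SU_mul (SU_inv g) g = SU_one R n by exact: Adj1.
by apply: val_inj; rewrite /= mulVmx// SU_unit.
Qed.

Lemma weight_charM mu g h : stab mu g -> stab mu h ->
  weight_char mu (SU_mul g h) = weight_char mu g * weight_char mu h.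
Proof.
rewrite /weight_char; case: xgetP => [chi _ [_ + _]|_ _ _]; first exact.
by rewrite mulr1.
Qed.

Lemma weight_char1 mu : weight_char mu (SU_one R n) = 1.
Proof.
rewrite /weight_char; case: xgetP => // chi _ [_ _ chiT].
rewrite (chiT 0); first last.
- apply/matrixP => i j; rewrite !mxE /expi mulr0 cos0 sin0.
  by case: (i == j).
- by rewrite /trace0 big1// => k _; rewrite mxE.
rewrite /dot big1 => [|k _]; last by rewrite mxE mulr0.
by rewrite /expi mulr0 cos0 sin0.
Qed.

(* (g h, z) ~ (g, chi(h) z) for h in G_mu *)
Definition assoc_eq mu (p r : G * C) : bool :=
  `[< exists h, [/\ stab mu h, p.1 = SU_mul r.1 h
                  & r.2 = weight_char mu h * p.2] >].

Lemma assoc_refl mu : reflexive (assoc_eq mu).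
Proof.
move=> p; apply/asboolP; exists (SU_one R n).
by rewrite SU_mulg1 weight_char1 mul1r; split=> //; exact: stab1.
Qed.

Lemma assoc_imp mu p r : assoc_eq mu p r -> assoc_eq mu r p.
Proof.
move=> /asboolP[h [hS pE rE]]; apply/asboolP; exists (SU_inv h); split.
- exact: stabV.
- by rewrite pE -SU_mulA SU_mulgV SU_mulg1.
- rewrite rE mulrA -weight_charM//; last exact: stabV.
  have -> : SU_mul (SU_inv h) h = SU_one R n.
    by apply: val_inj; rewrite /= mulVmx// SU_unit.
  by rewrite weight_char1 mul1r.
Qed.

Lemma assoc_sym mu : symmetric (assoc_eq mu).
Proof. by move=> p r; apply/idP/idP; exact: assoc_imp. Qed.

Lemma assoc_trans mu : transitive (assoc_eq mu).
Proof.
move=> r p s /asboolP[h [hS pE rE]] /asboolP[k [kS rE' sE]].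
apply/asboolP; exists (SU_mul k h); split; first exact: stabM.
- by rewrite pE rE' SU_mulA.
- by rewrite sE rE weight_charM// mulrA.
Qed.

Definition assoc_rel mu :=
  EquivRel (assoc_eq mu) (assoc_refl mu) (assoc_sym mu) (@assoc_trans mu).

(* G x_(G_mu) C_mu, with the quotient topology *)
Definition assoc_space mu := quotient_topology {eq_quot assoc_rel mu}.

Definition cls mu (g : G) (z : C) : assoc_space mu :=
  \pi_(assoc_space mu) (g, z).

(* the line bundle L_mu over the orbit of mu: [g, z] lies over g . mu *)
Definition orbit_bundle mu : bundle R n 'M[C]_n :=
  @Bundle R n 'M[C]_n (assoc_space mu) setT
    (fun x => Adj (repr x).1 (dmx mu))
    (fun z x => cls mu (repr x).1 (z * (repr x).2))
    (fun g x => cls mu (SU_mul g (repr x).1) (repr x).2).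

Definition basic_line (i j : 'I_n) : bundle R n G :=
  pullback (V R i `&` V R j) (theta R i j)
    (orbit_bundle (vertex R j - vertex R i)).

(* over A = g (exp xi) g^-1 the isomorphism L_ij (x) L_jk -> L_ik defined by
   the section t_ijk = 1 is [g, z] (x) [g, w] |-> [g, z w] *)
Definition basic_prod (i j k : 'I_n) (u : bspace (basic_line i j))
    (v : bspace (basic_line j k)) : bspace (basic_line i k) :=
  xget (u.1, cls _ (SU_one R n) 0) [set x | exists g xi z w,
    [/\ [/\ alcove_at i xi, alcove_at j xi & alcove_at k xi],
        set_val u.1 = Adj g (expt xi),
        u.2 = cls _ g z, v.2 = cls _ g w
      & x = (u.1, cls _ g (z * w))]].

Definition basic_gerbe : gerbe R n := @Gerbe R n basic_line basic_prod.

End BasicGerbe.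

Section GawedzkiReis.
Variables (R : realType) (n : nat).
Local Notation C := (Cplx R).
Local Notation G := (SU R n).

(* The exterior algebra of C^n: w is the family of the coordinates w S of
   w = \sum_S w S e_S, with e_S = e_(s1) /\ ... /\ e_(sp), s1 < ... < sp
   being the elements of S. *)
Definition ext := {ptws {set 'I_n} -> C}.

Definition inversions (S T : {set 'I_n}) : nat :=
  #|[pred p : 'I_n * 'I_n | [&& p.1 \in S, p.2 \in T & (p.2 < p.1)%N]]|.

(* e_S /\ e_T = (-1)^(inversions S T) e_(S u T) if S and T are disjoint *)
Definition wedge (u v : ext) : ext := fun S =>
  \sum_(T : {set 'I_n} | T \subset S)
    (-1) ^+ inversions T (S :\: T) * u T * v (S :\: T).

Definition ext_one : ext := fun S => (S == finset.set0)%:R.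

Definition ext_vec (v : 'cV[C]_n) : ext := fun S =>
  \sum_k (S == [set k]%SET)%:R * v k 0.

(* the algebra automorphism induced by g *)
Definition ext_act (g : 'M[C]_n) (w : ext) : ext := fun S =>
  \sum_(T : {set 'I_n})
    w T * (\big[wedge/ext_one]_(t in T) ext_vec (col t g)) S.

(* eigenlines E_k over the regular elements *)
Definition eigenline (k : 'I_n) : bundle R n G :=
  @Bundle R n G (G * 'cV[C]_n)%type
    [set p | regular R n p.1 /\
             set_val p.1 *m p.2 = expi (q p.1 0 k) *: p.2]
    fst
    (fun z p => (p.1, z *: p.2))
    (fun g p => (SU_conj g p.1, set_val g *m p.2)).

(* sum of the eigenspaces of A for the eigenvalues e^(2 pi sqrt(-1) lambda_k),
   i < k <= j; for A in V_ij it has dimension j - i *)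
Definition spectral (i j : 'I_n) (A : G) : set 'cV[C]_n :=
  [set v | exists u : 'I_n -> 'cV[C]_n,
     (forall k : 'I_n, (i < k <= j)%N ->
        set_val A *m u k = expi (q A 0 k) *: u k) /\
     v = \sum_(k < n | (i < k <= j)%N) u k].

(* The extension of E_(i+1) (x) ... (x) E_j to V_ij: at a regular A the
   tensor product of the eigenlines E_k, i < k <= j, is identified by
   v_(i+1) (x) ... (x) v_j |-> v_(i+1) /\ ... /\ v_j with the top exterior power
   of their sum, and the latter makes sense over V_ij (see GR_extends). All the
   elements of a top exterior power are decomposable. *)
Definition GR_line (i j : 'I_n) : bundle R n G :=
  @Bundle R n G (G * ext)%type
    [set p | (V R i `&` V R j) p.1 /\
       exists v : 'I_n -> 'cV[C]_n, (forall k, spectral i j p.1 (v k)) /\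
         p.2 = \big[wedge/ext_one]_(k < n | (i < k <= j)%N) ext_vec (v k)]
    fst
    (fun z p => (p.1, (fun S => z * p.2 S) : ext))
    (fun g p => (SU_conj g p.1, ext_act (set_val g) p.2)).

Definition GR_prod (i j k : 'I_n) (u : bspace (GR_line i j))
    (v : bspace (GR_line j k)) : bspace (GR_line i k) :=
  (u.1, wedge u.2 v.2).

Definition GR_gerbe : gerbe R n := @Gerbe R n GR_line GR_prod.

(* E_(i+1) (x) ... (x) E_j -> E_ij, v_(i+1) (x) ... (x) v_j |->
   v_(i+1) /\ ... /\ v_j *)
Definition GR_restr (i j : 'I_n) (A : G)
    (v : forall k : {k : 'I_n | (i < k <= j)%N}, bspace (eigenline (val k))) :
    bspace (GR_line i j) :=
  (A, \big[wedge/ext_one]_(k : {k : 'I_n | (i < k <= j)%N})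
        ext_vec (v k).2).

(* E_ij extends the tensor product of eigenlines, and the isomorphisms
   E_ij (x) E_jk -> E_ik extend the evident ones between tensor products of
   eigenlines *)
Definition GR_extends : Prop :=
  (forall i j : 'I_n, (i < j)%N ->
     regular R n `<=` V R i `&` V R j /\
     @tensor_iso R n {k : 'I_n | (i < k <= j)%N} (regular R n)
       (fun k => eigenline (val k)) (GR_line i j) (@GR_restr i j)) /\
  (forall i j k : 'I_n, (i < j < k)%N ->
     forall (A : G) (v : forall l, bspace (eigenline l)), regular R n A ->
     (forall l, btotal (eigenline l) (v l) /\ bproj (v l) = A) ->
     gprod GR_gerbe i j k
       (@GR_restr i j A (fun l => v (val l)))
       (@GR_restr j k A (fun l => v (val l)))
     = @GR_restr i k A (fun l => v (val l))).

End GawedzkiReis.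

(* Main.v *)
Require Import Defs.
From HB Require Import structures.
From mathcomp Require Import fingroup perm.
From mathcomp Require Import all_boot all_order all_algebra all_real_closed.
From mathcomp Require Import all_classical all_reals all_analysis.
From mathcomp Require Import zify ring lra.

(** Every element of SU(n) has the form g (exp xi) g^-1 with g in SU(n) and a
    unique xi in the alcove, and SU(n) x alcove is compact, so SU(n) carries
    the quotient topology of SU(n) x alcove: continuity of maps defined on (a
    part of) SU(n), such as q, can be checked upstairs.

    Put J = {i+1, ..., j} and omega(g) = g e_(i+1) /\ ... /\ g e_j.  Over
    A = g (exp xi) g^-1 in V_ij the fibre of E_ij is the line C omega(g).  Up to
    a multiple of the identity, mu_j - mu_i is the projection onto the span of
    the e_k, k in J; hence its stabilizer consists of the h preserving this
    span and its orthogonal complement, and omega(g h) = chi(h) omega(g) with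
    chi(h) the determinant of h on this span, which is the character of weight
    mu_j - mu_i.  Thus (A, [g, z]) |-> (A, z omega(g)) is a well defined
    isomorphism L_ij -> E_ij.  It is multiplicative because
    omega_ij(g) /\ omega_jk(g) = omega_ik(g), and the properties of the bundles
    L_ij and of their products are transported from those of the E_ij. *)

Set Implicit Arguments.
Unset Strict Implicit.
Unset Printing Implicit Defensive.

Import Order.TTheory GRing.Theory Num.Theory.
Import numFieldNormedType.Exports.

Local Open Scope ring_scope.

(** * Exterior algebra *)

(** Around a matrix with repeated eigenvalues the conjugating [g] cannot in general be chosen
    continuously in [A]. Continuity is therefore never tested on local sections of the
    parametrization: each map is written as a formula in (g, xi), and a tube argument over the
    compact space of parameters brings the limit downstairs. The formulas do not depend on [g]
    because, for xi in A_i and A_j, the numbers e^(2 pi sqrt(-1) xi_k) with k in J differ from those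
    with k outside J; so everything in SU(n) commuting with exp xi stabilizes mu_j - mu_i. The
    character of C_mu is obtained by a choice, so it has to be shown unique on the stabilizer before
    it can be identified with the block determinant. The transport goes from E_ij to L_ij because
    joint continuity of the scaling and of the action on G x_(G_mu) C_mu concerns a product with a
    quotient space and is not immediate, whereas on the exterior algebra these maps are given by
    explicit continuous formulas. *)

Section SetInduction.
Variable n : nat.
Implicit Types S T U : {set 'I_n}.

(** Both lists are strictly increasing with the same elements. Since the wedge product does not
    commute, the order of enumeration matters; this is what allows the first factor to be peeled
    off. *)
Lemma enum_set_min (s : 'I_n) T : (forall t, t \in T -> (s < t)%N) ->
  enum (s |: T)%SET = s :: enum T.
Proof.
move=> sT.
have srt U : sorted (relpre val ltn) (enum U).
  rewrite -sorted_map /enum_mem -enumT /=.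
  apply: (subseq_sorted ltn_trans (s2 := map val (enum 'I_n))).
    by apply: map_subseq; exact: filter_subseq.
  by rewrite val_enum_ord iota_ltn_sorted.
apply: (@irr_sorted_eq _ (relpre val ltn)).
- by move=> a b c; exact: ltn_trans.
- by move=> a /=; rewrite ltnn.
- exact: srt.
- rewrite /= path_min_sorted ?srt//.
  by apply/allP => t; rewrite mem_enum => /sT.
- by move=> t; rewrite inE !mem_enum !inE.
Qed.

(** Removing the least element, rather than an arbitrary one, matches the increasing order of the
    factors in [e_S]. *)
Lemma set_min_ind (P : {set 'I_n} -> Prop) : P finset.set0 ->
  (forall (s : 'I_n) T, (forall t, t \in T -> (s < t)%N) -> P T -> P (s |: T)%SET) ->
  forall T, P T.
Proof.
move=> P0 PS T; move: {2}#|T|.+1 (ltnSn #|T|) => k.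
elim: k T => // k IH T; rewrite ltnS => Tk.
have [->//|/set0Pn[s0 s0T]] := eqVneq T finset.set0.
pose s := [arg min_(t < s0 in T) (t : nat)].
have sT : s \in T by rewrite /s; case: arg_minnP.
have smin t : t \in T -> (s <= t)%N.
  by rewrite /s; case: arg_minnP => // i _; apply.
rewrite -(finset.setD1K sT); apply: PS.
  by move=> t; rewrite !inE => /andP[ts /smin]; rewrite leq_eqVlt val_eqE eq_sym (negPf ts).
by apply: IH; rewrite (cardsD1 s) sT in Tk.
Qed.

Lemma inversionsE S T :
  inversions S T = (\sum_(s in S) \sum_(t in T) (t < s : nat))%N.
Proof.
rewrite /inversions pair_big_dep/= -sum1_card big_mkcond/= [RHS]big_mkcond/=.
apply: eq_bigr => -[s t] _; rewrite inE /=.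
by case: (s \in S); case: (t \in T) => //=; case: ltnP.
Qed.

Lemma inversionsUr S T U : [disjoint T & U] ->
  inversions S (T :|: U)%SET = (inversions S T + inversions S U)%N.
Proof.
move=> TU; rewrite !inversionsE -big_split/=; apply: eq_bigr => s _.
by rewrite -bigU//; apply: eq_bigl => t; rewrite !inE.
Qed.

Lemma inversionsUl S T U : [disjoint S & T] ->
  inversions (S :|: T)%SET U = (inversions S U + inversions T U)%N.
Proof.
move=> TU; rewrite !inversionsE -bigU//=.
by apply: eq_bigl => t; rewrite !inE.
Qed.

Lemma inversions_eq0 S T :
  (forall s t, s \in S -> t \in T -> (s <= t)%N) -> inversions S T = 0%N.
Proof.
move=> ST; rewrite inversionsE big1// => s sS; rewrite big1// => t tT.
by rewrite ltnNge ST.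
Qed.

End SetInduction.

Section Exterior.
Variables (R : realType) (n : nat).
Local Notation C := (Cplx R).
Local Notation ext := (ext R n).
Implicit Types (u v w : ext) (S T U X : {set 'I_n}).

(** The basis vector [e_S] of the exterior algebra. *)
Definition delta S : ext := fun T => (T == S)%:R.

Definition escale (z : C) w : ext := fun S => z * w S.

(* structure constants: e_T /\ e_U = \sum_S wcoef T U S e_S *)
Definition wcoef T U S : C :=
  ([disjoint T & U] && (S == T :|: U)%SET)%:R * (-1) ^+ inversions T U.

(** [wedge] sums over the subsets of [S], the second index being forced. Freeing both indices turns
    the algebraic laws into identities between structure constants. *)
Lemma wedgeE u v S : wedge u v S = \sum_T \sum_U u T * v U * wcoef T U S.
Proof.
rewrite /wedge big_mkcond/=; apply: eq_bigr => T _.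
rewrite (bigD1 (S :\: T)%SET)//= big1 ?addr0 => [|U US]; last first.
  rewrite /wcoef; case: (boolP (_ && _)) => [/andP[TU /eqP SE]|]; last first.
    by rewrite mul0r mulr0.
  case/eqP: US; rewrite SE; apply/setP => x; rewrite !inE.
  by have := disjointFr TU (x := x); case: (x \in T) => //= ->.
rewrite /wcoef; have -> : [disjoint T & S :\: T]%SET.
  by rewrite -setI_eq0; apply/eqP/setP => x; rewrite !inE; case: (x \in T).
rewrite andTb; have -> : (S == T :|: (S :\: T))%SET = (T \subset S).
  apply/eqP/fintype.subsetP => [-> x xT|TS]; first by rewrite !inE xT.
  by apply/setP => x; rewrite !inE; case: (boolP (x \in T)) => // /TS.
case: ifP => _; last by rewrite mul0r mulr0.
by rewrite mul1r [RHS]mulrC mulrA.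
Qed.

Lemma wedge_delta T U : wedge (delta T) (delta U) =
  if [disjoint T & U] then escale ((-1) ^+ inversions T U) (delta (T :|: U)%SET)
  else (fun=> 0).
Proof.
apply: funext => S; rewrite wedgeE (bigD1 T)//= [X in _ + X]big1 ?addr0; last first.
  move=> T' TT'; rewrite big1// => U' _.
  by rewrite /delta (negPf TT') !mul0r.
rewrite (bigD1 U)//= big1 ?addr0 => [|U' UU']; last first.
  by rewrite /delta (negPf UU') mulr0 mul0r.
rewrite /delta !eqxx !mul1r /wcoef /escale /delta.
by case: ifP => //=; rewrite ?mul0r// mulrC.
Qed.

Lemma sum_wcoef T U (F : ext) : \sum_X F X * wcoef T U X =
  [disjoint T & U]%:R * (-1) ^+ inversions T U * F (T :|: U)%SET.
Proof.
rewrite (bigD1 (T :|: U)%SET)//= big1 ?addr0 => [|X /negPf XTU]; last first.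
  by rewrite /wcoef XTU andbF mul0r mulr0.
by rewrite /wcoef eqxx andbT mulrC.
Qed.

(** Both sides vanish unless [T], [U], [W] are pairwise disjoint; otherwise both signs count the
    inversions of the three pairs, by additivity of [inversions]. *)
Lemma wcoef_assoc T U W S : \sum_X wcoef X W S * wcoef T U X =
  \sum_X wcoef T X S * wcoef U W X.
Proof.
rewrite (sum_wcoef T U (fun X => wcoef X W S)).
rewrite (sum_wcoef U W (fun X => wcoef T X S)) /wcoef.
have dU : [disjoint T :|: U & W]%SET = [disjoint T & W] && [disjoint U & W].
  by rewrite -!setI_eq0 finset.setIUl finset.setU_eq0.
have dU' : [disjoint T & U :|: W]%SET = [disjoint T & U] && [disjoint T & W].
  by rewrite -!setI_eq0 finset.setIUr finset.setU_eq0.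
rewrite dU dU' finset.setUA.
case: (boolP [disjoint T & U]) => TU; last by rewrite ?(mul0r, mulr0).
case: (boolP [disjoint U & W]) => UW; last by rewrite andbF ?(mul0r, mulr0).
case: (boolP [disjoint T & W]) => TW; last by rewrite ?(mul0r, mulr0).
rewrite !andTb !mul1r inversionsUl// inversionsUr//.
by rewrite !mulrA -!(mulrC (S == _)%:R) -!mulrA -!exprD; congr (_ * (_ ^+ _)); lia.
Qed.

Lemma wedgeA u v w : wedge u (wedge v w) = wedge (wedge u v) w.
Proof.
apply: funext => S; rewrite !wedgeE.
transitivity (\sum_T \sum_U \sum_W
    u T * v U * w W * \sum_X wcoef T X S * wcoef U W X).
  apply: eq_bigr => T _.
  under eq_bigr => X _ do rewrite wedgeE mulr_sumr mulr_suml.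
  rewrite exchange_big/=; apply: eq_bigr => U _.
  under eq_bigr => X _ do rewrite mulr_sumr mulr_suml.
  rewrite exchange_big/=; apply: eq_bigr => W _; rewrite mulr_sumr.
  by apply: eq_bigr => X _; ring.
transitivity (\sum_W \sum_T \sum_U
    u T * v U * w W * \sum_X wcoef X W S * wcoef T U X); last first.
  rewrite [RHS]exchange_big/=; apply: eq_bigr => W _.
  under [RHS]eq_bigr => X _ do rewrite wedgeE !mulr_suml.
  rewrite [RHS]exchange_big/=; apply: eq_bigr => T _.
  under [RHS]eq_bigr => X _ do rewrite !mulr_suml.
  rewrite [RHS]exchange_big/=; apply: eq_bigr => U _.
  by rewrite mulr_sumr; apply: eq_bigr => X _; ring.
rewrite [RHS]exchange_big/=; apply: eq_bigr => T _.
rewrite [RHS]exchange_big/=; apply: eq_bigr => U _.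
by apply: eq_bigr => W _; rewrite wcoef_assoc.
Qed.

Lemma ext_oneE : @ext_one R n = delta finset.set0.
Proof. by []. Qed.

Lemma wedge1 u : wedge (@ext_one R n) u = u.
Proof.
apply: funext => S; rewrite wedgeE (bigD1 finset.set0)//= [X in _ + X]big1 ?addr0.
  rewrite (bigD1 S)//= big1 ?addr0 => [|U /negPf US].
    rewrite /wcoef /ext_one eqxx finset.set0U eqxx andbT.
    rewrite finset.disjoints_subset finset.sub0set.
    rewrite inversions_eq0 ?mul1r ?mulr1// => s t; by rewrite inE.
  by rewrite /wcoef finset.set0U eq_sym US andbF !mul0r !mulr0.
by move=> T T0; rewrite big1// => U _; rewrite /ext_one (negPf T0) !mul0r.
Qed.

Lemma wedgeu1 u : wedge u (@ext_one R n) = u.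
Proof.
apply: funext => S; rewrite wedgeE exchange_big (bigD1 finset.set0)//=.
rewrite [X in _ + X]big1 ?addr0.
  rewrite (bigD1 S)//= big1 ?addr0 => [|U /negPf US].
    rewrite /wcoef /ext_one eqxx finset.setU0 eqxx andbT disjoint_sym.
    rewrite finset.disjoints_subset finset.sub0set.
    rewrite inversions_eq0 ?mul1r ?mulr1// => s t; by rewrite inE.
  by rewrite /wcoef finset.setU0 eq_sym US andbF !mul0r !mulr0.
by move=> T T0; rewrite big1// => U _; rewrite /ext_one (negPf T0) !(mulr0, mul0r).
Qed.

HB.instance Definition _ :=
  Monoid.isLaw.Build ext (@ext_one R n) (@wedge R n) wedgeA wedge1 wedgeu1.

Lemma wedge_scalel z u v : wedge (escale z u) v = escale z (wedge u v).
Proof.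
apply: funext => S; rewrite /escale !wedgeE mulr_sumr; apply: eq_bigr => T _.
by rewrite mulr_sumr; apply: eq_bigr => U _; rewrite !mulrA.
Qed.

Lemma wedge_scaler z u v : wedge u (escale z v) = escale z (wedge u v).
Proof.
apply: funext => S; rewrite /escale !wedgeE mulr_sumr; apply: eq_bigr => T _.
by rewrite mulr_sumr; apply: eq_bigr => U _; rewrite !mulrA (mulrC _ z).
Qed.

Lemma escaleA a b w : escale a (escale b w) = escale (a * b) w.
Proof. by apply: funext => S; rewrite /escale mulrA. Qed.

Lemma escale1 w : escale 1 w = w.
Proof. by apply: funext => S; rewrite /escale mul1r. Qed.

Lemma escale0 w : escale 0 w = (fun=> 0).
Proof. by apply: funext => S; rewrite /escale mul0r. Qed.

Lemma escalex0 z : escale z (fun=> 0) = (fun=> 0).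
Proof. by apply: funext => S; rewrite /escale mulr0. Qed.

Lemma wedgex0 u : wedge u (fun=> 0) = (fun=> 0).
Proof. by rewrite -(escale0 u) wedge_scaler !escale0. Qed.

Lemma wedge0x u : wedge (fun=> 0) u = (fun=> 0).
Proof. by rewrite -(escale0 u) wedge_scalel !escale0. Qed.

Lemma sum_ext_vec (x : 'cV[C]_n) (F : {set 'I_n} -> C) :
  \sum_T ext_vec x T * F T = \sum_k x k 0 * F [set k]%SET.
Proof.
under eq_bigr => T _ do rewrite /ext_vec mulr_suml.
rewrite exchange_big/=; apply: eq_bigr => k _.
rewrite (bigD1 [set k]%SET)//= eqxx mul1r big1 ?addr0// => T /negPf ->.
by rewrite !mul0r.
Qed.

Lemma wedge_vec (x y : 'cV[C]_n) S : wedge (ext_vec x) (ext_vec y) S =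
  \sum_k \sum_l x k 0 * y l 0 * wcoef [set k]%SET [set l]%SET S.
Proof.
rewrite wedgeE; under eq_bigr => T _.
  under eq_bigr => U _ do rewrite -mulrA.
  rewrite -mulr_sumr sum_ext_vec; over.
rewrite sum_ext_vec; apply: eq_bigr => k _.
by rewrite mulr_sumr; apply: eq_bigr => l _; rewrite mulrA.
Qed.

Lemma inversions11 (k l : 'I_n) : inversions [set k]%SET [set l]%SET = (l < k)%N.
Proof. by rewrite inversionsE big_set1 big_set1. Qed.

Lemma wedge_vecC (x y : 'cV[C]_n) :
  wedge (ext_vec x) (ext_vec y) = escale (-1) (wedge (ext_vec y) (ext_vec x)).
Proof.
apply: funext => S; rewrite /escale !wedge_vec mulr_sumr exchange_big/=.
apply: eq_bigr => l _; rewrite mulr_sumr; apply: eq_bigr => k _.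
rewrite (mulrC (x k 0)) [RHS]mulrCA; apply: congr1.
rewrite /wcoef !inversions11 disjoint_sym finset.setUC.
case: (boolP (_ && _)) => [/andP[+ _]|]; last by rewrite !mul0r mulr0.
rewrite disjoints1 inE => lk; rewrite !mul1r.
by case: ltngtP lk => [||/val_inj ->]; rewrite ?eqxx// ?expr0 ?expr1 ?mulr1 ?mulrNN ?mulr1.
Qed.

Lemma wedge_vecvec (x : 'cV[C]_n) : wedge (ext_vec x) (ext_vec x) = (fun=> 0).
Proof.
apply: funext => S; have /(congr1 (fun f : ext => f S)) := wedge_vecC x x.
rewrite /escale mulN1r => /eqP; rewrite -addr_eq0 -mulr2n mulrn_eq0 /=.
by move/eqP.
Qed.

(** The factors occur in increasing order of their index, the order in which ordinals are
    enumerated. *)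
Definition bwedge (x : 'I_n -> 'cV[C]_n) T : ext :=
  \big[@wedge R n/@ext_one R n]_(t in T) ext_vec (x t).

Lemma bwedgeE x T :
  bwedge x T = \big[@wedge R n/@ext_one R n]_(t <- enum T) ext_vec (x t).
Proof. by rewrite /bwedge /enum_mem big_filter [index_enum _]unlock. Qed.

Lemma bwedge_min x (s : 'I_n) T : (forall t, t \in T -> (s < t)%N) ->
  bwedge x (s |: T)%SET = wedge (ext_vec (x s)) (bwedge x T).
Proof.
by move=> sT; rewrite !bwedgeE enum_set_min// big_cons.
Qed.

Lemma bwedge0 x : bwedge x finset.set0 = @ext_one R n.
Proof. by rewrite /bwedge big_set0. Qed.

Lemma bwedge1 x s : bwedge x [set s]%SET = ext_vec (x s).
Proof.
rewrite -[[set s]%SET]finset.setU0 bwedge_min ?bwedge0 ?wedgeu1// => t.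
by rewrite inE.
Qed.

Lemma min_notin (s : 'I_n) T : (forall t, t \in T -> (s < t)%N) -> s \notin T.
Proof. by move=> sT; apply/negP => /sT; rewrite ltnn. Qed.

Lemma inversions_min (s : 'I_n) T : (forall t, t \in T -> (s < t)%N) ->
  inversions [set s]%SET T = 0%N.
Proof.
by move=> sT; apply: inversions_eq0 => a t /set1P-> /sT/ltnW.
Qed.

(** The new factor moves right past each factor of smaller index, at the cost of one sign each; the
    number of these is the inversion count. If it meets a copy of itself, the product vanishes. *)
Lemma wedge_bwedge x s T : wedge (ext_vec (x s)) (bwedge x T) =
  if s \in T then fun=> 0
  else escale ((-1) ^+ inversions [set s]%SET T) (bwedge x (s |: T)%SET).
Proof.
elim/set_min_ind: T => [|t T tT IH].
  rewrite inE inversions_min ?escale1 -?bwedge_min// => t; by rewrite inE.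
rewrite !inE; have [->|st] := eqVneq s t.
  by rewrite bwedge_min// wedgeA wedge_vecvec wedge0x.
have [lst|lts] := ltnP s t.
  have sT r : r \in (t |: T)%SET -> (s < r)%N.
    by rewrite !inE => /orP[/eqP->//|/tT]; exact: ltn_trans.
  have -> : s \in T = false by apply/negP => /tT; rewrite ltnNge ltnW.
  by rewrite inversions_min// escale1 (bwedge_min x sT).
have {}lts : (t < s)%N by rewrite ltn_neqAle lts andbT eq_sym.
rewrite bwedge_min// wedgeA wedge_vecC wedge_scalel -wedgeA IH /=.
case: (boolP (s \in T)) => sT; first by rewrite wedgex0 escalex0.
rewrite wedge_scaler -bwedge_min; last first.
  by move=> u; rewrite !inE => /orP[/eqP->//|/tT].
rewrite escaleA -exprS finset.setUCA; congr (escale (_ ^+ _) _).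
rewrite inversionsUr ?inversions11 ?lts//.
by rewrite disjoints1 min_notin.
Qed.

(** For any family [x], the products [bwedge x T] multiply with the structure constants of the
    [e_T]; this is why a linear map induces an algebra morphism. *)
Lemma bwedgeM x S T : wedge (bwedge x S) (bwedge x T) =
  if [disjoint S & T]
  then escale ((-1) ^+ inversions S T) (bwedge x (S :|: T)%SET)
  else fun=> 0.
Proof.
elim/set_min_ind: S => [|s S sS IH].
  rewrite bwedge0 wedge1 inversions_eq0 => [|? ?]; last by rewrite inE.
  by rewrite finset.disjoints_subset finset.sub0set finset.set0U escale1.
rewrite bwedge_min// -wedgeA IH.
have -> : [disjoint s |: S & T]%SET = (s \notin T) && [disjoint S & T].
  by rewrite -!setI_eq0 finset.setIUl finset.setU_eq0 !setI_eq0 disjoints1.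
case: (boolP [disjoint S & T]) => ST; last by rewrite andbF wedgex0.
rewrite andbT wedge_scaler wedge_bwedge !inE (negPf (min_notin sS)) /=.
case: (boolP (s \in T)) => sT /=; first by rewrite escalex0.
rewrite escaleA -exprD finset.setUA; congr (escale (_ ^+ _) _).
rewrite inversionsUr// inversionsUl ?disjoints1 ?min_notin//.
by rewrite (inversions_min sS) add0n addnC.
Qed.

Definition stdvec (k : 'I_n) : 'cV[C]_n := delta_mx k 0.

Lemma ext_vec_std k : ext_vec (stdvec k) = delta [set k]%SET.
Proof.
apply: funext => S; rewrite /ext_vec /delta (bigD1 k)//= !mxE !eqxx mulr1.
by rewrite big1 ?addr0// => l /negPf lk; rewrite !mxE lk mulr0.
Qed.

Lemma bwedge_std T : bwedge stdvec T = delta T.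
Proof.
elim/set_min_ind: T => [|s T sT IH]; first by rewrite bwedge0.
rewrite bwedge_min// IH ext_vec_std wedge_delta disjoints1 min_notin//.
by rewrite inversions_min// escale1.
Qed.

(** The factors lie in the span of the [e_l], [l] in [J], whose top exterior power is the line of
    [e_J]. The coefficient is the determinant of the [J] block. *)
Lemma bwedge_support (y : 'I_n -> 'cV[C]_n) (J : {set 'I_n}) :
  (forall k l, k \in J -> l \notin J -> y k l 0 = 0) ->
  bwedge y J = escale (bwedge y J J) (delta J).
Proof.
move=> yJ.
(* Support and degree together: a nonzero coordinate [S] lies in [J] and has as many elements as
   there are factors, so [S = J] once [T = J]. *)
have H T : T \subset J -> forall S, bwedge y T S != 0 ->
    (S \subset J) && (#|S| == #|T|).
  elim/set_min_ind: T => [_ S|s T sT IH].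
    rewrite bwedge0 /ext_one; have [->|_] := eqVneq S finset.set0.
      by rewrite finset.sub0set cards0.
    by rewrite eqxx.
  rewrite finset.subUset finset.sub1set => /andP[sJ TJ] S.
  rewrite bwedge_min// wedgeE; apply: contraNT => H0.
  under eq_bigr => A _.
    under eq_bigr => B _ do rewrite -mulrA.
    rewrite -mulr_sumr; over.
  rewrite sum_ext_vec big1// => k _.
  have [kJ|kJ] := boolP (k \in J); last by rewrite yJ// mul0r.
  rewrite big1 ?mulr0// => B _.
  have [->|B0] := eqVneq (bwedge y T B) 0; first by rewrite mul0r.
  have /andP[BJ /eqP Bc] := IH TJ B B0.
  rewrite /wcoef; case: (boolP (_ && _)) => [|_]; last by rewrite mul0r mulr0.
  rewrite disjoints1 => /andP[kB /eqP SE]; case/negP: H0.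
  rewrite SE finset.subUset finset.sub1set kJ BJ/= cardsU1 kB Bc.
  by rewrite cardsU1 min_notin.
apply: funext => S; rewrite /escale /delta.
have [->|SJ] := eqVneq S J; first by rewrite mulr1.
rewrite mulr0; apply/eqP; apply: contraNT SJ => /(H J (subxx _)).
by move=> /andP[sSJ /eqP cSJ]; rewrite eqEcard sSJ cSJ leqnn.
Qed.

Lemma ext_actE (g : 'M[C]_n) w S :
  ext_act g w S = \sum_T w T * bwedge (fun t => col t g) T S.
Proof. by []. Qed.

Lemma ext_act_delta (g : 'M[C]_n) T :
  ext_act g (delta T) = bwedge (fun t => col t g) T.
Proof.
apply: funext => S; rewrite ext_actE (bigD1 T)//= /delta eqxx mul1r.
by rewrite big1 ?addr0// => U /negPf ->; rewrite mul0r.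
Qed.

Lemma ext_act_scale (g : 'M[C]_n) z w :
  ext_act g (escale z w) = escale z (ext_act g w).
Proof.
apply: funext => S; rewrite /escale !ext_actE mulr_sumr.
by apply: eq_bigr => T _; rewrite mulrA.
Qed.

Lemma ext_act_one (g : 'M[C]_n) : ext_act g (@ext_one R n) = @ext_one R n.
Proof. by rewrite ext_oneE ext_act_delta bwedge0. Qed.

Lemma ext_act_vec (g : 'M[C]_n) (x : 'cV[C]_n) :
  ext_act g (ext_vec x) = ext_vec (g *m x).
Proof.
apply: funext => S; rewrite ext_actE sum_ext_vec.
under eq_bigr => k _ do rewrite bwedge1 /ext_vec mulr_sumr.
rewrite exchange_big/=; apply: eq_bigr => l _; rewrite mxE mulr_sumr.
by apply: eq_bigr => k _; rewrite !mxE mulrCA; congr (_ * _); rewrite mulrC.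
Qed.

(** By bilinearity only basis vectors matter, and by [bwedgeM] their images [E T] multiply as the
    [e_T] do. *)
Lemma ext_act_wedge (g : 'M[C]_n) u v :
  ext_act g (wedge u v) = wedge (ext_act g u) (ext_act g v).
Proof.
apply: funext => S; rewrite wedgeE.
pose E T := bwedge (fun t => col t g) T.
have actE w X : ext_act g w X = \sum_T w T * E T X by [].
rewrite actE.
have key T U : \sum_X E X S * wcoef T U X = wedge (E T) (E U) S.
  rewrite (sum_wcoef T U (fun X => E X S)) bwedgeM.
  by case: ifP => _; rewrite ?mul0r// mul1r.
transitivity (\sum_T \sum_U u T * v U * wedge (E T) (E U) S).
  under eq_bigr => X _ do rewrite wedgeE mulr_suml.
  rewrite exchange_big/=; apply: eq_bigr => T _.
  under eq_bigr => X _ do rewrite mulr_suml.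
  rewrite exchange_big/=; apply: eq_bigr => U _.
  by rewrite -key mulr_sumr; apply: eq_bigr => X _; ring.
transitivity (\sum_T \sum_U \sum_A \sum_B
    u T * v U * (E T A * E U B * wcoef A B S)).
  apply: eq_bigr => T _; apply: eq_bigr => U _.
  by rewrite wedgeE mulr_sumr; apply: eq_bigr => A _; rewrite mulr_sumr.
transitivity (\sum_A \sum_B \sum_T \sum_U
    u T * v U * (E T A * E U B * wcoef A B S)).
  under eq_bigr => T _ do rewrite exchange_big/=.
  rewrite exchange_big/=; apply: eq_bigr => A _.
  under eq_bigr => T _ do rewrite exchange_big/=.
  by rewrite exchange_big.
apply: eq_bigr => A _; apply: eq_bigr => B _.
rewrite !actE !mulr_suml; apply: eq_bigr => T _.
rewrite mulr_sumr mulr_suml; apply: eq_bigr => U _.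
by ring.
Qed.

Lemma ext_act_big (g : 'M[C]_n) (I : Type) (r : seq I) (P : pred I)
    (x : I -> 'cV[C]_n) :
  ext_act g (\big[@wedge R n/@ext_one R n]_(i <- r | P i) ext_vec (x i)) =
  \big[@wedge R n/@ext_one R n]_(i <- r | P i) ext_vec (g *m x i).
Proof.
rewrite (big_morph _ (ext_act_wedge g) (ext_act_one g)).
by under eq_bigr => i _ do rewrite ext_act_vec.
Qed.

Lemma ext_act_bwedge (g : 'M[C]_n) x T :
  ext_act g (bwedge x T) = bwedge (fun t => g *m x t) T.
Proof. exact: ext_act_big. Qed.

Lemma ext_actM (g h : 'M[C]_n) w : ext_act (g *m h) w = ext_act g (ext_act h w).
Proof.
apply: funext => S; rewrite !ext_actE.
under [RHS]eq_bigr => X _ do rewrite ext_actE mulr_suml.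
rewrite exchange_big/=; apply: eq_bigr => T _.
under [RHS]eq_bigr => X _ do rewrite -mulrA.
rewrite -mulr_sumr; congr (_ * _).
transitivity (ext_act g (bwedge (fun t => col t h) T) S) => //.
rewrite ext_act_bwedge; congr (bwedge _ _ _).
by apply: funext => t; rewrite !colE mulmxA.
Qed.

Lemma ext_act1 w : ext_act 1%:M w = w.
Proof.
apply: funext => S; rewrite ext_actE (bigD1 S)//= big1 ?addr0 => [|T TS].
  have -> : (fun t => col t (1%:M : 'M[C]_n)) = stdvec.
    by apply: funext => t; rewrite colE mul1mx.
  by rewrite bwedge_std /delta eqxx mulr1.
have -> : (fun t => col t (1%:M : 'M[C]_n)) = stdvec.
  by apply: funext => t; rewrite colE mul1mx.
by rewrite bwedge_std /delta eq_sym (negPf TS) mulr0.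
Qed.

End Exterior.

(** * The alcove and conjugacy classes *)

Section Phases.
Variable R : realType.
Local Notation C := (Cplx R).

Lemma expi0 : expi 0 = 1 :> C.
Proof. by rewrite /expi mulr0 cos0 sin0. Qed.

Lemma expiD (x y : R) : expi (x + y) = expi x * expi y.
Proof.
rewrite /expi mulrDr cosD sinD; apply/eqP; rewrite eq_complex /=.
by rewrite eqxx/= addrC [sin _ * _]mulrC [cos _ * sin (2 * pi * x)]mulrC eqxx.
Qed.

Lemma expiN (x : R) : expi x * expi (- x) = 1.
Proof. by rewrite -expiD subrr expi0. Qed.

Lemma expi_neq0 (x : R) : expi x != 0.
Proof.
by apply/eqP => x0; have /eqP := expiN x; rewrite x0 mul0r eq_sym oner_eq0.
Qed.

Lemma conj_expi (x : R) : (expi x : C)^* = expi (- x).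
Proof. by rewrite /expi mulrN cosN sinN. Qed.

Lemma expi1 : expi 1 = 1 :> C.
Proof.
by rewrite /expi mulr1 mulr_natl cos2pi sin2pi.
Qed.

Lemma expiX (x : R) m : expi x ^+ m = expi (x *+ m) :> C.
Proof.
by elim: m => [|m IH]; rewrite ?expi0// exprS IH -expiD mulrS.
Qed.

Lemma expi_nat (m : nat) : expi m%:R = 1 :> C.
Proof.
by elim: m => [|m IH]; rewrite ?expi0// -natr1 expiD IH expi1 mulr1.
Qed.

Lemma expi_int (m : int) : expi m%:~R = 1 :> C.
Proof.
case: m => m; first exact: expi_nat.
by rewrite NegzE mulrNz; have := expiN m.+1%:R; rewrite expi_nat mul1r.
Qed.

Lemma expi_neq1 (x : R) : 0 < x < 1 -> expi x != 1.
Proof.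
move=> /andP[x0 x1]; apply/eqP => -[] + _.
(* By the double angle formula, [cos (2 pi x) = 1] would force [sin (pi x) = 0], whereas [pi x] lies
   strictly between 0 and [pi]. *)
have -> : 2 * pi * x = (pi * x) *+ 2 by rewrite mulr2n; ring.
rewrite cos_mulr2n cos2sin2 => /eqP.
have s0 : 0 < sin (pi * x).
  by rewrite sin_gt0_pi// mulr_gt0 ?pi_gt0//= -[ltRHS]mulr1 ltr_pM2l ?pi_gt0.
have := mulr_gt0 s0 s0; rewrite -expr2 => s20 /eqP ?; lra.
Qed.

Lemma expi_inj (x y : R) : expi x = expi y -> exists m : int, x = y + m%:~R.
Proof.
move=> xy; pose d := x - y; exists (Num.floor d).
have := floor_itv d; set m := Num.floor d => /andP[md dm].
suff : d - m%:~R = 0 by rewrite /d => /eqP; rewrite subr_eq0 subr_eq addrC => /eqP.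
apply/eqP; apply: contraTT isT => /eqP dm0.
have : expi (d - m%:~R) != 1.
  apply: expi_neq1; rewrite intrD in dm; apply/andP; split; last lra.
  by rewrite lt_neqAle eq_sym; apply/andP; split; [exact/eqP|lra].
rewrite expiD -mulrNz expi_int mulr1 /d expiD xy -expiD subrr expi0.
by rewrite eqxx.
Qed.

Lemma expi_onto (z : C) : z * z^* = 1 -> exists x, z = expi x.
Proof.
case: z => a b; rewrite /Num.conj/= => -[] + _.
rewrite mulrN opprK -!expr2 => ab.
have a1 : -1 <= a <= 1.
  rewrite -ler_norml -(expr_le1 (n := 2))// real_normK ?num_real//.
  by have := sqr_ge0 b; lra.
have sq : Num.sqrt (1 - a ^+ 2) = `|b| by rewrite -ab addrAC subrr add0r sqrtr_sqr.
have P x : 2 * pi * (x / (2 * pi)) = x :> R.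
  by rewrite mulrC divfK// mulf_neq0 ?pnatr_eq0// lt0r_neq0// pi_gt0.
have [b0|b0] := leP 0 b.
  exists (acos a / (2 * pi)); rewrite /expi P acosK ?in_itv//.
  by rewrite sin_acos// sq ger0_norm.
exists (- acos a / (2 * pi)); rewrite /expi P cosN sinN acosK ?in_itv//.
by rewrite sin_acos// sq ltr0_norm// opprK.
Qed.

Lemma expi_sum (I : Type) (r : seq I) (P : pred I) (x : I -> R) :
  expi (\sum_(i <- r | P i) x i) = \prod_(i <- r | P i) expi (x i).
Proof. by rewrite (big_morph _ expiD expi0). Qed.

End Phases.

(** * Gaps between eigenvalues, and points of the alcove modulo permutations and integers *)

Section Alcove.
Variables (R : realType) (n : nat).
Local Notation C := (Cplx R).
Implicit Types xi : 'rV[R]_n.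

(** The ordinary gaps telescope to monotonicity; the last gap, which wraps around, bounds the
    difference of the extreme coordinates by 1 and hence all differences. *)
Lemma alcoveP xi : alcove xi <-> [/\ trace0 xi,
  forall i j : 'I_n, (i <= j)%N -> xi 0 j <= xi 0 i &
  forall i j : 'I_n, xi 0 i - xi 0 j <= 1].
Proof.
split=> [[xi0 gapxi]|[xi0 xile xi1]]; last first.
  split=> // i; rewrite /gap; have [/eqP iE|iE] := eqVneq i.+1 n.
    by have := xi1 (ordS i) i; rewrite mulr1n; lra.
  have -> : false%:R = 0 :> R by [].
  suff : xi 0 (ordS i) <= xi 0 i by lra.
  by apply: xile; rewrite /= modn_small ?leqnSn// ltn_neqAle iE ltn_ord.
have mono : forall i j : 'I_n, (i <= j)%N -> xi 0 j <= xi 0 i.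
  move=> i j; move Ed : (j - i)%N => d; elim: d i j Ed => [|d IH] i j Ed ij.
    by have -> : i = j by apply/val_inj/eqP; rewrite eqn_leq ij/= -subn_eq0 Ed.
  have iS : (i.+1 < n)%N by have := ltn_ord j; lia.
  apply: (@le_trans _ _ (xi 0 (ordS i))).
    by apply: IH => /=; rewrite modn_small//; lia.
  have := gapxi i; rewrite /gap ltn_eqF//= mulr0n; lra.
split=> // i j.
have n0 : (0 < n)%N by exact: leq_ltn_trans (ltn_ord i).
have nS : (n.-1 < n)%N by rewrite prednK.
pose l := Ordinal nS; pose f := Ordinal n0.
have il : xi 0 i <= xi 0 f by apply: mono.
have lj : xi 0 l <= xi 0 j by apply: mono; rewrite /= -ltnS prednK.
have := gapxi l; rewrite /gap /= prednK// eqxx.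
have -> : ordS l = f by apply: val_inj; rewrite /= prednK// modnn.
by rewrite mulr1n; lra.
Qed.

Lemma gap_lt xi (i k l : 'I_n) : alcove xi -> 0 < gap xi i ->
  (k <= i < l)%N -> xi 0 l < xi 0 k.
Proof.
move=> /alcoveP[_ mono _] gi /andP[ki il].
have iS : (i.+1 < n)%N by exact: leq_ltn_trans (ltn_ord l).
apply: le_lt_trans (lt_le_trans (y := xi 0 i) _ _); last exact: mono.
  by apply: (mono (ordS i)); rewrite /= modn_small.
by move: gi; rewrite /gap ltn_eqF//= mulr0n; lra.
Qed.

(** If [j] is the last index, its gap is the one that wraps around. Otherwise [xi k] strictly
    exceeds the last coordinate, from which [xi l] differs by at most 1. *)
Lemma gap_wrap xi (j k l : 'I_n) : alcove xi -> 0 < gap xi j -> (k <= j)%N ->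
  xi 0 l - xi 0 k < 1.
Proof.
move=> A gj kj; have /alcoveP[_ mono le1] := A.
have n0 : (0 < n)%N by exact: leq_ltn_trans (ltn_ord j).
have nS : (n.-1 < n)%N by rewrite prednK.
pose z := Ordinal nS; pose f := Ordinal n0.
have [jE|jE] := eqVneq j.+1 n.
  have zk : xi 0 j <= xi 0 k by apply: mono.
  have lf : xi 0 l <= xi 0 f by apply: mono.
  move: gj; rewrite /gap jE eqxx.
  have -> : ordS j = f by apply: val_inj; rewrite /= jE modnn.
  by rewrite mulr1n; lra.
have zk : xi 0 z < xi 0 k.
  by apply: (@gap_lt _ j) => //; rewrite kj/=; have := ltn_ord j; lia.
by have := le1 l z; lra.
Qed.

(** The strict gaps at [i] and [j] cut the circle of eigenvalues into two arcs. In both cases, [l]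
    at most [i] and [l] beyond [j], the larger coordinate minus the smaller lies strictly between 0
    and 1. *)
Lemma alcove_separated xi (i j k l : 'I_n) :
  alcove_at i xi -> alcove_at j xi -> (i < k <= j)%N -> ~~ (i < l <= j)%N ->
  expi (xi 0 k) != expi (xi 0 l).
Proof.
move=> [A gi] [_ gj] /andP[ik kj]; rewrite negb_and -leqNgt -ltnNge => H.
have neq1 (x y : R) : expi (x - y) != 1 -> expi x != expi y.
  by apply: contra => /eqP xy; rewrite expiD xy expiN.
have [li|il] := leqP l i.
  rewrite eq_sym; apply/neq1/expi_neq1.
  have := gap_lt A gi (k := l) (l := k); rewrite li ik => /(_ isT).
  by have := gap_wrap l A gj kj; lra.
have {H}jl : (j < l)%N by move: H; rewrite leqNgt il.
apply/neq1/expi_neq1; have := gap_lt A gj (k := k) (l := l).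
rewrite kj jl => /(_ isT).
have := gap_lt A gi (k := i) (l := k); rewrite leqnn ik => /(_ isT).
by have /alcoveP[_ _ /(_ i l)] := A; lra.
Qed.

Let level xi (x : R) : int := \sum_k Num.floor (xi 0 k - x).

(** If [x] is at most [xi k], the [k + 1] floors with [l <= k] are at least 0 and the others at
    least -1. Otherwise the floors with [l < k] are at most 0 and the [n - k] others at most -1. The
    resulting bounds, [k + 1 - n] below and [k - n] above, exclude each other. *)
Let le_level xi (k : 'I_n) x : alcove xi ->
  (x <= xi 0 k) = (k.+1%:Z - n%:Z <= level xi x).
Proof.
move=> /alcoveP[_ mono le1].
have cnt (P : pred 'I_n) (a b : int) : \sum_(l < n) (if P l then a else b)
    = a * #|P|%:Z + b * (n%:Z - #|P|%:Z).
  rewrite (bigID P)/= (eq_bigr (fun=> a)); last by move=> l ->.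
  rewrite [X in _ + X](eq_bigr (fun=> b)); last by move=> l /negPf->.
  rewrite !sumr_const -[a *+ _]mulr_natr -[b *+ _]mulr_natr.
  congr (_ * _ + _ * _); first by rewrite natz.
  have := cardC P; rewrite card_ord natz.
  rewrite (@eq_card _ [predC P] (fun i => ~~ P i)) //.
  by move: (#|P|) (#|fun i => ~~ P i|) => p c pc; rewrite -[in RHS]pc PoszD addrAC subrr add0r.
  have clt m : (m <= n)%N -> #|[pred l : 'I_n | (l < m)%N]| = m.
    move=> mn; rewrite -sum1_card -[RHS]card_ord -sum1_card.
    by rewrite (big_ord_widen n (fun=> 1%N) mn).
have [xk|kx] := leP x (xi 0 k).
  apply/esym.
  have : \sum_(l < n) (if (l <= k)%N then 0 else -1) <= level xi x.
    apply: ler_sum => l _; case: leqP => lk; rewrite floor_ge_int.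
      by have := mono _ _ lk; lra.
    by have := le1 k l; rewrite mulrN1z; lra.
  by rewrite (cnt [pred l : 'I_n | (l < k.+1)%N]) clt ?ltn_ord//; lia.
apply/esym/negbTE; rewrite -ltNge.
have : level xi x <= \sum_(l < n) (if (l < k)%N then 0 else -1).
  apply: ler_sum => l _; rewrite -ltzD1 floor_lt_int; case: ltnP => lk.
    by have := le1 l k; rewrite add0r mulr1z; lra.
  by have := mono _ _ lk; rewrite addNr; lra.
rewrite (cnt [pred l : 'I_n | (l < k)%N]) clt; last exact: ltnW.
rewrite mul0r add0r mulN1r opprB.
by move: (level xi x) (nat_of_ord k) => L m; clear => *; lia.
Qed.

(* [level xi x] only depends on the residues modulo 1 of the entries, up to
   permutation, and determines which entries are at least [x]. *)
Lemma alcove_inj xi xi' (s : 'S_n) : alcove xi -> alcove xi' ->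
  (forall k, expi (xi' 0 (s k)) = expi (xi 0 k)) -> xi = xi'.
Proof.
move=> A A' ss.
pose m k := Num.floor (xi' 0 (s k) - xi 0 k).
have mE k : xi' 0 (s k) = xi 0 k + (m k)%:~R.
  have [d dE] := expi_inj (ss k).
  by rewrite /m dE addrAC subrr add0r intrKfloor.
have m0 : \sum_k m k = 0.
  have [[t0 _] [t0' _]] := (A, A').
  have : \sum_k xi' 0 (s k) = 0 by rewrite -[RHS]t0' [RHS](reindex_inj (@perm_inj _ s)).
  under eq_bigr do rewrite mE.
  rewrite big_split/= t0 add0r -(raddf_sum (intr : int -> R)) => /eqP.
  by rewrite intr_eq0 => /eqP.
have lE x : level xi x = level xi' x.
  rewrite /level [RHS](reindex_inj (@perm_inj _ s))/=.
  under [RHS]eq_bigr do rewrite mE addrAC floorDrz ?intr_int// intrKfloor.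
  by rewrite big_split/= m0 addr0.
(* Each inequality between [xi 0 k] and [xi' 0 k] is read off the common level function and becomes
   a reflexive one. *)
apply/rowP => k; apply/eqP; rewrite eq_le.
rewrite (le_level _ _ A') -lE -(le_level _ _ A) lexx.
by rewrite (le_level _ _ A) lE -(le_level _ _ A') lexx.
Qed.

End Alcove.

(** * Simultaneous unitary diagonalization *)

Section Spectral.
Variables (C : numClosedFieldType) (n : nat).
Implicit Types (A B M : 'M[C]_n) (d : 'rV[C]_n).
Local Open Scope sesquilinear_scope.

Lemma char_poly_diag d : char_poly (diag_mx d) = \prod_k ('X - (d 0 k)%:P).
Proof.
rewrite char_poly_trig; first by apply: eq_bigr => k _; rewrite !mxE eqxx.
by apply/is_trig_mxP => i j ij; rewrite !mxE -val_eqE ltn_eqF.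
Qed.

Lemma char_poly_conj A B (u : 'M[C]_n) : u \in unitmx -> A *m u = u *m B ->
  char_poly A = char_poly B.
Proof.
move=> uU AB; rewrite /char_poly; set U := map_mx polyC u.
have U0 : \det U != 0.
  by rewrite det_map_mx polyC_eq0 -unitfE -unitmxE.
apply: (mulIf U0); rewrite -[LHS]det_mulmx mulrC -[RHS]det_mulmx.
congr (\det _); rewrite /char_poly_mx mulmxBl mulmxBr -!map_mxM AB.
by rewrite mul_scalar_mx mul_mx_scalar.
Qed.

Lemma mup_char_poly_diag d a :
  mup a (char_poly (diag_mx d)) = #|[pred k | d 0 k == a]|.
Proof.
rewrite char_poly_diag -sum1_card.
have H (r : seq 'I_n) : mup a (\prod_(k <- r) ('X - (d 0 k)%:P)) =
    (\sum_(k <- r | d 0%R k == a) 1)%N.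
  elim: r => [|k r IH]; first by rewrite !big_nil mupNroot// rootC oner_eq0.
  rewrite !big_cons mupM ?polyXsubC_eq0 ?monic_neq0 ?monic_prod_XsubC// IH.
  by rewrite -['X - _]expr1 mup_XsubCX; case: eqP.
exact: H.
Qed.

(** Similar matrices have the same characteristic polynomial, and its root multiplicities count the
    occurrences of each diagonal entry. *)
Lemma diag_similar_perm d d' (u : 'M[C]_n) : u \in unitmx ->
  diag_mx d' *m u = u *m diag_mx d ->
  exists s : {perm 'I_n}, forall k, d' 0 (s k) = d 0 k.
Proof.
move=> uU dd'; have cp := char_poly_conj uU dd'.
have pe : perm_eq [tuple d 0 k | k < n] [tuple d' 0 k | k < n].
  apply/allP => a _ /=; apply/eqP; rewrite !count_map.
  have cE (e : 'rV[C]_n) : count (preim id (preim [eta e 0] (pred1 a)))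
      (Finite.enum 'I_n) = #|[pred k | e 0 k == a]|.
    by rewrite cardE -size_filter /enum_mem.
  by rewrite (cE d) (cE d') -!mup_char_poly_diag cp.
have /tuple_permP[s sE] := pe; exists s => k.
have /(congr1 (fun t => tnth t k)) := val_inj sE.
by rewrite !tnth_mktuple.
Qed.

Lemma diag_perm d (s : {perm 'I_n}) :
  diag_mx d *m perm_mx s^-1 = perm_mx s^-1 *m diag_mx (\row_k d 0 (s k)).
Proof.
apply/matrixP => i j; rewrite mul_diag_mx mul_mx_diag !mxE.
by case: eqP => [<-|_]; rewrite ?mulr0 ?mul0r// permKV mulr1 mul1r.
Qed.

Lemma perm_mx_unitary (s : {perm 'I_n}) :
  (perm_mx s : 'M[C]_n) \is unitarymx.
Proof.
apply/unitarymxP; rewrite tr_perm_mx map_perm_mx -perm_mxM mulgV.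
by rewrite perm_mx1.
Qed.

(* The commuting normal matrices M, Q are diagonal in a common orthonormal
   basis, which can be reordered so that Q gets back its original form. *)
Lemma unitary_spectral M (b : 'rV[C]_n) :
  M \is unitarymx -> M *m diag_mx b = diag_mx b *m M ->
  (forall k, (b 0 k)^* = b 0 k) ->
  exists (u : 'M[C]_n) (d : 'rV[C]_n), [/\ u \is unitarymx,
    M *m u = u *m diag_mx d & diag_mx b *m u = u *m diag_mx b].
Proof.
move=> MU Mb br; set Q := diag_mx b in Mb *.
have Qh : Q ^t* = Q.
  rewrite tr_diag_mx map_diag_mx; congr diag_mx.
  by apply/rowP => k; rewrite mxE; exact: br.
have MMt : M *m M ^t* = 1%:M by exact/unitarymxP.
have MtM : M ^t* *m M = 1%:M by exact: mulmx1C.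
have QMt : Q *m M ^t* = M ^t* *m Q.
  by rewrite -{1}Qh -[in RHS]Qh -!map_mxM -!trmx_mul Mb.
(* The adjoint of [M] is included so that [M] becomes triangular together with its adjoint, hence
   diagonal; [Q] is its own adjoint. *)
have [] := @cotrigonalization C n [:: M; M ^t*; Q].
  move=> X Y; rewrite !inE => /or3P[] /eqP-> /or3P[] /eqP->//;
    rewrite /comm_mx ?MMt ?MtM//.
move=> P PU; rewrite /= andbT => /and3P[].
have PuU := unitarymx_unit PU.
rewrite /similar_to/= !conjumx// => tM tMt tQ.
have cj X : (P *m X *m invmx P) ^t* = P *m X ^t* *m invmx P.
  by rewrite invmx_unitary// !trmx_mul !map_mxM/= trmxCK mulmxA.
have diagP X : is_trig_mx (P *m X *m invmx P) ->
    is_trig_mx (P *m X ^t* *m invmx P) ->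
    exists e, X *m invmx P = invmx P *m diag_mx e.
  move=> /is_trig_mxP t1; rewrite -cj => /is_trig_mxP t2.
  exists (\row_k (P *m X *m invmx P) k k).
  rewrite -[LHS](mulKmx PuU); congr (_ *m _); rewrite !mulmxA.
  apply/matrixP => i j; rewrite [RHS]mxE [in RHS]mxE.
  case: (ltngtP i j) => [ij|ji|/val_inj->].
  - by rewrite t1// -val_eqE ltn_eqF.
  - rewrite -val_eqE gtn_eqF//; have /eqP := t2 _ _ ji.
    by rewrite !mxE conjC_eq0 => /eqP.
  - by rewrite eqxx.
have [e Me] := diagP M tM tMt.
have [b' Qb'] := diagP Q tQ (etrans (congr1 (fun X => is_trig_mx (P *m X *m _)) Qh) tQ).
have iPU : invmx P \is unitarymx by rewrite invmx_unitary// trmxC_unitary.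
have [s sE] : exists s : {perm 'I_n}, forall k, b' 0 (s k) = b 0 k.
  apply: (@diag_similar_perm _ _ P) => //.
  rewrite -[LHS](mulmxKV PuU) -[RHS](mulmxKV PuU); congr (_ *m _).
  by rewrite -[RHS]mulmxA Qb' mulKVmx// -mulmxA mulmxV// mulmx1.
exists (invmx P *m perm_mx s^-1), (\row_k e 0 (s k)); split.
- by rewrite mul_unitarymx// perm_mx_unitary.
- by rewrite mulmxA Me -mulmxA diag_perm mulmxA.
- rewrite mulmxA Qb' -mulmxA diag_perm mulmxA; congr (_ *m diag_mx _).
  by apply/rowP => k; rewrite mxE sE.
Qed.

End Spectral.

(** * Moving phases into the alcove and unitary matrices into SU(n) *)

Section Conjugacy.
Variables (R : realType) (n : nat).
Local Notation C := (Cplx R).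
Local Notation G := (SU R n).
Implicit Types (xi : 'rV[R]_n) (g h A : G).

Lemma SU_eq g h : set_val g = set_val h -> g = h.
Proof. exact: val_inj. Qed.

Lemma SU_mulE g h : set_val (SU_mul g h) = set_val g *m set_val h.
Proof. by []. Qed.

Lemma SU_invE g : set_val (SU_inv g) = invmx (set_val g).
Proof. by []. Qed.

Lemma SU_oneE : set_val (SU_one R n) = 1%:M.
Proof. by []. Qed.

Lemma SU_unitary g : set_val g \is unitarymx.
Proof. by have [] := set_mem (valP g). Qed.

Lemma SU_det g : \det (set_val g) = 1.
Proof. by have [] := set_mem (valP g). Qed.

Lemma SU_mulVg g : SU_mul (SU_inv g) g = SU_one R n.
Proof. by apply: SU_eq; rewrite SU_mulE SU_invE mulVmx// SU_unit. Qed.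

Lemma SU_mul1g g : SU_mul (SU_one R n) g = g.
Proof. by apply: SU_eq; rewrite SU_mulE mul1mx. Qed.

Lemma SU_lift (M : 'M[C]_n) : M \is unitarymx -> \det M = 1 ->
  exists g : G, set_val g = M.
Proof.
move=> MU MD; have MS : M \in SU R n by apply/mem_set.
by exists (SigSub MS).
Qed.

Lemma Adj_eq g (X Y : 'M[C]_n) : X = Adj g Y <-> X *m set_val g = set_val g *m Y.
Proof.
rewrite /Adj; split=> [->|XY]; first by rewrite mulmxKV// SU_unit.
by rewrite -XY mulmxK// SU_unit.
Qed.

Lemma AdjK g (X : 'M[C]_n) : Adj (SU_inv g) (Adj g X) = X.
Proof. by rewrite -AdjM SU_mulVg Adj1. Qed.

Lemma AdjVK g (X : 'M[C]_n) : Adj g (Adj (SU_inv g) X) = X.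
Proof. by rewrite -AdjM SU_mulgV Adj1. Qed.

Lemma SU_conjE g A : set_val (SU_conj g A) = Adj g (set_val A).
Proof. by []. Qed.

Lemma expt_unitary xi : expt xi \is unitarymx.
Proof.
apply/unitarymxP; rewrite /expt tr_diag_mx map_diag_mx mulmx_diag.
rewrite -diag_const_mx; congr diag_mx; apply/rowP => k.
by rewrite !mxE /= conj_expi expiN.
Qed.

Lemma det_expt xi : \det (expt xi) = expi (\sum_k xi 0 k).
Proof.
by rewrite det_diag expi_sum; apply: eq_bigr => k _; rewrite mxE.
Qed.

Lemma exists_perm_nonincreasing (y : 'I_n -> R) :
  exists s : {perm 'I_n}, forall i j : 'I_n, (i <= j)%N -> y (s j) <= y (s i).
Proof.
pose r (a b : 'I_n) := y b <= y a.
have rT : total r by move=> a b; exact: le_total.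
have rtr : transitive r by move=> a b c /= ba ac; exact: le_trans ac ba.
have /tuple_permP[s sE] : perm_eq (sort r (enum 'I_n)) (ord_tuple n).
  by rewrite perm_sort.
exists s => i j ij.
have nthE (k : 'I_n) : nth i (sort r (enum 'I_n)) k = s k.
  by rewrite sE -(tnth_nth i) tnth_mktuple tnth_ord_tuple.
rewrite -!nthE; apply: (@sorted_leq_nth _ r) => //.
- by move=> a; exact: lexx.
- exact: sort_sorted.
- by rewrite inE size_sort size_enum_ord.
- by rewrite inE size_sort size_enum_ord.
Qed.

(* Subtracting 1 from a largest entry keeps the differences bounded by 1. *)
Lemma balance (m : nat) (y : 'I_n -> R) :
  (forall k l, y k - y l <= 1) -> \sum_k y k = m%:R ->
  exists y' : 'I_n -> R, [/\ forall k, expi (y' k) = expi (y k),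
    forall k l, y' k - y' l <= 1 & \sum_k y' k = 0].
Proof.
elim: m y => [|m IH] y y1 ym; first by exists y.
have [k0 _] : exists k0 : 'I_n, true.
  have [n0|] := posnP n; last by move=> n0; exists (Ordinal n0).
  have : \sum_k y k = 0.
    by rewrite big1// => k; have := ltn_ord k; rewrite {2}n0.
  by rewrite ym => /eqP; rewrite pnatr_eq0.
pose K := [arg max_(k > k0) y k]%O.
have yK l : y l <= y K by rewrite /K; case: Order.TotalTheory.arg_maxP => // k _; apply.
pose z k := y k - (k == K)%:R.
have [||y' [y'z y'1 y'0]] := IH z.
- move=> k l; rewrite /z; have := y1 k l; have := yK k; have := yK l.
  have [->|kK] := eqVneq k K; have [->|lK] := eqVneq l K; rewrite ?mulr1n ?mulr0n; lra.
- rewrite /z sumrB ym (bigD1 K)//= eqxx big1 ?addr0 => [|k /negPf->]//.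
  by rewrite -natr1 addrK.
exists y'; split => // k; rewrite y'z /z expiD.
case: eqP => _; last by rewrite oppr0 expi0 mulr1.
by have := expi_int R (-1); rewrite mulrN1z => ->; rewrite mulr1.
Qed.

(** Reduced modulo 1 to [0, 1), the entries differ by at most 1 and their sum is a natural number;
    [balance] brings this sum to 0, and sorting gives a point of the alcove. *)
Lemma exists_alcove (y : 'I_n -> R) : expi (\sum_k y k) = 1 ->
  exists (xi : 'rV[R]_n) (s : {perm 'I_n}), alcove xi /\
    forall k, expi (xi 0 k) = expi (y (s k)).
Proof.
move=> y1; pose z k := y k - (Num.floor (y k))%:~R.
have zi k : 0 <= z k < 1.
  by rewrite /z; have /andP[] := floor_itv (y k); rewrite intrD => *; lra.
have ze k : expi (z k) = expi (y k).
  by rewrite /z expiD -mulrNz expi_int mulr1.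
have [m mE] : exists m : nat, \sum_k z k = m%:R.
  have : expi (\sum_k z k) = expi 0.
    by rewrite expi_sum (eq_bigr _ (fun k _ => ze k)) -expi_sum y1 expi0.
  move=> /expi_inj[m]; rewrite add0r => mE.
  have : 0 <= \sum_k z k by apply: sumr_ge0 => k _; have /andP[] := zi k.
  rewrite mE ler0z; case: m mE => // m mE _; by exists m.
have [|y' [y'e y'1 y'0]] := balance _ mE.
  by move=> k l; have := zi k; have := zi l; lra.
have [s sE] := exists_perm_nonincreasing y'.
exists (\row_k y' (s k)), s; split; last by move=> k; rewrite mxE y'e ze.
apply/alcoveP; split=> [|i j ij|i j]; rewrite ?mxE//; last exact: sE.
rewrite /trace0 -[RHS]y'0 [RHS](reindex_inj (@perm_inj _ s)).
by apply: eq_bigr => k _; rewrite mxE.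
Qed.

(** The scalar is an [n]-th root of the inverse determinant. Scalars do not affect conjugation, so a
    unitary eigenbasis can be replaced by an element of SU(n). *)
Lemma SU_rescale (u : 'M[C]_n) : u \is unitarymx ->
  exists (c : C) (g : G), c != 0 /\ set_val g = c *: u.
Proof.
move=> uU; have uut : u *m (map_mx Num.conj (u^T)) = 1%:M by exact/unitarymxP.
have [n0|n0] := posnP n.
  (* For [n = 0] the [n]-th root makes no sense, but the empty matrix has determinant 1 already. *)
  exists 1; have [|g gE] := SU_lift uU; last first.
    by exists g; rewrite oner_eq0 scale1r.
  by move: u {uU uut}; rewrite n0 => u; rewrite det_mx00.
have [t tE] : exists t, \det u = expi t.
  apply: expi_onto; rewrite -det_map_mx -[X in _ * X]det_tr map_trmx -det_mulmx.
  by rewrite uut det1.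
pose c : C := expi (- t / n%:R).
have cc : c * c^* = 1 by rewrite /c conj_expi expiN.
have c0 : c != 0 by exact: expi_neq0.
have [||g gE] := @SU_lift (c *: u); last by exists c, g.
  apply/unitarymxP; rewrite linearZ/= map_mxZ -scalemxAl -scalemxAr scalerA cc.
  by rewrite uut scale1r.
rewrite detZ tE; have -> : c ^+ n = expi (- t).
  by rewrite /c expiX -[(- t / n%:R) *+ n]mulr_natr divfK// pnatr_eq0 -lt0n.
by rewrite mulrC expiN.
Qed.

End Conjugacy.

(** * Conjugacy classes of SU(n) and the map [q] *)

Section Quotient.
Variables (R : realType) (n : nat).
Local Notation C := (Cplx R).
Local Notation G := (SU R n).
Implicit Types (xi mu : 'rV[R]_n) (g h A : G).
Local Open Scope sesquilinear_scope.

Lemma unitary_diag_phase (M u : 'M[C]_n) (d : 'rV[C]_n) :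
  M \is unitarymx -> u \is unitarymx -> M *m u = u *m diag_mx d ->
  exists y : 'I_n -> R, diag_mx d = expt (\row_k y k) /\
    \det M = expi (\sum_k y k).
Proof.
move=> MU uU Mu.
have dU : diag_mx d \is unitarymx.
  have -> : diag_mx d = invmx u *m M *m u.
    by rewrite -mulmxA Mu mulKmx// unitarymx_unit.
  apply: (mul_unitarymx _ uU); apply: (mul_unitarymx _ MU).
  rewrite (invmx_unitary uU).
  by rewrite trmxC_unitary.
have dd i : exists y, d 0 i = expi y.
  apply: expi_onto; have /unitarymxP/matrixP/(_ i i) := dU.
  by rewrite tr_diag_mx map_diag_mx mulmx_diag !mxE eqxx.
have [y yE] := choice dd; exists y.
have dE : diag_mx d = expt (\row_k y k).
  by congr diag_mx; apply/rowP => i; rewrite !mxE yE.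
split=> //; have : \det (M *m u) = \det (u *m diag_mx d) by rewrite Mu.
rewrite !det_mulmx mulrC => /(mulfI _) ->.
  by rewrite dE det_expt; congr expi; apply: eq_bigr => i _; rewrite mxE.
by rewrite -unitfE -unitmxE unitarymx_unit.
Qed.

Lemma SU_diag A : exists g xi, alcove xi /\ set_val A = Adj g (expt xi).
Proof.
have AU := SU_unitary A.
(* With [b = 0] the commuting matrix is zero, and what remains is the spectral theorem for [A]
   alone. *)
have [||u [d [uU Au _]]] := unitary_spectral (b := 0) AU.
- by rewrite linear0 mulmx0 mul0mx.
- by move=> k; rewrite mxE conjC0.
have [y [dE yD]] := unitary_diag_phase AU uU Au.
rewrite SU_det in yD; have [xi [s [xiA xis]]] := exists_alcove (esym yD).
have vU : u *m perm_mx s^-1 \is unitarymx.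
  by apply: (mul_unitarymx uU); exact: perm_mx_unitary.
have [c [g [c0 gE]]] := SU_rescale vU.
exists g, xi; split=> //; apply/Adj_eq.
rewrite gE -scalemxAl -scalemxAr; congr (_ *: _).
rewrite mulmxA Au dE -!mulmxA /expt diag_perm; congr (_ *m (_ *m diag_mx _)).
by apply/rowP => k; rewrite !mxE xis.
Qed.

Lemma alcove_uniq g h xi xi' : alcove xi -> alcove xi' ->
  Adj g (expt xi) = Adj h (expt xi') -> xi = xi'.
Proof.
move=> xiA xiA' gh.
have /Adj_eq e : expt xi' = Adj (SU_mul (SU_inv h) g) (expt xi).
  by rewrite AdjM gh AdjK.
have [s sE] := diag_similar_perm (SU_unit _) e.
by apply: (@alcove_inj _ _ _ _ s) => // k; have := sE k; rewrite !mxE.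
Qed.

Lemma q_eq A g xi : alcove xi -> set_val A = Adj g (expt xi) -> q A = xi.
Proof.
move=> xiA AE; rewrite /q; case: xgetP => [xi' _ [xiA' [h AE']]|H].
  exact: (alcove_uniq xiA' xiA (etrans (esym AE') AE)).
by case: (H xi); split=> //; exists g.
Qed.

Lemma qP A : alcove (q A) /\ exists g, set_val A = Adj g (expt (q A)).
Proof.
have [g [xi [xiA AE]]] := SU_diag A; rewrite (q_eq xiA AE).
by split=> //; exists g.
Qed.

Lemma V_eq i A g xi : alcove xi -> set_val A = Adj g (expt xi) ->
  V R i A <-> alcove_at i xi.
Proof. by move=> xiA AE; rewrite /V/= (q_eq xiA AE). Qed.

(** * The block of indices J, its stabilizer, character and spectral subspace *)

Section Blocks.
Variables (i j : 'I_n).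

Definition Jset : {set 'I_n} := [set k : 'I_n | (i < k <= j)%N]%SET.

Hypothesis ij : (i < j)%N.

Lemma vertexB k : (vertex R j - vertex R i) 0 k =
  (k \in Jset)%:R + (i.+1%:R / n%:R - j.+1%:R / n%:R).
Proof.
rewrite !mxE inE.
have -> : (k <= j)%N%:R = (k <= i)%N%:R + (i < k <= j)%N%:R :> R.
  rewrite -natrD; congr _%:R; case: (leqP k i) => ki /=.
    by rewrite (leq_trans ki (ltnW ij)).
  by [].
by ring.
Qed.

Lemma stabP g : stab (vertex R j - vertex R i) g <->
  forall k l, (k \in Jset) != (l \in Jset) -> set_val g k l = 0.
Proof.
rewrite /stab/=; move: (_ - _) vertexB => mu mE.
transitivity (set_val g *m dmx mu = dmx mu *m set_val g).
  by split=> [/esym/Adj_eq|/esym/Adj_eq].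
split=> [e k l kl|e].
  have /matrixP/(_ k l) := e; rewrite mul_mx_diag mul_diag_mx !mxE !mE => /eqP.
  rewrite mulrC -subr_eq0 -mulrBl mulf_eq0 => /orP[|/eqP//].
  rewrite -rmorphB fmorph_eq0 opprD addrACA subrr addr0.
  by case: (k \in _) (l \in _) kl => -[]; rewrite ?(subr0, sub0r, oppr_eq0, oner_eq0).
apply/matrixP => k l; rewrite mul_mx_diag mul_diag_mx !mxE !mE.
have [->|kl] := eqVneq (k \in Jset) (l \in Jset); first exact: mulrC.
by rewrite (e k l)// mul0r mulr0.
Qed.

Definition omega g : ext R n := ext_act (set_val g) (delta R Jset).

(** The minor of [g] on the rows and columns in [Jset], defined on all of [G]; [chiM] makes it
    multiplicative when the right factor is in the stabilizer. *)
Definition chi g : C := omega g Jset.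

Lemma omegaM g h : omega (SU_mul g h) = ext_act (set_val g) (omega h).
Proof. by rewrite /omega SU_mulE ext_actM. Qed.

Lemma omega1 : omega (SU_one R n) = delta R Jset.
Proof. by rewrite /omega SU_oneE ext_act1. Qed.

Lemma omega_stab h : stab (vertex R j - vertex R i) h ->
  omega h = escale (chi h) (delta R Jset).
Proof.
move=> /stabP hS; rewrite /chi /omega ext_act_delta bwedge_support => [|k l kJ lJ].
  by congr (escale _ _); rewrite /escale /delta eqxx mulr1.
by rewrite mxE hS// kJ (negPf lJ).
Qed.

Lemma omegaM_stab g h : stab (vertex R j - vertex R i) h ->
  omega (SU_mul g h) = escale (chi h) (omega g).
Proof. by move=> hS; rewrite omegaM omega_stab// ext_act_scale. Qed.

(** Acting by the inverse of [g] takes [omega g] back to a basis vector. A nonzero coordinate [S] of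
    [omega g] is what local trivializations divide by. *)
Lemma omega_neq0 g : exists S, omega g S != 0.
Proof.
apply: contrapT => /forallNP H.
have o0 : omega g = fun=> 0.
  by apply: funext => S; apply/eqP/negPn/negP => /H.
have : omega (SU_mul (SU_inv g) g) Jset = 0.
  by rewrite omegaM o0 -(escale0 (omega g)) ext_act_scale /escale mul0r.
by rewrite SU_mulVg omega1 /delta eqxx => /eqP; rewrite oner_eq0.
Qed.

Lemma chiM g h : stab (vertex R j - vertex R i) h ->
  chi (SU_mul g h) = chi g * chi h.
Proof.
by move=> hS; rewrite {1}/chi omegaM_stab// /escale mulrC.
Qed.

Lemma bwedge_scale (c : 'I_n -> C) x T :
  bwedge (fun t => c t *: x t) T = escale (\prod_(t in T) c t) (bwedge x T).
Proof.
rewrite /bwedge; elim/big_rec3: _ => [|t w v a tT ->]; first by rewrite escale1.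
have -> : ext_vec (c t *: x t) = escale (c t) (ext_vec (x t)).
  apply: funext => S; rewrite /escale /ext_vec mulr_sumr; apply: eq_bigr => k _.
  by rewrite mxE mulrCA.
by rewrite wedge_scalel wedge_scaler escaleA.
Qed.

Lemma chi_expt xi h : trace0 xi -> set_val h = expt xi ->
  chi h = expi (dot (vertex R j - vertex R i) xi).
Proof.
move=> xi0 hE; rewrite /chi /omega hE ext_act_delta.
have -> : (fun t => col t (expt xi)) = fun t => expi (xi 0 t) *: stdvec R t.
  apply: funext => t; apply/colP => k; rewrite !mxE eqxx andbT.
  by case: eqP => [->|]; rewrite ?mulr1// mulr0.
rewrite bwedge_scale bwedge_std /escale /delta eqxx mulr1 -expi_sum.
congr expi; rewrite /dot.
under [RHS]eq_bigr => k _ do rewrite vertexB mulrDl.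
rewrite big_split/= -mulr_sumr.
have -> : \sum_k xi 0 k = 0 by [].
rewrite mulr0 addr0 big_mkcond/=; apply: eq_bigr => k _.
by case: ifP; rewrite ?mul1r ?mul0r.
Qed.

(** [h] commutes with the real diagonal matrix of mu, so [unitary_spectral] diagonalizes it in a
    basis that leaves this matrix unchanged: the conjugating element is itself in the stabilizer. *)
Lemma stab_diag h : stab (vertex R j - vertex R i) h ->
  exists k xi, [/\ stab (vertex R j - vertex R i) k, trace0 xi &
    set_val h = Adj k (expt xi)].
Proof.
set mu := (_ - _) => hS.
have hc : set_val h *m dmx mu = dmx mu *m set_val h.
  exact/esym/Adj_eq/esym.
have [|u [d [uU hu mu_u]]] := unitary_spectral (SU_unitary h) hc.
  by move=> k; rewrite mxE; exact: conjc_real.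
have [y [dE yD]] := unitary_diag_phase (SU_unitary h) uU hu.
rewrite SU_det -(expi0 R) in yD; have [m mE] := expi_inj yD.
(* The phases [y] sum to [-m]. Adding the integer [m] to one entry, here that of index [i], gives
   trace 0 without changing the exponential. *)
pose xi : 'rV[R]_n := \row_k (y k + (k == i)%:R * m%:~R).
have [c [k [c0 kE]]] := SU_rescale uU.
exists k, xi; split.
- rewrite /stab/=; apply/esym/Adj_eq.
  by rewrite kE -scalemxAr mu_u scalemxAl.
- rewrite /trace0; under eq_bigr do rewrite mxE.
  rewrite big_split/= -mulr_suml.
  have -> : \sum_(k < n) (k == i)%:R = 1 :> R.
    by rewrite (bigD1 i)//= eqxx big1 ?addr0// => l /negPf->.
  by rewrite mul1r -mE.
- apply/Adj_eq; rewrite kE -scalemxAr hu -scalemxAl dE; congr (_ *: (_ *m diag_mx _)).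
  apply/rowP => l; rewrite !mxE expiD; case: eqP => _.
    by rewrite mul1r expi_int mulr1.
  by rewrite mul0r expi0 mulr1.
Qed.

(* an element of the stabilizer is conjugate in it to an element of T *)
Lemma character_uniq (c1 c2 : G -> C) h :
  is_character (vertex R j - vertex R i) c1 ->
  is_character (vertex R j - vertex R i) c2 ->
  stab (vertex R j - vertex R i) h -> c1 h = c2 h.
Proof.
move=> ch1 ch2 hS; have [k [xi [kS xi0 hE]]] := stab_diag hS.
have [t tE] := SU_lift (expt_unitary xi)
  (etrans (det_expt xi) (etrans (congr1 _ xi0) (expi0 R))).
have hkt : h = SU_mul (SU_mul k t) (SU_inv k).
  by apply: SU_eq; rewrite hE !SU_mulE SU_invE tE.
have tS : stab (vertex R j - vertex R i) t.
  rewrite /stab/=; apply/esym/Adj_eq; rewrite tE /expt /dmx.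
  by rewrite !mulmx_diag; congr diag_mx; apply/rowP => l; rewrite !mxE mulrC.
suff H c : is_character (vertex R j - vertex R i) c ->
    c h = expi (dot (vertex R j - vertex R i) xi) by rewrite !H.
move=> [_ cM cT]; have kVS := stabV kS.
(* As [c] takes commuting values, the factors of [k] and of its inverse combine into the value of
   [c] at 1, which is known because 1 is the exponential of 0. *)
rewrite hkt (cM _ _ (stabM kS tS) kVS) (cM _ _ kS tS) mulrAC.
rewrite -(cM _ _ kS kVS) SU_mulgV (cT xi t xi0 tE).
rewrite (cT 0 (SU_one R n)); first last.
- apply/matrixP => a b; rewrite SU_oneE !mxE expi0.
  by [].
- by rewrite /trace0 big1// => l _; rewrite mxE.
rewrite /dot big1 => [|l _]; last by rewrite [X in _ * X]mxE mulr0.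
by rewrite expi0 mul1r.
Qed.

(** The matrix [h^-1 g] commutes with [expt xi]; by [alcove_separated] its entries between [Jset]
    and the complement vanish. Hence constructions invariant under the stabilizer do not depend on
    the chosen parameter of [A]. *)
Lemma param_stab xi g h : alcove_at i xi -> alcove_at j xi ->
  Adj g (expt xi) = Adj h (expt xi) ->
  stab (vertex R j - vertex R i) (SU_mul (SU_inv h) g).
Proof.
move=> Ai Aj gh; set k := SU_mul _ _.
have /Adj_eq kc : expt xi = Adj k (expt xi) by rewrite AdjM gh AdjK.
apply/stabP => a b ab.
have /matrixP/(_ a b) := kc; rewrite mul_mx_diag mul_diag_mx !mxE mulrC => /eqP.
rewrite -subr_eq0 -mulrBr mulf_eq0 subr_eq0 => /orP[/eqP//|].
move: ab; rewrite !inE; case aJ: (i < a <= j)%N; case bJ: (i < b <= j)%N => // _.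
  by rewrite (negPf (alcove_separated Ai Aj aJ (negbT bJ))).
by rewrite eq_sym (negPf (alcove_separated Ai Aj bJ (negbT aJ))).
Qed.

Lemma omega_param xi g h : alcove_at i xi -> alcove_at j xi ->
  Adj g (expt xi) = Adj h (expt xi) ->
  exists z, z != 0 /\ omega g = escale z (omega h).
Proof.
move=> Ai Aj gh; have kS := param_stab Ai Aj gh; set k := SU_mul _ _ in kS.
have gE : g = SU_mul h k by rewrite SU_mulA SU_mulgV SU_mul1g.
exists (chi k); split; last by rewrite [in LHS]gE omegaM_stab.
apply/eqP => k0; have [S /eqP] := omega_neq0 g; apply.
by rewrite gE omegaM_stab// k0 /escale mul0r.
Qed.

Lemma theta_eq A xi g : alcove_at i xi -> alcove_at j xi ->
  set_val A = Adj g (expt xi) ->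
  theta R i j A = Adj g (dmx (vertex R j - vertex R i)).
Proof.
move=> Ai Aj AE; rewrite /theta; case: xgetP => [Y _|H]; last first.
  exfalso; apply: (H (Adj g (dmx (vertex R j - vertex R i)))).
  exists g, xi; split; [exact: Ai|exact: Aj|exact: AE|reflexivity].
move=> [h [xi' [Ai' Aj' AE' ->]]].
have xiE : xi' = xi.
  by apply: (@alcove_uniq h g); [case: Ai'|case: Ai|rewrite -AE -AE'].
rewrite xiE in AE'; have := param_stab Ai Aj (etrans (esym AE') AE).
rewrite /stab/= AdjM => {2}<-; exact/esym/AdjVK.
Qed.

(** In the basis of columns of [g], [A] is diagonal, and by [alcove_separated] the eigenvalues
    indexed by [Jset] do not occur at the other indices. *)
Lemma spectralE A xi g v : alcove_at i xi -> alcove_at j xi ->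
  set_val A = Adj g (expt xi) -> spectral i j A v <->
  forall l, l \notin Jset -> (invmx (set_val g) *m v) l 0 = 0.
Proof.
move=> Ai Aj AE; have qA : q A = xi by apply: (q_eq _ AE); case: Ai.
have gU := SU_unit g; have /Adj_eq Ag := AE.
split=> [[u [uE ->]] l lJ|H].
  rewrite mulmx_sumr summxE big1// => k kJ.
  have /(congr1 (mulmx (invmx (set_val g)))) := uE k kJ; rewrite qA.
  have -> : set_val A = Adj g (expt xi) by [].
  rewrite /Adj !mulmxA mulVmx// mul1mx -mulmxA -scalemxAr.
  move=> /matrixP/(_ l 0); rewrite mul_diag_mx !mxE => /eqP.
  rewrite -subr_eq0 -mulrBl mulf_eq0 subr_eq0 eq_sym => /orP[|/eqP//].
  by rewrite (negPf (alcove_separated Ai Aj kJ _))//; move: lJ; rewrite inE.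
(* The components of [v] along the columns of [g], which are eigenvectors of [A]. *)
exists (fun k => (invmx (set_val g) *m v) k 0 *: col k (set_val g)); split.
  move=> k kJ; rewrite -scalemxAr colE mulmxA Ag qA -mulmxA.
  rewrite scalerA mulrC -scalerA; congr (_ *: _); rewrite scalemxAr; congr (_ *m _).
  apply/colP => l; rewrite mul_diag_mx !mxE; case: eqP => [->//|].
  by rewrite !mulr0.
rewrite -[LHS](mulKVmx gU); apply/colP => l; rewrite mxE summxE [RHS]big_mkcond/=.
apply: eq_bigr => k _; case: ifP => kJ; first by rewrite !mxE mulrC.
by rewrite H ?mulr0// inE kJ.
Qed.

Lemma GR_fibreP A xi g w : alcove_at i xi -> alcove_at j xi ->
  set_val A = Adj g (expt xi) ->
  btotal (GR_line R i j) (A, w) <-> exists z, w = escale z (omega g).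
Proof.
move=> Ai Aj AE; have AU := SU_unit g.
have qA : q A = xi by apply: (q_eq _ AE); case: Ai.
have bJ (x : 'I_n -> 'cV[C]_n) :
    \big[@wedge R n/@ext_one R n]_(k < n | (i < k <= j)%N) ext_vec (x k)
    = bwedge x Jset.
  by apply: eq_bigl => k; rewrite inE.
split=> [[_ [v [vS /= ->]]]|[z ->]].
  rewrite bJ; pose y k := invmx (set_val g) *m v k.
  have -> : v = (fun k => set_val g *m y k).
    by apply: funext => k; rewrite /y mulKVmx.
  rewrite -ext_act_bwedge bwedge_support.
    by exists (bwedge y Jset Jset); rewrite ext_act_scale.
  by move=> k l _ lJ; have /(spectralE _ Ai Aj AE) := vS k; apply.
split; first by split; rewrite /V/= qA.
(* The scalar is put into the single factor of index [j], which belongs to [Jset] because [i < j].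
   Off [Jset] the family is 0, so that it stays in the spectral subspace. *)
exists (fun k => if k == j then z *: col k (set_val g)
  else if k \in Jset then col k (set_val g) else 0); split=> [k|/=].
  apply/(spectralE _ Ai Aj AE) => l lJ.
  have jJ : j \in Jset by rewrite inE ij leqnn.
  have colg k' : k' \in Jset -> (invmx (set_val g) *m col k' (set_val g)) l 0 = 0.
    move=> kJ; rewrite colE mulKmx// mxE eqxx andbT.
    by case: eqP => // lk; move: lJ; rewrite lk kJ.
  case: eqP => [->|_]; first by rewrite -scalemxAr mxE colg ?mulr0.
  by case: ifP => [/colg//|_]; rewrite mulmx0 mxE.
rewrite bJ /omega ext_act_delta.
have jJ : j \in Jset by rewrite inE ij leqnn.
transitivity (bwedge (fun t => (if t == j then z else 1) *: col t (set_val g)) Jset).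
  rewrite bwedge_scale (bigD1 j)//= eqxx big1 ?mulr1// => k /andP[_ /negPf->].
  by [].
apply: eq_bigr => t tJ; rewrite tJ; case: eqP => // _.
by rewrite scale1r.
Qed.

End Blocks.
End Quotient.

Local Open Scope classical_set_scope.

(** * Limits and compactness *)

Section Limits.
Variables (R : realType) (n : nat).
Local Notation C := (Cplx R).
Local Notation G := (SU R n).

Lemma cvg_initial (S : choiceType) (T : topologicalType) (f : S -> T)
    (F : set_system S) (s : initial_topology f) :
  Filter F -> f @ F --> f s -> F --> s.
Proof.
move=> FF fs A [_ [[B oB <-] /= Bs BA]]; apply: filterS BA _.
by apply: fs; apply: open_nbhs_nbhs.
Qed.

Lemma cvg_prodP (I : eqType) (K : I -> topologicalType) (X : Type)
    (F : set_system X) {FF : Filter F} (f : X -> prod_topology K)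
    (w : prod_topology K) :
  f @ F --> w <-> forall k, (fun x => f x k) @ F --> w k.
Proof.
split=> [fw k|fw].
  exact: (cvg_comp _ _ fw (@proj_continuous I K k w)).
apply/cvg_sup => k; apply: cvg_initial; exact: fw.
Qed.

Lemma cvg_mx (K : topologicalType) (m p : nat) (X : Type) (F : set_system X)
    (f : X -> 'M[K]_(m, p)) (M : 'M[K]_(m, p)) :
  Filter F -> (forall i j, (fun x => f x i j) @ F --> M i j) -> f @ F --> M.
Proof.
move=> FF fM A [P MP PA].
have H i j : F [set x | P i j (f x i j)] by apply: (fM i j); exact: MP.
apply: (@filterS _ F _ [set x | forall ij, P ij.1 ij.2 (f x ij.1 ij.2)]).
  by move=> x Px; apply: PA => i j; exact: (Px (i, j)).
by apply: filter_forall => -[i j]; exact: H.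
Qed.

Lemma cvg_mx_entry (K : topologicalType) (m p : nat) (X : Type) (F : set_system X)
    (f : X -> 'M[K]_(m, p)) (M : 'M[K]_(m, p)) i j :
  f @ F --> M -> (fun x => f x i j) @ F --> M i j.
Proof.
move=> fM A MA; apply: (fM [set N : 'M[K]_(m, p) | A (N i j)]).
exists (fun a b => if (a == i) && (b == j) then A else setT).
  by move=> a b; case: ifP => [/andP[/eqP-> /eqP->]//|_]; exact: filterT.
by move=> N /(_ i j); rewrite !eqxx.
Qed.

Lemma mx_hausdorff (K : topologicalType) m p :
  hausdorff_space K -> hausdorff_space 'M[K]_(m, p).
Proof.
move=> KH M N MN; apply/matrixP => i j; apply: KH => A B MA NB.
have [] := MN [set X : 'M[K]_(m, p) | A (X i j)] [set X | B (X i j)].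
- exact: (@cvg_mx_entry K m p _ (nbhs M) id M i j).
- exact: (@cvg_mx_entry K m p _ (nbhs N) id N i j).
- by move=> X [AX BX]; exists (X i j).
Qed.

Lemma cvg_SU (X : Type) (F : set_system X) (f : X -> G) (g : G) :
  Filter F -> (fun x => set_val (f x)) @ F --> set_val g -> f @ F --> g.
Proof. by move=> FF fg; apply: cvg_initial. Qed.

Lemma cvg_set_val (X : Type) (F : set_system X) (f : X -> G) (g : G) :
  f @ F --> g -> (fun x => set_val (f x)) @ F --> set_val g.
Proof.
move=> fg; apply: (cvg_comp _ _ fg); exact: initial_continuous.
Qed.

Section Ops.
Variables (X : Type) (F : set_system X).
Context {FF : Filter F}.

Lemma cvg_sumC (I : Type) (r : seq I) (P : pred I) (f : I -> X -> C) (a : I -> C) :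
  (forall i, P i -> f i @ F --> a i) ->
  (fun x => \sum_(i <- r | P i) f i x) @ F --> \sum_(i <- r | P i) a i.
Proof.
move=> fa; apply: cvg_big => // -[x y] /=.
by apply: cvgD; [exact: cvg_fst|exact: cvg_snd].
Qed.

Lemma cvg_prodC (I : Type) (r : seq I) (P : pred I) (f : I -> X -> C) (a : I -> C) :
  (forall i, P i -> f i @ F --> a i) ->
  (fun x => \prod_(i <- r | P i) f i x) @ F --> \prod_(i <- r | P i) a i.
Proof.
move=> fa; apply: cvg_big => // -[x y] /=.
by apply: cvgM; [exact: cvg_fst|exact: cvg_snd].
Qed.

Lemma cvg_mulmx m p r (f : X -> 'M[C]_(m, p)) (g : X -> 'M[C]_(p, r))
    (M : 'M[C]_(m, p)) (N : 'M[C]_(p, r)) :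
  f @ F --> M -> g @ F --> N -> (fun x => f x *m g x) @ F --> M *m N.
Proof.
move=> fM gN; apply: cvg_mx => i j; rewrite mxE.
under eq_cvg do rewrite mxE.
by apply: cvg_sumC => k _; apply: cvgM; exact: cvg_mx_entry.
Qed.

Lemma cvg_det m (f : X -> 'M[C]_m) (M : 'M[C]_m) :
  f @ F --> M -> (fun x => \det (f x)) @ F --> \det M.
Proof.
move=> fM; apply: cvg_sumC => s _; apply: cvgM; first exact: cvg_cst.
by apply: cvg_prodC => i _; exact: cvg_mx_entry.
Qed.

Lemma cvg_conj (f : X -> C) (a : C) : f @ F --> a ->
  (fun x => (f x)^*) @ F --> a^*.
Proof.
move=> fa; apply/cvgrPdist_lt => e e0.
move/cvgrPdist_lt : fa => /(_ e e0); apply: filterS => x.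
by rewrite -rmorphB norm_conjC.
Qed.

Lemma cvg_real_complex (f : X -> R) (a : R) : f @ F --> a ->
  (fun x => (f x)%:C%C : C) @ F --> (a%:C%C : C).
Proof.
move=> fa; apply/cvgrPdist_lt => e e0.
have [e' e'0 eE] : exists2 e', 0 < e' & e = (e')%:C%C :> C.
  exists (complex.Re e); last by rewrite RRe_real// gtr0_real.
  by move: e0; rewrite ltcE /= => /andP[].
move/cvgrPdist_lt : fa => /(_ e' e'0); apply: filterS => x.
rewrite eE -(rmorphB (real_complex R)) /= normc_def /= expr0n addr0 sqrtr_sqr.
by rewrite ltcR.
Qed.

Lemma cvg_complex (f g : X -> R) (a b : R) : f @ F --> a -> g @ F --> b ->
  (fun x => (f x +i* g x)%C : C) @ F --> ((a +i* b)%C : C).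
Proof.
move=> fa gb; have E (x y : R) : (x +i* y)%C = x%:C%C + 'i%C * y%:C%C :> C.
  by rewrite [LHS]complexE.
rewrite E; under eq_cvg do rewrite E.
apply: cvgD; first exact: cvg_real_complex.
by apply: cvgM; [exact: cvg_cst|exact: cvg_real_complex].
Qed.

Lemma cvg_expi (f : X -> R) (a : R) : f @ F --> a ->
  (fun x => expi (f x)) @ F --> expi a.
Proof.
move=> fa; have fa' : (fun x => 2 * pi * f x) @ F --> 2 * pi * a.
  by apply: cvgM => //; exact: cvg_cst.
by apply: cvg_complex; apply: continuous_cvg => //;
  [exact: continuous_cos|exact: continuous_sin].
Qed.

Lemma cvg_expt (f : X -> 'rV[R]_n) (xi : 'rV[R]_n) : f @ F --> xi ->
  (fun x => expt (f x)) @ F --> expt xi.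
Proof.
move=> fxi; apply: cvg_mx => i j; rewrite !mxE; under eq_cvg do rewrite !mxE.
case: eqP => _; last exact: cvg_cst.
by apply: cvg_expi; exact: cvg_mx_entry.
Qed.

Lemma cvg_escale (f : X -> C) (u : X -> ext R n)
    (z : C) (w : ext R n) : f @ F --> z -> u @ F --> w ->
  (fun x => escale (f x) (u x) : ext R n) @ F --> (escale z w : ext R n).
Proof.
move=> fz /cvg_prodP uw; apply/cvg_prodP => S.
exact: (cvgM fz (uw S)).
Qed.

Lemma cvg_wedge (u v : X -> ext R n) (a b : ext R n) : u @ F --> a -> v @ F --> b ->
  (fun x => wedge (u x) (v x)) @ F --> wedge a b.
Proof.
move=> /cvg_prodP ua /cvg_prodP vb; apply/cvg_prodP => S.
apply: cvg_sumC => T _.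
exact: (cvgM (cvgM (cvg_cst _) (ua T)) (vb (S :\: T)%SET)).
Qed.

Lemma cvg_ext_vec (f : X -> 'cV[C]_n) (v : 'cV[C]_n) : f @ F --> v ->
  (fun x => ext_vec (f x)) @ F --> ext_vec v.
Proof.
move=> fv; apply/cvg_prodP => S; apply: cvg_sumC => k _.
exact: (cvgM (cvg_cst _) (cvg_mx_entry (i := k) (j := 0) fv)).
Qed.

Lemma cvg_big_wedge (I : Type) (r : seq I) (P : pred I)
    (f : I -> X -> ext R n) (a : I -> ext R n) :
  (forall i, P i -> f i @ F --> a i) ->
  (fun x => \big[@wedge R n/@ext_one R n]_(i <- r | P i) f i x) @ F -->
  (\big[@wedge R n/@ext_one R n]_(i <- r | P i) a i : ext R n).
Proof.
move=> fa; elim: r => [|i r IH].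
  by rewrite big_nil; under eq_cvg do rewrite big_nil; exact: cvg_cst.
rewrite big_cons; under eq_cvg do rewrite big_cons.
by case: ifPn => // Pi; apply: cvg_wedge => //; exact: fa.
Qed.

Lemma cvg_ext_act (f : X -> 'M[C]_n) (u : X -> ext R n)
    (M : 'M[C]_n) (w : ext R n) :
  f @ F --> M -> u @ F --> w ->
  (fun x => ext_act (f x) (u x)) @ F --> ext_act M w.
Proof.
move=> fM /cvg_prodP uw; apply/cvg_prodP => S; apply: cvg_sumC => T _.
apply: (cvgM (uw T)).
move: S; apply/cvg_prodP; apply: cvg_big_wedge => t _.
apply: cvg_ext_vec; apply: cvg_mx => i j; rewrite mxE.
by under eq_cvg do rewrite mxE; exact: cvg_mx_entry.
Qed.

Lemma cvg_SU_mul (f g : X -> G) (a b : G) : f @ F --> a -> g @ F --> b ->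
  (fun x => SU_mul (f x) (g x)) @ F --> SU_mul a b.
Proof.
move=> fa gb; apply: cvg_SU.
by apply: cvg_mulmx; exact: cvg_set_val.
Qed.

(** On unitary matrices the inverse is the adjoint, whose entries are conjugates of entries. *)
Lemma cvg_invmx (f : X -> G) (a : G) : f @ F --> a ->
  (fun x => invmx (set_val (f x))) @ F --> invmx (set_val a).
Proof.
move=> fa; rewrite invmx_unitary ?SU_unitary//.
under eq_cvg do rewrite (invmx_unitary (SU_unitary _)).
apply: cvg_mx => i j; rewrite !mxE; under eq_cvg do rewrite !mxE.
by apply: cvg_conj; apply: cvg_mx_entry; exact: cvg_set_val.
Qed.

Lemma cvg_SU_inv (f : X -> G) (a : G) : f @ F --> a ->
  (fun x => SU_inv (f x)) @ F --> SU_inv a.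
Proof. by move=> fa; apply: cvg_SU; exact: cvg_invmx. Qed.

Lemma cvg_Adj (f : X -> G) (u : X -> 'M[C]_n)
    (a : G) (M : 'M[C]_n) : f @ F --> a -> u @ F --> M ->
  (fun x => Adj (f x) (u x)) @ F --> Adj a M.
Proof.
move=> fa uM; apply: cvg_mulmx; last exact: cvg_invmx.
exact: (cvg_mulmx (cvg_set_val fa) uM).
Qed.

Lemma cvg_SU_conj (f g : X -> G) (a b : G) : f @ F --> a -> g @ F --> b ->
  (fun x => SU_conj (f x) (g x)) @ F --> SU_conj a b.
Proof.
move=> fa gb; apply: cvg_SU_mul; last exact: cvg_SU_inv.
exact: cvg_SU_mul.
Qed.

Lemma cvg_omega (i j : 'I_n) (f : X -> G) (a : G) : f @ F --> a ->
  (fun x => omega i j (f x)) @ F --> omega i j a.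
Proof.
move=> fa; apply: cvg_ext_act; last exact: cvg_cst.
exact: cvg_set_val.
Qed.

End Ops.
End Limits.

(** * Compactness of SU(n) and of the alcove, and limits computed on parameters *)

Section Compactness.
Variables (R : realType) (n : nat).
Local Notation C := (Cplx R).
Local Notation G := (SU R n).
Local Open Scope sesquilinear_scope.

(** A compact set containing the closed unit disc, hence every entry of a unitary matrix. *)
Definition square : set C :=
  (fun p : R * R => (p.1 +i* p.2)%C) @` (`[-1, 1] `*` `[-1, 1]).

Lemma square_compact : compact square.
Proof.
apply: continuous_compact; last by apply: compact_setX; exact: segment_compact.
apply: continuous_subspaceT => -[x y].
by apply: (@cvg_complex R _ (nbhs (x, y)) _ fst snd);
  [exact: cvg_fst|exact: cvg_snd].
Qed.

Lemma square_norm (z : C) : `|z| <= 1 -> square z.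
Proof.
case: z => a b; rewrite normc_def /= (_ : 1 = 1%:C%C)// lecR => ab.
have ab1 : a ^+ 2 + b ^+ 2 <= 1.
  rewrite -(sqr_sqrtr (addr_ge0 (sqr_ge0 a) (sqr_ge0 b))) -[leRHS](expr1n _ 2).
  by rewrite lerXn2r// nnegrE.
have le1 (x : R) : x ^+ 2 <= 1 -> -1 <= x <= 1.
  by move=> x2; rewrite -ler_norml -(expr_le1 (n := 2))// real_normK ?num_real.
exists (a, b) => //; split; rewrite /= in_itv /=; apply: le1.
  by have := sqr_ge0 b; lra.
by have := sqr_ge0 a; lra.
Qed.

Lemma mx_compact (A : set C) : compact A ->
  compact [set M : 'M[C]_n | forall i j, A (M i j)].
Proof.
move=> cA; pose f (w : prod_topology (fun _ : 'I_n * 'I_n => C)) : 'M[C]_n :=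
  \matrix_(i, j) w (i, j).
have -> : [set M : 'M[C]_n | forall i j, A (M i j)] =
    f @` [set w : prod_topology (fun _ : 'I_n * 'I_n => C) | forall ij, A (w ij)].
  rewrite eqEsubset; split=> [M MA|_ [w wA <-] i j]; last by rewrite mxE.
  by exists (fun ij => M ij.1 ij.2) => //; apply/matrixP => i j; rewrite mxE.
apply: (@continuous_compact (prod_topology (fun _ : 'I_n * 'I_n => C))
  'M[C]_n f); last exact: (@tychonoff _ (fun=> C) (fun=> A) (fun=> cA)).
apply: continuous_subspaceT => w.
apply: (@cvg_mx C n n _ (nbhs w) f (f w)) => i j.
rewrite mxE; under eq_cvg do rewrite mxE.
have /cvg_prodP := @cvg_id _ (nbhs w); exact.
Qed.

Lemma SU_closed : closed (SU R n).
Proof.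
have C_h : hausdorff_space C by exact: norm_hausdorff.
have -> : SU R n = (fun M : 'M[C]_n => M *m M ^t*) @^-1` [set 1%:M] `&`
    (fun M : 'M[C]_n => \det M) @^-1` [set 1].
  rewrite eqEsubset; split=> [M [/unitarymxP MU MD]//|M [/= MU MD]].
  by split=> //; exact/unitarymxP.
apply: closedI; apply: preimage_closed.
- move=> M _; have idM : id @ nbhs M --> M by exact: cvg_id.
  apply: (cvg_mulmx idM); apply: (@cvg_mx C n n _ (nbhs M) _ (M ^t*)) => i j.
  rewrite !mxE; under eq_cvg do rewrite !mxE.
  exact: (cvg_conj (cvg_mx_entry idM)).
- exact: (accessible_closed_set1 (hausdorff_accessible (mx_hausdorff C_h))).
- move=> M _; exact: (cvg_det (@cvg_id _ (nbhs M))).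
- exact: (accessible_closed_set1 (hausdorff_accessible C_h)).
Qed.

Lemma SU_compact : compact (SU R n).
Proof.
apply: (subclosed_compact SU_closed (mx_compact square_compact)).
move=> M [/unitarymxP MU _] i j; apply: square_norm.
have /matrixP/(_ i i) := MU; rewrite !mxE eqxx => Mi.
rewrite -(expr_le1 (n := 2))// normCK.
have : \sum_k M i k * (M i k)^* = 1.
  by rewrite -[RHS]Mi; apply: eq_bigr => k _; rewrite !mxE.
rewrite (bigD1 j)//= => <-; rewrite lerDl sumr_ge0// => k _.
by rewrite mul_conjC_ge0.
Qed.

Lemma SU_compactT : compact [set: G].
Proof.
move=> F PF _; pose F' : set_system 'M[C]_n := set_val @ F.
have [|M [MS MF]] := SU_compact (F := F').
  rewrite /F'; apply: (@filterS _ F _ setT) filterT => g _ /=.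
  exact: set_mem (valP g).
exists (SigSub (mem_set MS)); split=> // A D FA [_ [[B oB <-] /= BM BA]].
have [||N [[g Ag <-] BN]] := MF (set_val @` A) B.
- by apply: (@filterS _ F _ A) => // g Ag; exists g.
- by apply: open_nbhs_nbhs.
- by exists g; split=> //; exact: BA.
Qed.

Lemma cvg_gap (X : Type) (F : set_system X) (f : X -> 'rV[R]_n)
    (xi : 'rV[R]_n) i {FF : Filter F} :
  f @ F --> xi -> (fun x => gap (f x) i) @ F --> gap xi i.
Proof.
move=> fxi.
exact: (cvgD (cvgB (cvg_mx_entry fxi) (cvg_mx_entry fxi)) (cvg_cst _)).
Qed.

Lemma alcove_closed : closed (@alcove R n).
Proof.
have -> : @alcove R n = (fun xi : 'rV[R]_n => \sum_k xi 0 k) @^-1` [set 0] `&`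
    \bigcap_(i in [set: 'I_n]) (fun xi : 'rV[R]_n => gap xi i) @^-1` [set x | 0 <= x].
  rewrite eqEsubset; split=> [xi [t0 ge]|xi [t0 ge]].
    by split=> [|i _]; [exact: t0|exact: ge].
  by split=> // i; exact: ge.
have coordc (k : 'I_n) : continuous (fun xi : 'rV[R]_n => xi 0 k).
  exact: coord_continuous.
apply: closedI.
  apply: preimage_closed; last first.
    exact: (accessible_closed_set1 (hausdorff_accessible (@Rhausdorff R))).
  move=> xi _; apply: continuous_big => [[x y]|k _]; last exact: coordc.
  by apply: cvgD; [exact: cvg_fst|exact: cvg_snd].
apply: closed_bigI => i _; apply: preimage_closed; last exact: closed_ge.
move=> xi _; exact: (cvg_gap (i := i) (@cvg_id _ (nbhs xi))).
Qed.

Lemma alcove_compact : compact (@alcove R n).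
Proof.
have cB := @rV_compact R n (fun=> `[-1, 1]) (fun=> @segment_compact R (-1) 1).
apply: (subclosed_compact alcove_closed cB).
move=> xi /alcoveP[t0 _ le1] k /=; rewrite in_itv /=.
(* Since differences are at most 1, an entry above 1 would make all entries positive and one below
   -1 would make them all negative, against the zero sum. *)
apply/andP; split; rewrite leNgt; apply/negP => H.
  have : \sum_l xi 0 l < 0; last by rewrite t0 ltxx.
  rewrite (bigD1 k)//=; apply: (@le_lt_trans _ _ (xi 0 k)); last lra.
  by rewrite gerDl; apply: sumr_le0 => l _; have := le1 l k; lra.
have : 0 < \sum_l xi 0 l; last by rewrite t0 ltxx.
rewrite (bigD1 k)//=; apply: (@lt_le_trans _ _ (xi 0 k)); first lra.
by rewrite lerDl; apply: sumr_ge0 => l _; have := le1 k l; lra.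
Qed.

(* SU(n) is a quotient of the compact space SU(n) x alcove by
   (g, xi) |-> g (exp xi) g^-1, so it suffices to work locally upstairs. *)
Lemma near_param (T : topologicalType) (D : set T) (p : T -> G) (P : T -> Prop)
    (t0 : T) :
  p @ within D (nbhs t0) --> p t0 ->
  (forall g xi, alcove xi -> set_val (p t0) = Adj g (expt xi) ->
    \forall gx \near ((g, xi) : G * 'rV[R]_n) & t \near within D (nbhs t0),
      alcove gx.2 -> set_val (p t) = Adj gx.1 (expt gx.2) -> P t) ->
  \forall t \near within D (nbhs t0), P t.
Proof.
move=> pt0 H; pose F := within D (nbhs t0).
have FF : Filter F by exact: within_filter.
(* Tube argument: neighbourhoods found around each parameter are merged into one neighbourhood of
   [t0], valid for all parameters. *)
have /compact_near_coveringP/near_covering_withinP cover :=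
  compact_setX SU_compactT alcove_compact.
have K : \forall t \near F, [set: G] `*` @alcove R n `<=`
    (fun gx => set_val (p t) = Adj gx.1 (expt gx.2) -> P t).
  apply: (cover T F (fun t gx => set_val (p t) = Adj gx.1 (expt gx.2) -> P t) FF).
  move=> [g xi] [_ /= xiA].
  (* Over [p t0] the hypothesis applies. Elsewhere the Hausdorff property separates [p t0] from the
     conjugate given by (g, xi), and the implication holds vacuously nearby. *)
  have [pE|pE] := pselect (set_val (p t0) = Adj g (expt xi)).
    have := H g xi xiA pE; apply: filterS => -[gx t] /= K [_ gxA].
    exact: K.
  have [A [B [Ap BE AB]]] : exists A B, [/\ nbhs (set_val (p t0)) A,
      nbhs (Adj g (expt xi)) B & ~ (A `&` B !=set0)].
    apply: contrapT => K; apply: pE; apply: mx_hausdorff.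
      exact: norm_hausdorff.
    by move=> A B Ap BE; apply: contrapT => AB; apply: K; exists A, B.
  have cA : F [set t | A (set_val (p t))] by exact: (cvg_set_val pt0).
  have cB : nbhs (g, xi) [set gx | B (Adj gx.1 (expt gx.2))].
    exact: (cvg_Adj (@cvg_fst _ _ (nbhs g) (nbhs xi) _)
      (cvg_expt (@cvg_snd _ _ (nbhs g) (nbhs xi) _))).
  exists ([set gx | B (Adj gx.1 (expt gx.2))], [set t | A (set_val (p t))]) => //.
  move=> [gx t] /= [Bgx At] _ pE'; case: AB.
  by exists (set_val (p t)); split=> //; rewrite pE'.
near=> t; have [g [xi [xiA tE]]] := SU_diag (p t).
have Kt : [set: G] `*` @alcove R n `<=`
    (fun gx => set_val (p t) = Adj gx.1 (expt gx.2) -> P t) by near: t.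
exact: (Kt (g, xi)).
Unshelve. all: by end_near. Qed.

(** The formula [h] may vary with the parameter (g, xi) of [p t0], and it has to compute [f] for
    every parameter of [p t] near (g, xi): no continuous choice of parameters is involved. *)
Lemma cvg_param (T U : topologicalType) (D : set T) (p : T -> G) (f : T -> U)
    (t0 : T) :
  p @ within D (nbhs t0) --> p t0 ->
  (forall g xi, alcove xi -> set_val (p t0) = Adj g (expt xi) ->
    exists h : (G * 'rV[R]_n) * T -> U,
    h @ nbhs ((g, xi), t0) --> f t0 /\
    \forall gx \near ((g, xi) : G * 'rV[R]_n) & t \near within D (nbhs t0),
      alcove gx.2 -> set_val (p t) = Adj gx.1 (expt gx.2) -> f t = h (gx, t)) ->
  f @ within D (nbhs t0) --> f t0.
Proof.
move=> pt0 H N Nf; apply: (near_param pt0) => g xi xiA pE.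
have [h [ht0 fh]] := H g xi xiA pE.
have hN : \forall gx \near ((g, xi) : G * 'rV[R]_n) & t \near within D (nbhs t0),
    N (h (gx, t)).
  have [[A B] /= [nA nB] AB] := ht0 _ Nf; exists (A, B) => //=.
    by split=> //; exact: cvg_within.
  by move=> [gx t]; exact: AB.
apply: filterS2 fh hN => -[gx t] /= E hn xiA' pE'.
by rewrite E.
Qed.

End Compactness.

(** * The line bundles E_ij *)

Section GRBundle.
Variables (R : realType) (n : nat).
Local Notation C := (Cplx R).
Local Notation G := (SU R n).

Lemma cvg_withinW (T U : topologicalType) (D : set T) (f : T -> U) (t : T) (l : U) :
  f @ nbhs t --> l -> f @ within D (nbhs t) --> l.
Proof. by move=> fl N Nl; apply: (cvg_within D); exact: fl. Qed.

Lemma cvg_within_id (T : topologicalType) (D : set T) (t : T) :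
  id @ within D (nbhs t) --> t.
Proof. by move=> N Nt; exact: (cvg_within D). Qed.

Lemma near2_within (S T : Type) (F : set_system S) (H : set_system T)
    {FF : Filter F} {FH : Filter H} (D : set T) (Q : S -> T -> Prop) :
  (forall s t, D t -> Q s t) -> \forall s \near F & t \near within D H, Q s t.
Proof.
move=> DQ; exists (setT, D) => /=; last by move=> [s t] [_ Dt]; exact: DQ.
by split; [exact: filterT|exact: withinT].
Qed.

Lemma q_continuous : continuous (@q R n).
Proof.
move=> A; suff H : @q R n @ within setT (nbhs A) --> q A.
  by move=> N /H; exact: (@filterS _ _ (nbhs_filter A) _ _ (fun B K => K I)).
apply: (cvg_param (@cvg_within_id _ setT A)).
move=> g xi xiA AE; exists (fun x => x.1.2); split.
  rewrite (q_eq xiA AE).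
  exact: (cvg_comp _ _ (@cvg_fst _ _ (nbhs (g, xi)) (nbhs A) _)
    (@cvg_snd _ _ (nbhs g) (nbhs xi) _)).
by apply: (@near2_within _ _ (nbhs (g, xi)) (nbhs A)) =>
  -[h eta] B _ /= etaA BE; exact: q_eq BE.
Qed.

Lemma V_gap i (A : G) : V R i A <-> 0 < gap (q A) i.
Proof. by have [qA _] := qP A; split=> [[]|]. Qed.

Lemma V_open i : open (@V R n i).
Proof.
have -> : @V R n i = (fun A => gap (q A) i) @^-1` [set x | 0 < x].
  by rewrite eqEsubset; split=> A /V_gap.
apply: open_comp; last exact: open_gt.
move=> A _; exact: (cvg_gap (i := i) (@q_continuous A)).
Qed.

(** The cyclic gaps of a point of the alcove sum to 1, so they are not all nonpositive. *)
Lemma V_cover : (0 < n)%N -> \bigcup_i @V R n i = setT.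
Proof.
move=> n0; rewrite eqEsubset; split=> // A _.
have nS : (n.-1 < n)%N by rewrite prednK.
have gap1 : \sum_i gap (q A) i = 1.
  rewrite big_split/= sumrB [X in _ - X](_ : _ = \sum_i q A 0 i); last first.
    by rewrite [RHS](reindex_inj (@ordS_inj n)).
  rewrite subrr add0r (bigD1 (Ordinal nS))//= prednK// eqxx big1 ?addr0//.
  move=> i iN; case: eqP => // iE; case/eqP: iN; apply: val_inj => /=.
  by apply: succn_inj; rewrite prednK.
apply: contrapT => H; have : \sum_i gap (q A) i <= 0; last first.
  by rewrite gap1 ler10.
by apply: sumr_le0 => i _; rewrite leNgt; apply/negP => /V_gap Vi; apply: H; exists i.
Qed.

Lemma V2_param i j (A : G) : V R i A -> V R j A -> exists g xi,
  [/\ alcove_at i xi, alcove_at j xi & set_val A = Adj g (expt xi)].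
Proof. by move=> Vi Vj; have [_ [g gE]] := qP A; exists g, (q A). Qed.

Lemma V3_param i j k (A : G) : V R i A -> V R j A -> V R k A -> exists g xi,
  [/\ alcove_at i xi, alcove_at j xi, alcove_at k xi &
      set_val A = Adj g (expt xi)].
Proof. by move=> Vi Vj Vk; have [_ [g gE]] := qP A; exists g, (q A). Qed.

Section Line.
Variables (i j : 'I_n).
Hypothesis ij : (i < j)%N.
Let L := GR_line R i j.
Let B : set G := V R i `&` V R j.

Lemma GR_totalP A w : btotal L (A, w) -> exists g xi z,
  [/\ alcove_at i xi, alcove_at j xi, set_val A = Adj g (expt xi) &
      w = escale z (omega i j g)].
Proof.
move=> Aw; have [[/= Vi Vj] _] := Aw; have [g [xi [Ai Aj AE]]] := V2_param Vi Vj.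
have /(GR_fibreP ij w Ai Aj AE)[z zE] := Aw.
by exists g, xi, z.
Qed.

Lemma GR_scale_total z A w : btotal L (A, w) -> btotal L (A, escale z w).
Proof.
move=> /GR_totalP[g [xi [a [Ai Aj AE ->]]]]; apply/(GR_fibreP ij _ Ai Aj AE).
by exists (z * a); rewrite escaleA.
Qed.

Lemma GR_act_total g A w : btotal L (A, w) ->
  btotal L (SU_conj g A, ext_act (set_val g) w).
Proof.
move=> /GR_totalP[h [xi [a [Ai Aj AE ->]]]].
have AE' : set_val (SU_conj g A) = Adj (SU_mul g h) (expt xi).
  by rewrite SU_conjE AE AdjM.
apply/(GR_fibreP ij _ Ai Aj AE'); exists a.
by rewrite ext_act_scale omegaM.
Qed.

Section Trivialization.
Variable S : {set 'I_n}.

(** The locus where the coordinate [S] of a generator of the fibre is nonzero. The premise [B A]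
    makes being a neighbourhood a statement relative to [B], the form that [near_param] delivers. *)
Let U : set G := [set A | B A -> forall g xi, alcove xi ->
  set_val A = Adj g (expt xi) -> omega i j g S != 0].

(** Over [U], the vector of the fibre whose coordinate [S] is 1. Rescaling [omega i j g] leaves it
    unchanged, which removes the dependence on [g]. *)
Let sec (A : G) : ext R n := xget (fun=> 0) [set w | exists g xi,
  [/\ alcove xi, set_val A = Adj g (expt xi) &
      w = escale (omega i j g S)^-1 (omega i j g)]].

Let omega_ratio A g h xi xi' : B A -> alcove xi -> alcove xi' ->
  set_val A = Adj g (expt xi) -> set_val A = Adj h (expt xi') ->
  exists z, z != 0 /\ omega i j g = escale z (omega i j h).
Proof.
move=> [Vi Vj] xiA xiA' AE AE'.
have Ai := (V_eq i xiA AE).1 Vi; have Aj := (V_eq j xiA AE).1 Vj.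
apply: (omega_param ij Ai Aj); rewrite -AE AE'; congr (Adj _ (expt _)).
exact: alcove_uniq (etrans (esym AE') AE).
Qed.

Let sec_eq A g xi : U A -> B A -> alcove xi -> set_val A = Adj g (expt xi) ->
  sec A = escale (omega i j g S)^-1 (omega i j g).
Proof.
move=> UA BA xiA AE; rewrite /sec; case: xgetP => [w _|H]; last first.
  by case: (H (escale (omega i j g S)^-1 (omega i j g))); exists g, xi.
move=> [h [xi' [xiA' AE' ->]]].
have [z [z0 ->]] := omega_ratio BA xiA' xiA AE' AE.
rewrite escaleA {1}/escale invfM mulrAC mulVf// mul1r.
by [].
Qed.

Let U_nbhs A : U A -> B A -> nbhs A U.
Proof.
move=> UA BA; apply: (near_param (@cvg_within_id _ B A)).
move=> g xi xiA AE; have o0 := UA BA g xi xiA AE.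
have oc0 : (fun h : G => omega i j h) @ nbhs g --> omega i j g.
  exact: (cvg_omega (@cvg_id _ (nbhs g))).
have oc : (fun h : G => omega i j h S) @ nbhs g --> omega i j g S.
  by move/cvg_prodP: oc0; exact.
have N : \forall h \near g, omega i j h S != 0 by apply: cvgr_neq0 oc o0.
exists ([set gx : G * 'rV[R]_n | omega i j gx.1 S != 0], B).
  split=> /=; last exact: withinT.
  by exists ([set h | omega i j h S != 0], setT) => //=;
    [split=> //; exact: filterT|move=> [? ?] []].
move=> [[h eta] A'] /= [hS BA'] etaA A'E g' xi' xiA' A'E'.
have [z [z0 ->]] := omega_ratio BA' xiA' etaA A'E' A'E.
by rewrite /escale mulf_neq0.
Qed.

Let sec_cont : {within U `&` B, continuous sec}.
Proof.
apply/subspace_continuousP => A [UA BA].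
apply: (@cvg_param R n _ _ (U `&` B) id sec A (@cvg_within_id _ _ A)).
move=> g xi xiA AE; rewrite (sec_eq UA BA xiA AE).
exists (fun x => escale (omega i j x.1.1 S)^-1 (omega i j x.1.1)); split.
  have c1 : (fun x : (G * 'rV[R]_n) * G => omega i j x.1.1) @ nbhs ((g, xi), A) -->
      omega i j g.
    apply: cvg_omega; exact: (cvg_comp _ _ (@cvg_fst _ _ (nbhs (g, xi)) (nbhs A) _)
      (@cvg_fst _ _ (nbhs g) (nbhs xi) _)).
  have /cvg_prodP/(_ S) c2 := c1.
  apply: cvg_escale c1; apply: cvgV => //.
  exact: UA AE.
by apply: (@near2_within _ _ (nbhs (g, xi)) (nbhs A)) =>
  -[h eta] A' [UA' BA'] /= etaA A'E; exact: sec_eq A'E.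
Qed.

Lemma GR_triv A : B A -> U A -> exists (U : set G) (s : G -> bspace L)
      (c : bspace L -> C),
    [/\ nbhs A U,
        forall A', U A' -> B A' ->
          [/\ btotal L (s A'), bproj (s A') = A' &
              forall z, c (bscale z (s A')) = z],
        forall v, btotal L v -> U (bproj v) ->
          bscale (c v) (s (bproj v)) = v,
        {within U `&` B, continuous s} &
        {within btotal L `&` [set v | U (bproj v)], continuous c}].
Proof.
(* Since [sec] has coordinate 1 at [S], the coordinate [S] of a vector is also its coordinate in the
   fibre. *)
move=> BA UA; exists U, (fun A' => (A', sec A')), (fun v => v.2 S); split.
- exact: U_nbhs.
- move=> A' UA' BA'; have [Vi Vj] := BA'.
  have [g [xi [Ai Aj AE]]] := V2_param Vi Vj; have xiA := proj1 Ai.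
  have sE := sec_eq UA' BA' xiA AE; rewrite sE; split; last first.
  + by move=> z; rewrite /= /escale mulVf ?mulr1//; exact: UA' AE.
  + by [].
  + by apply/(GR_fibreP ij _ Ai Aj AE); exists (omega i j g S)^-1.
- move=> [A' w] wt UA'; have [BA' _] := wt.
  have [g [xi [z [Ai Aj AE ->]]]] := GR_totalP wt; have xiA := proj1 Ai.
  rewrite /bscale/=; congr (_, _); rewrite (sec_eq UA' BA' xiA AE).
  apply: funext => T; rewrite /escale -!mulrA; congr (_ * _).
  by rewrite mulrA mulfV ?mul1r//; exact: UA' AE.
- apply/subspace_continuousP => A' UBA'.
  have /subspace_continuousP/(_ A' UBA') c2 := sec_cont.
  exact: (cvg_pair (@cvg_within_id _ (U `&` B) A') c2).
- apply/subspace_continuousP => -[A' w] _; apply: cvg_withinW.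
  have c : (fun x : G * ext R n => x.2) @ nbhs (A', w) --> (w : ext R n).
    exact: cvg_snd.
  by have /cvg_prodP/(_ S) := c.
Qed.

End Trivialization.

Lemma GR_line_bundle : is_line_bundle B L.
Proof.
split.
- by move=> [A w] [].
- apply/subspace_continuousP => -[A w] _; apply: cvg_withinW; exact: cvg_fst.
- by move=> z [A w]; exact: GR_scale_total.
- by [].
- by move=> [A w] _; rewrite /bscale/=; congr (_, _); exact: escale1.
- by move=> a b [A w] _; rewrite /bscale/=; congr (_, _); exact: escaleA.
- apply/subspace_continuousP => -[z [A w]] _; apply: cvg_withinW.
  have c1 : fst @ nbhs (z, (A, w)) --> z by exact: cvg_fst.
  have c2 : (fun x : C * (G * ext R n) => x.2.1) @ nbhs (z, (A, w)) --> A.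
    exact: (cvg_comp _ _ (@cvg_snd _ _ (nbhs z) (nbhs (A, w)) _)
      (@cvg_fst _ _ (nbhs A) (nbhs w) _)).
  have c3 : (fun x : C * (G * ext R n) => x.2.2) @ nbhs (z, (A, w)) --> w.
    exact: (cvg_comp _ _ (@cvg_snd _ _ (nbhs z) (nbhs (A, w)) _)
      (@cvg_snd _ _ (nbhs A) (nbhs w) _)).
  exact: (cvg_pair c2 (cvg_escale c1 c3)).
- move=> A BA; have [Vi Vj] := BA; have [g [xi [Ai Aj AE]]] := V2_param Vi Vj.
  have [S S0] := omega_neq0 i j g; apply: (@GR_triv S) => // _ h xi' xiA' AE'.
  have xiE : xi' = xi.
    exact: (alcove_uniq xiA' (proj1 Ai) (etrans (esym AE') AE)).
  rewrite xiE in AE'.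
  have [z [z0 ->]] := omega_param ij Ai Aj (etrans (esym AE') AE).
  by rewrite /escale mulf_neq0.
- by move=> g [A w]; exact: GR_act_total.
- by [].
- by move=> g z [A w] _; rewrite /bact/=; congr (_, _); exact: ext_act_scale.
- move=> [A w] _; rewrite /bact/=; congr (_, _); last by rewrite SU_oneE ext_act1.
  by apply: SU_eq; rewrite SU_conjE Adj1.
- move=> g h [A w] _; rewrite /bact/=; congr (_, _); last by rewrite SU_mulE ext_actM.
  by apply: SU_eq; rewrite !SU_conjE AdjM.
- apply/subspace_continuousP => -[g [A w]] _; apply: cvg_withinW.
  have c1 : fst @ nbhs (g, (A, w)) --> g by exact: cvg_fst.
  have c2 : (fun x : G * (G * ext R n) => x.2.1) @ nbhs (g, (A, w)) --> A.
    exact: (cvg_comp _ _ (@cvg_snd _ _ (nbhs g) (nbhs (A, w)) _)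
      (@cvg_fst _ _ (nbhs A) (nbhs w) _)).
  have c3 : (fun x : G * (G * ext R n) => x.2.2) @ nbhs (g, (A, w)) --> w.
    exact: (cvg_comp _ _ (@cvg_snd _ _ (nbhs g) (nbhs (A, w)) _)
      (@cvg_snd _ _ (nbhs A) (nbhs w) _)).
  exact: (cvg_pair (cvg_SU_conj c1 c2) (cvg_ext_act (cvg_set_val c1) c3)).
Qed.

End Line.
End GRBundle.

(** * The product of the bundles E_ij and the comparison with eigenlines *)

Section GRGerbe.
Variables (R : realType) (n : nat).
Local Notation C := (Cplx R).
Local Notation G := (SU R n).

(** All indices of the first block precede those of the second, so no sign appears in the product of
    the generators. *)
Lemma Jset_cat (i j k : 'I_n) : (i < j < k)%N ->
  [/\ [disjoint Jset i j & Jset j k]%B,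
      (Jset i j :|: Jset j k)%SET = Jset i k &
      inversions (Jset i j) (Jset j k) = 0%N].
Proof.
move=> /andP[ij jk]; split.
- rewrite -setI_eq0; apply/eqP/setP => l; rewrite !inE.
  by case: (leqP l j) => lj; rewrite ?andbF.
- apply/setP => l; rewrite !inE; case: (leqP l j) => lj /=.
    by rewrite andbT orbF (leq_trans lj (ltnW jk)) andbT.
  by rewrite andbF (ltn_trans ij lj).
- apply: inversions_eq0 => s t; rewrite !inE => /andP[_ sj] /andP[jt _].
  exact: leq_trans sj (ltnW jt).
Qed.

Lemma bwedge_Jset_cat (i j k : 'I_n) (x : 'I_n -> 'cV[C]_n) : (i < j < k)%N ->
  wedge (bwedge x (Jset i j)) (bwedge x (Jset j k)) = bwedge x (Jset i k).
Proof.
by move=> /Jset_cat[d u inv0]; rewrite bwedgeM d u inv0 escale1.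
Qed.

Lemma omega_wedge (i j k : 'I_n) (g : G) : (i < j < k)%N ->
  wedge (omega i j g) (omega j k g) = omega i k g.
Proof.
by move=> ijk; rewrite /omega -ext_act_wedge -!bwedge_std bwedge_Jset_cat.
Qed.

Lemma cvg_proj (I : eqType) (K : I -> topologicalType) (X : topologicalType)
    (p : X * prod_topology K) k :
  (fun q : X * prod_topology K => q.2 k) @ nbhs p --> p.2 k.
Proof.
have c : (fun q : X * prod_topology K => q.2) @ nbhs p --> p.2.
  by case: p => x w; exact: cvg_snd.
by have /cvg_prodP/(_ k) := c.
Qed.

Lemma cvg_fst_comp (T X Y : topologicalType) (f : T -> X * Y) (t : T) :
  f @ nbhs t --> f t -> (fun x => (f x).1) @ nbhs t --> (f t).1.
Proof.
move=> fc; apply: (cvg_comp _ _ fc).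
by case: (f t) => a b; exact: cvg_fst.
Qed.

Lemma cvg_snd_comp (T X Y : topologicalType) (f : T -> X * Y) (t : T) :
  f @ nbhs t --> f t -> (fun x => (f x).2) @ nbhs t --> (f t).2.
Proof.
move=> fc; apply: (cvg_comp _ _ fc).
by case: (f t) => a b; exact: cvg_snd.
Qed.

Lemma GR_prod_total (i j k : 'I_n) (u : bspace (GR_line R i j))
    (v : bspace (GR_line R j k)) : (i < j < k)%N ->
  btotal (GR_line R i j) u -> btotal (GR_line R j k) v -> bproj u = bproj v ->
  btotal (GR_line R i k) (GR_prod u v).
Proof.
case: u v => A u [A' v] ijk; rewrite /bproj/= => ut vt AA'.
have /andP[ij jk] := ijk; have ik := ltn_trans ij jk.
rewrite -AA' in vt; have [[/= Vi Vj] _] := ut; have [[/= _ Vk] _] := vt.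
have [g [xi [Ai Aj Ak AE]]] := V3_param Vi Vj Vk.
have /(GR_fibreP ij u Ai Aj AE)[a ->] := ut.
have /(GR_fibreP jk v Aj Ak AE)[b ->] := vt.
apply/(GR_fibreP ik _ Ai Ak AE); exists (a * b).
by rewrite /GR_prod/= wedge_scalel wedge_scaler escaleA omega_wedge.
Qed.

Lemma GR_prod_onto (i j k : 'I_n) (A : G) (w : ext R n) : (i < j < k)%N ->
  (V R i `&` V R j `&` V R k) A -> btotal (GR_line R i k) (A, w) ->
  exists u v, [/\ btotal (GR_line R i j) (A, u), btotal (GR_line R j k) (A, v) &
    w = wedge u v].
Proof.
move=> ijk [[Vi Vj] Vk] wt.
have /andP[ij jk] := ijk; have ik := ltn_trans ij jk.
have [g [xi [Ai Aj Ak AE]]] := V3_param Vi Vj Vk.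
have /(GR_fibreP ik w Ai Ak AE)[a ->] := wt.
exists (escale a (omega i j g)), (omega j k g); split.
- by apply/(GR_fibreP ij _ Ai Aj AE); exists a.
- by apply/(GR_fibreP jk _ Aj Ak AE); exists 1; rewrite escale1.
- by rewrite wedge_scalel omega_wedge.
Qed.

Lemma GR_prod_tensor (i j k : 'I_n) : (i < j < k)%N ->
  @tensor_iso R n bool (V R i `&` V R j `&` V R k)
    (fun b => if b then GR_line R i j else GR_line R j k) (GR_line R i k)
    (fun _ v => @GR_prod R n i j k (v true) (v false)).
Proof.
move=> ijk; have /andP[ij jk] := ijk; have ik := ltn_trans ij jk.
split.
- move=> A v [_ /= vP]; have [ut uA] := vP true; have [vt vA] := vP false.
  split; last exact: uA.
  by apply: GR_prod_total => //; exact: etrans uA (esym vA).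
- move=> A v [] z _ /=; rewrite /GR_prod /bscale /=; congr (_, _).
    exact: wedge_scalel.
  exact: wedge_scaler.
- move=> g A v _; rewrite /GR_prod /bact /=; congr (_, _).
  by rewrite ext_act_wedge.
- apply/subspace_continuousP => p _; apply: cvg_withinW.
  have cu := @cvg_proj bool
    (fun b => bspace (if b then GR_line R i j else GR_line R j k)) G p true.
  have cv := @cvg_proj bool
    (fun b => bspace (if b then GR_line R i j else GR_line R j k)) G p false.
  have u1 := @cvg_fst_comp _ G (ext R n) _ p cu.
  have u2 := @cvg_snd_comp _ G (ext R n) _ p cu.
  have v2 := @cvg_snd_comp _ G (ext R n) _ p cv.
  exact: (cvg_pair u1 (cvg_wedge u2 v2)).
- move=> A [A' w] BA wt /= A'A; rewrite A'A in wt *.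
  have [u [v [ut vt ->]]] := GR_prod_onto ijk BA wt.
  exists (fun b => if b return bspace (if b then GR_line R i j else GR_line R j k)
    then (A, u) else (A, v)).
  by split=> //; split=> // -[].
Qed.

Lemma GR_is_gerbe : (0 < n)%N -> is_gerbe (@V R n) (GR_gerbe R n).
Proof.
move=> n0; split.
- by split; [exact: V_open|exact: V_cover].
- by move=> i j; exact: GR_line_bundle.
- by move=> i j k; exact: GR_prod_tensor.
- move=> i j k l ijk kl u v w _ _ _ _ _.
  by rewrite /gprod/= /GR_prod /= wedgeA.
Qed.

(** A zero gap makes the eigenvalues at [i] and at its cyclic successor coincide. These are two
    different positions when [n > 1], so the eigenvalue would have multiplicity at least 2. *)
Lemma regular_V (i : 'I_n) (A : G) : (1 < n)%N -> regular R n A -> V R i A.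
Proof.
move=> n2 Areg; apply/V_gap; have [qA [g AE]] := qP A.
rewrite lt_neqAle eq_sym; apply/andP; split; last by case: qA.
apply/negP => /eqP g0.
have ne : ordS i != i.
  apply/eqP => /(congr1 val) /=; have [iE|iE] := eqVneq i.+1 n.
    by rewrite iE modnn; lia.
  by rewrite modn_small; have := ltn_ord i; lia.
have ee : expi (q A 0 (ordS i)) = expi (q A 0 i).
  have -> : q A 0 i = q A 0 (ordS i) - (i.+1 == n)%:R.
    by move: g0; rewrite /gap; lra.
  rewrite expiD; case: eqP => _; last by rewrite oppr0 expi0 mulr1.
  by have := expi_int R (-1); rewrite mulrN1z => ->; rewrite mulr1.
have cp : char_poly (set_val A) = char_poly (expt (q A)).
  by apply: (char_poly_conj (SU_unit g)); exact/Adj_eq.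
have mE a : mup a (char_poly (set_val A)) = #|[pred k | expi (q A 0 k) == a]|.
  by rewrite cp /expt mup_char_poly_diag; apply: eq_card => k; rewrite !inE mxE.
pose a : C := expi (q A 0 i).
have c2 : (1 < #|[pred k | expi (q A 0%R k) == a]|)%N.
  apply/card_gt1P; exists (ordS i), i; split; rewrite ?inE; last exact: ne.
    by rewrite ee; exact: eqxx.
  exact: eqxx.
have := Areg a; rewrite mE => K.
have [r|r] := boolP (root (char_poly (set_val A)) a).
  by move: c2; rewrite K.
by have := mupNroot r; rewrite mE => m0; rewrite m0 in c2.
Qed.

(** The product does not commute, so this cannot be a mere reindexing: the enumeration of the
    subtype has to be shown to list the ordinals in the same order. *)
Lemma big_sig_wedge (P : pred 'I_n) (F : {k : 'I_n | P k} -> ext R n)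
    (F' : 'I_n -> ext R n) : (forall k, F k = F' (val k)) ->
  \big[@wedge R n/@ext_one R n]_(k : {k : 'I_n | P k}) F k =
  \big[@wedge R n/@ext_one R n]_(k < n | P k) F' k.
Proof.
move=> FF'; rewrite (eq_bigr _ (fun k _ => FF' k)) -(big_map val predT F') -[RHS]big_filter.
apply: (congr1 (fun s => \big[@wedge R n/@ext_one R n]_(k <- s) F' k)).
rewrite ![index_enum _]unlock.
rewrite [X in map _ X](_ : _ = pmap insub (Finite.enum (ordinal n))).
  rewrite (pmap_filter (insubK _)); apply: eq_filter => x; exact: isSome_insub.
by rewrite {1}Finite.enum.unlock.
Qed.

Lemma GR_restrE (i j : 'I_n) (A : G) (x : 'I_n -> 'cV[C]_n)
    (v : forall k : {k : 'I_n | (i < k <= j)%N}, bspace (eigenline R (val k))) :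
  (forall k, (v k).2 = x (val k)) ->
  GR_restr A v = (A, bwedge x (Jset i j)).
Proof.
move=> vx; rewrite /GR_restr; congr (_, _).
rewrite (@big_sig_wedge _ _ (fun k => ext_vec (x k))) => [|k]; last by rewrite vx.
by apply: eq_bigl => k; rewrite inE.
Qed.

(** [GR_line] asks for a family indexed by all ordinals with values in the spectral subspace;
    extension by zero provides one. *)
Lemma eigenline_ext (i j : 'I_n)
    (v : forall k : {k : 'I_n | (i < k <= j)%N}, bspace (eigenline R (val k))) :
  exists x : 'I_n -> 'cV[C]_n, (forall k, (v k).2 = x (val k)) /\
    (forall k, k \notin Jset i j -> x k = 0).
Proof.
exists (fun k => if insub k is Some k' then (v k').2 else 0); split=> [k|k].
  by rewrite valK.
by rewrite inE => kJ; rewrite insubN.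
Qed.

Lemma GR_restr_tensor (i j : 'I_n) : (i < j)%N ->
  @tensor_iso R n {k : 'I_n | (i < k <= j)%N} (regular R n)
    (fun k => eigenline R (val k)) (GR_line R i j) (@GR_restr R n i j).
Proof.
move=> ij; have n1 : (1 < n)%N by have := ltn_ord j; lia.
have Vr A k : regular R n A -> V R k A by exact: regular_V.
have bJ (x : 'I_n -> 'cV[C]_n) :
    \big[@wedge R n/@ext_one R n]_(k < n | (i < k <= j)%N) ext_vec (x k)
    = bwedge x (Jset i j).
  by apply: eq_bigl => k; rewrite inE.
split.
- move=> A v [Areg vP]; have [x [vx x0]] := eigenline_ext v.
  rewrite (GR_restrE A vx); split=> //; split; first by split; exact: Vr.
  exists x; split; last by rewrite bJ.
  move=> k; have [kJ|kJ] := boolP (k \in Jset i j); last first.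
    rewrite x0//; exists (fun=> 0); split=> [l _|]; last by rewrite big1.
    by rewrite mulmx0 scaler0.
  exists (fun l => if l == k then x k else 0); split=> [l lJ|].
    case: eqP => [->|_]; last by rewrite mulmx0 scaler0.
    have kJ' : (i < k <= j)%N by move: kJ; rewrite inE.
    have [[_ ke] kA] := vP (exist _ k kJ').
    by rewrite vx /= in ke; rewrite /= in kA; rewrite -kA.
  rewrite (bigD1 k)/= ?eqxx; last by move: kJ; rewrite inE.
  by rewrite big1 ?addr0// => l /andP[_ /negPf->].
- move=> A v k0 z _; have [x [vx x0]] := eigenline_ext v.
  rewrite (GR_restrE A vx).
  rewrite (@GR_restrE _ _ _ (fun k => (if k == val k0 then z else 1) *: x k)); last first.
    move=> k; rewrite (inj_eq val_inj); case: eqP => [->|_]; last by rewrite scale1r vx.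
    by rewrite /= vx.
  rewrite bwedge_scale (bigD1 (val k0))/= ?eqxx; last by rewrite inE; exact: (valP k0).
  rewrite big1 ?mulr1// => l /andP[_ /negPf->].
  by [].
- move=> g A v _; have [x [vx x0]] := eigenline_ext v.
  rewrite (GR_restrE A vx) (@GR_restrE _ _ _ (fun k => set_val g *m x k)); last first.
    by move=> k; rewrite /= vx.
  by rewrite /bact/= ext_act_bwedge.
- apply/subspace_continuousP => p _; apply: cvg_withinW.
  pose T := (G * prod_topology
    (fun k : {k : 'I_n | (i < k <= j)%N} => bspace (eigenline R (val k))))%type.
  have c1 : (fun q : T => q.1) @ nbhs p --> p.1 by case: p => A w; exact: cvg_fst.
  pose m (q : T) : ext R n := \big[@wedge R n/@ext_one R n]_k ext_vec (q.2 k).2.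
  have c2 : m @ nbhs p --> m p.
    apply: cvg_big_wedge => k _; apply: cvg_ext_vec.
    exact: (@cvg_snd_comp _ G 'cV[C]_n _ p (@cvg_proj _
      (fun k : {k : 'I_n | (i < k <= j)%N} => bspace (eigenline R (val k))) G p k)).
  exact: (cvg_pair c1 c2).
- move=> A [A' w] Areg wt /= A'A; rewrite A'A in wt *.
  have [g [xi [Ai Aj AE]]] := V2_param (Vr A i Areg) (Vr A j Areg).
  have /(GR_fibreP ij w Ai Aj AE)[z ->] := wt.
  have qA := q_eq (proj1 Ai) AE; have /Adj_eq Ag := AE.
  (* As in [GR_fibreP], the scalar is absorbed by the factor of index [j]; the columns of [g] are
     eigenvectors of [A]. *)
  pose x k := (if k == j then z else 1) *: col k (set_val g).
  exists (fun k : {k : 'I_n | (i < k <= j)%N} =>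
    (A, x (val k)) : bspace (eigenline R (val k))).
  split.
    split=> // k; split=> //; split=> //=.
    rewrite /x -scalemxAr scalerA mulrC -scalerA; congr (_ *: _).
    rewrite qA colE mulmxA Ag -mulmxA scalemxAr; congr (_ *m _).
    apply/colP => l; rewrite mul_diag_mx !mxE; case: eqP => [->//|].
    by rewrite !mulr0.
  rewrite (@GR_restrE _ _ _ x)//; congr (_, _).
  have jJ : j \in Jset i j by rewrite inE ij leqnn.
  rewrite /x bwedge_scale (bigD1 j)//= eqxx big1 ?mulr1; last first.
    by move=> k /andP[_ /negPf->].
  by rewrite /omega ext_act_delta.
Qed.

Lemma GR_extendsP : GR_extends R n.
Proof.
split=> [i j ij|i j k ijk A v Areg vP].
  split; last exact: GR_restr_tensor.
  have n1 : (1 < n)%N by have := ltn_ord j; lia.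
  by move=> A Areg; split; exact: regular_V.
rewrite !(@GR_restrE _ _ _ (fun l => (v l).2))//.
by rewrite /gprod/= /GR_prod /= bwedge_Jset_cat.
Qed.

End GRGerbe.

(** * Transport along isomorphisms *)

Section Transfer.
Variables (R : realType) (n : nat).
Local Notation C := (Cplx R).
Local Notation G := (SU R n).

Lemma within_comp (T U W : topologicalType) (D : set T) (E : set U)
    (f : T -> U) (g : U -> W) : {within D, continuous f} ->
  (forall x, D x -> E (f x)) -> {within E, continuous g} ->
  {within D, continuous (g \o f)}.
Proof.
move=> /subspace_continuousP fc DE /subspace_continuousP gc.
apply/subspace_continuousP => x Dx N /(gc _ (DE _ Dx)) Ng.
have := fc _ Dx _ Ng.
by apply: (@filterS _ (nbhs x) (nbhs_filter x)) => y /= K Dy; exact: K Dy (DE _ Dy).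
Qed.

Lemma within_ext (T U : topologicalType) (D : set T) (f g : T -> U) :
  (forall x, D x -> f x = g x) -> {within D, continuous f} ->
  {within D, continuous g}.
Proof.
move=> fg /subspace_continuousP fc.
apply/subspace_continuousP => x Dx; change (g @ within D (nbhs x) --> g x).
rewrite -(fg x Dx) => N /(fc _ Dx).
apply: (@filterS _ (nbhs x) (nbhs_filter x)) => y /= K Dy.
by rewrite -(fg y Dy); exact: K.
Qed.

Lemma within_pair (T U W : topologicalType) (D : set T) (f : T -> U) (g : T -> W) :
  {within D, continuous f} -> {within D, continuous g} ->
  {within D, continuous (fun x => (f x, g x))}.
Proof.
move=> /subspace_continuousP fc /subspace_continuousP gc.
apply/subspace_continuousP => x Dx; exact: (cvg_pair (fc _ Dx) (gc _ Dx)).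
Qed.

Lemma within_fst (U W : topologicalType) (D : set (U * W)) :
  {within D, continuous fst}.
Proof.
by apply/subspace_continuousP => -[x y] _; apply: cvg_withinW; exact: cvg_fst.
Qed.

Lemma within_snd (U W : topologicalType) (D : set (U * W)) :
  {within D, continuous snd}.
Proof.
by apply/subspace_continuousP => -[x y] _; apply: cvg_withinW; exact: cvg_snd.
Qed.

Section Line.
Variables (B : set G) (L M : bundle R n G) (phi : bspace L -> bspace M).
Hypothesis phi_iso : bundle_iso phi.

Lemma bundle_iso_inj u v : btotal L u -> btotal L v -> phi u = phi v -> u = v.
Proof.
have [_ _ _ _ [psi [_ psiK _ _]]] := phi_iso.
by move=> ut vt uv; rewrite -[u]psiK// uv psiK.
Qed.

(** On the total space, each structure map of [L] is that of [M] conjugated by [phi] and its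
    inverse. [bundle_iso] does not give the stability of [btotal L] under scaling and action, which
    is therefore assumed. *)
Lemma line_bundle_iso : is_line_bundle B M ->
  (forall z v, btotal L v -> btotal L (bscale z v)) ->
  (forall g v, btotal L v -> btotal L (bact g v)) -> is_line_bundle B L.
Proof.
move=> [Mbase Mcont Mst Msp M1 MA Msc Mtriv Mat Map Mas Ma1 MaM Mac] Lst Lat.
have [phit phis phia phic [psi [psit psiK phiK psic]]] := phi_iso.
have tot v : btotal L v -> btotal M (phi v) by case/phit.
have prj v : btotal L v -> bproj (phi v) = bproj v by case/phit.
have inj := bundle_iso_inj.
have prjpsi w : btotal M w -> bproj (psi w) = bproj w.
  by move=> wt; rewrite -prj ?phiK//; exact: psit.
split => //.
- by move=> v vt; rewrite -prj//; exact/Mbase/tot.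
- apply: (@within_ext _ _ _ (@bproj _ _ _ M \o phi)); first by move=> v /prj.
  exact: (within_comp phic tot Mcont).
- move=> z v vt; rewrite -prj; last exact: Lst.
  by rewrite phis// Msp ?prj//; exact: tot.
- move=> v vt; apply: inj => //; first exact: Lst.
  by rewrite phis// M1//; exact: tot.
- move=> a b v vt; apply: inj; do ?[exact: Lst|exact/Lst/Lst].
  by rewrite !phis//; [rewrite MA//; exact: tot|exact: Lst].
- apply: (@within_ext _ _ _ (psi \o ((fun zv : C * bspace M => bscale zv.1 zv.2)
      \o (fun zv : C * bspace L => (zv.1, phi zv.2))))).
    by move=> [z v] /= vt; rewrite -phis// psiK//; exact: Lst.
  apply: (@within_comp _ _ _ _ (@btotal _ _ _ M)) => //; last first.
    by move=> [z v] /= vt; apply: Mst; exact: tot.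
  apply: (@within_comp _ _ _ _ [set zv : C * bspace M | btotal M zv.2]) => //.
    apply: within_pair; first exact: within_fst.
    by apply: (@within_comp _ _ _ _ (@btotal _ _ _ L)) => //; exact: within_snd.
  by move=> [z v] /= vt; exact: tot.
- move=> A BA; have [U [s [c [AU sP cP sc cc]]]] := Mtriv A BA.
  exists U, (psi \o s), (c \o phi); split => //.
  + move=> A' UA' BA'; have [st sp sz] := sP A' UA' BA'; split.
    * exact: psit.
    * by rewrite /= prjpsi.
    * by move=> z; rewrite /= phis ?phiK//; exact: psit.
  + move=> v vt Uv; have vt' := tot v vt.
    have Bv : B (bproj v) by rewrite -prj//; exact: Mbase.
    have Uv' : U (bproj (phi v)) by rewrite prj.
    have [st _ _] := sP _ Uv Bv; have := cP _ vt' Uv'; rewrite prj// => cv.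
    apply: inj => //; first exact/Lst/psit.
    by rewrite phis ?phiK//; exact: psit.
  + apply: (@within_comp _ _ _ _ (@btotal _ _ _ M)) => // A' [UA' BA'].
    by have [] := sP A' UA' BA'.
  + apply: (@within_comp _ _ _ _ (btotal M `&` [set v | U (bproj v)])) => //.
      apply: continuous_subspaceW phic; exact: subIsetl.
    by move=> v [vt Uv]; split; [exact: tot|rewrite /= prj].
- move=> g v vt; rewrite -prj; last exact: Lat.
  by rewrite phia// Map ?prj//; exact: tot.
- move=> g z v vt; apply: inj; [exact/Lat/Lst|exact/Lst/Lat|].
  rewrite phia; last exact: Lst.
  rewrite !phis//; last exact: Lat.
  by rewrite phia// Mas//; exact: tot.
- move=> v vt; apply: inj => //; first exact: Lat.
  by rewrite phia// Ma1//; exact: tot.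
- move=> g h v vt; apply: inj; [exact: Lat|exact/Lat/Lat|].
  by rewrite !phia//; [rewrite MaM//; exact: tot|exact: Lat].
- apply: (@within_ext _ _ _ (psi \o ((fun gv : G * bspace M => bact gv.1 gv.2)
      \o (fun gv : G * bspace L => (gv.1, phi gv.2))))).
    by move=> [g v] /= vt; rewrite -phia// psiK//; exact: Lat.
  apply: (@within_comp _ _ _ _ (@btotal _ _ _ M)) => //; last first.
    by move=> [g v] /= vt; apply: Mat; exact: tot.
  apply: (@within_comp _ _ _ _ [set gv : G * bspace M | btotal M gv.2]) => //.
    apply: within_pair; first exact: within_fst.
    by apply: (@within_comp _ _ _ _ (@btotal _ _ _ L)) => //; exact: within_snd.
  by move=> [g v] /= vt; exact: tot.
Qed.

End Line.
End Transfer.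

(** * Transport of the gerbe structure *)

Section GerbeTransfer.
Variables (R : realType) (n : nat).
Local Notation C := (Cplx R).
Local Notation G := (SU R n).

Local Notation FP B L := (@fibre_product R n bool B L).

(** Identities are checked after applying the injective [phi], and the product of [L] is continuous
    because it is that of [M] followed by the inverse of [phi]. The last three hypotheses keep all
    points in the total spaces, where [phi] is injective. *)
Lemma gerbe_iso_is_gerbe (U : 'I_n -> set G) (L M : gerbe R n)
    (phi : forall i j, bspace (gline L i j) -> bspace (gline M i j)) :
  gerbe_iso phi -> is_gerbe U M ->
  (forall i j : 'I_n, (i < j)%N -> forall z v, btotal (gline L i j) v ->
     btotal (gline L i j) (bscale z v)) ->
  (forall i j : 'I_n, (i < j)%N -> forall g v, btotal (gline L i j) v ->
     btotal (gline L i j) (bact g v)) ->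
  (forall i j k : 'I_n, (i < j < k)%N -> forall u v,
     btotal (gline L i j) u -> btotal (gline L j k) v -> bproj u = bproj v ->
     btotal (gline L i k) (gprod L i j k u v)) ->
  is_gerbe U L.
Proof.
move=> [phi_iso phiM] [Ucov Mline Mten Massoc] Lst Lat Lprod.
have tot (i j : 'I_n) (v : bspace (gline L i j)) : (i < j)%N ->
    btotal (gline L i j) v -> btotal (gline M i j) (phi i j v).
  by move=> ij vt; have [/(_ v vt)[]] := phi_iso i j ij.
have prj (i j : 'I_n) (v : bspace (gline L i j)) : (i < j)%N ->
    btotal (gline L i j) v -> bproj (phi i j v) = bproj v.
  by move=> ij vt; have [/(_ v vt)[]] := phi_iso i j ij.
have phis (i j : 'I_n) z (v : bspace (gline L i j)) : (i < j)%N ->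
    btotal (gline L i j) v ->
    phi i j (bscale z v) = bscale z (phi i j v).
  by move=> ij vt; have [_ /(_ z v vt)] := phi_iso i j ij.
have phia (i j : 'I_n) g (v : bspace (gline L i j)) : (i < j)%N ->
    btotal (gline L i j) v ->
    phi i j (bact g v) = bact g (phi i j v).
  by move=> ij vt; have [_ _ /(_ g v vt)] := phi_iso i j ij.
have prodprj (i j k : 'I_n) (u : bspace (gline L i j))
    (v : bspace (gline L j k)) : (i < j < k)%N -> btotal (gline L i j) u ->
    btotal (gline L j k) v -> bproj u = bproj v ->
    bproj (gprod L i j k u v) = bproj u.
  move=> ijk ut vt uv; have /andP[ij jk] := ijk; have ik := ltn_trans ij jk.
  rewrite -[LHS]prj//; last exact: Lprod.
  rewrite phiM//; have [Mt _ _ _ _] := Mten i j k ijk.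
  have Bu : (U i `&` U j) (bproj (phi i j u)) := bproj_base (Mline i j ij) (tot _ _ _ ij ut).
  have Bv : (U j `&` U k) (bproj (phi j k v)) := bproj_base (Mline j k jk) (tot _ _ _ jk vt).
  rewrite !prj// -?uv in Bu Bv.
  have [|_ /= ->] := Mt (bproj u) (fun b => if b
    return bspace (if b then gline M i j else gline M j k)
    then phi i j u else phi j k v) => //.
  split=> /=; first by case: Bu => ? ?; case: Bv.
  by case; split; rewrite ?prj//; exact: tot.
split=> //.
- move=> i j ij; apply: (line_bundle_iso (phi_iso i j ij) (Mline i j ij)).
    exact: Lst.
  exact: Lat.
- move=> i j k ijk; have /andP[ij jk] := ijk; have ik := ltn_trans ij jk.
  have [Mt Ms Ma Mc Mo] := Mten i j k ijk.
  have [_ _ _ _ [psi [psit psiK phiK psic]]] := phi_iso i k ik.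
  pose LL b := if b then gline L i j else gline L j k.
  pose MM b := if b then gline M i j else gline M j k.
  (* [phi] applied to both factors; the types depend on the boolean, whence the annotated match. *)
  pose lift (v : forall b, bspace (LL b)) : forall b, bspace (MM b) :=
    fun b => (if b return bspace (LL b) -> bspace (MM b)
              then phi i j else phi j k) (v b).
  pose B := U i `&` U j `&` U k.
  have fpl A v : FP B LL (A, v) -> FP B MM (A, lift v).
    move=> [BA vP]; split=> // -[] /=.
      by have [vt vA] := vP true; rewrite prj//; split=> //; exact: tot.
    by have [vt vA] := vP false; rewrite prj//; split=> //; exact: tot.
  have inj := bundle_iso_inj (phi_iso i k ik).
  have phiP A v : FP B LL (A, v) ->
      [/\ btotal (gline L i k) (gprod L i j k (v true) (v false)),
        bproj (gprod L i j k (v true) (v false)) = A &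
        phi i k (gprod L i j k (v true) (v false)) =
        gprod M i j k (lift v true) (lift v false)].
    move=> [_ vP]; have [ut uA] := vP true; have [vt vA] := vP false.
    have uv : bproj (v true) = bproj (v false) := etrans uA (esym vA).
    by split; [exact: Lprod|rewrite prodprj|rewrite phiM].
  have fps A v b z : FP B LL (A, v) ->
      FP B LL (A, fun l => if l == b then bscale z (v l) else v l).
    move=> [BA vP]; split=> // -[] /=.
      have [vt vA] := vP true; case: eqP => // _; split; first exact: Lst.
      by rewrite -prj ?phis//; [rewrite (bscale_proj (Mline i j ij)) ?prj//;
        exact: tot|exact: Lst].
    have [vt vA] := vP false; case: eqP => // _; split; first exact: Lst.
    by rewrite -prj ?phis//; [rewrite (bscale_proj (Mline j k jk)) ?prj//;
        exact: tot|exact: Lst].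
  have fpa A v g : FP B LL (A, v) ->
      FP B LL (SU_conj g A, fun l => bact g (v l)).
    move=> [BA vP]; have [ut uA] := vP true; have [vt vA] := vP false.
    have ut' := tot _ _ _ ij ut; have vt' := tot _ _ _ jk vt.
    have uA' : bproj (bact g (phi i j (v true))) = SU_conj g A.
      by rewrite (bact_proj (Mline i j ij))// prj// uA.
    have vA' : bproj (bact g (phi j k (v false))) = SU_conj g A.
      by rewrite (bact_proj (Mline j k jk))// prj// vA.
    have := bproj_base (Mline i j ij) (bact_total (Mline i j ij) g ut').
    have := bproj_base (Mline j k jk) (bact_total (Mline j k jk) g vt').
    rewrite uA' vA' => -[_ Uk] [Ui Uj]; split=> // -[] /=.
      split; first exact: Lat.
      by rewrite -prj ?phia//; exact: Lat.
    split; first exact: Lat.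
    by rewrite -prj ?phia//; exact: Lat.
  split.
  + by move=> A v /phiP[].
  + move=> A v b z vP; have [t1 _ e1] := phiP _ _ vP.
    have [t2 _ e2] := phiP _ _ (fps _ _ b z vP).
    apply: inj => //; first exact: Lst.
    rewrite phis// e1; apply: (etrans e2).
    rewrite -(Ms A (lift v) b z (fpl _ _ vP)).
    have [ut _] := vP.2 true; have [vt _] := vP.2 false.
    by case: b {t2 e2}; rewrite /= phis.
  + move=> g A v vP; have [t1 _ e1] := phiP _ _ vP.
    have [t2 _ e2] := phiP _ _ (fpa _ _ g vP).
    apply: inj => //; first exact: Lat.
    rewrite phia// e1; apply: (etrans e2).
    rewrite -(Ma g A (lift v) (fpl _ _ vP)).
    have [ut _] := vP.2 true; have [vt _] := vP.2 false.
    by rewrite /= !phia.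
  + pose Phi (p : G * prod_topology (fun b => bspace (LL b))) :
      G * prod_topology (fun b => bspace (MM b)) := (p.1, lift p.2).
    apply: (@within_ext _ _ _ (psi \o ((fun p : G * prod_topology (fun b => bspace (MM b)) =>
        gprod M i j k (p.2 true) (p.2 false)) \o Phi))).
      by move=> [A v] /phiP[/= t1 _ e1]; rewrite -e1 psiK.
    apply: (@within_comp _ _ _ _ (@btotal _ _ _ (gline M i k))) => //; last first.
      by move=> [A v] /fpl/Mt[].
    apply: (@within_comp _ _ _ _ (FP B MM)) => //; last first.
      by move=> [A v] /fpl.
    apply: within_pair; first exact: within_fst.
    apply/subspace_continuousP => -[A v] vP.
    apply/cvg_prodP => b.
    have pc : {within FP B LL, continuous
        (fun p : G * prod_topology (fun b => bspace (LL b)) => p.2 b)}.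
      by apply/subspace_continuousP => p _; apply: cvg_withinW; exact: cvg_proj.
    case: b pc => pc.
      have [_ _ _ phic _] := phi_iso i j ij.
      have /subspace_continuousP/(_ (A, v) vP) := within_comp pc
        (fun p (pP : FP B LL p) => (pP.2 true).1) phic.
      by [].
    have [_ _ _ phic _] := phi_iso j k jk.
    have /subspace_continuousP/(_ (A, v) vP) := within_comp pc
      (fun p (pP : FP B LL p) => (pP.2 false).1) phic.
    by [].
  (* The image of [w] is decomposed in [M], and the two factors are brought back to [L] by the
     inverse isomorphisms. *)
  + move=> A w BA wt wA; have [|v' [[_ vP] vE]] := Mo A (phi i k w) BA (tot _ _ _ ik wt).
      by rewrite prj.
    have [_ _ _ _ [psi1 [psit1 _ phiK1 _]]] := phi_iso i j ij.
    have [_ _ _ _ [psi2 [psit2 _ phiK2 _]]] := phi_iso j k jk.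
    have [ut uA] := vP true; have [vt vA] := vP false.
    pose v : forall b, bspace (LL b) := fun b => (if b return bspace (MM b) -> bspace (LL b)
              then psi1 else psi2) (v' b).
    have fv : FP B LL (A, v).
      split=> // -[] /=.
        by rewrite -prj ?phiK1//; [split=> //|]; exact: psit1.
      by rewrite -prj ?phiK2//; [split=> //|]; exact: psit2.
    exists v; split=> //; have [t1 _ e1] := phiP _ _ fv.
    by apply: inj => //; rewrite e1 /lift/= phiK1// phiK2.
- move=> i j k l ijk kl u v w ut vt wt uv vw.
  have /andP[ij jk] := ijk; have ik := ltn_trans ij jk.
  have jl := ltn_trans jk kl; have il := ltn_trans ij jl.
  have ikl : (i < k < l)%N by rewrite ik.
  have jkl : (j < k < l)%N by rewrite jk.
  have ijl : (i < j < l)%N by rewrite ij.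
  have uvt := Lprod i j k ijk u v ut vt uv.
  have vwt := Lprod j k l jkl v w vt wt vw.
  have uvw : bproj (gprod L i j k u v) = bproj w by rewrite prodprj// uv vw.
  have uvw' : bproj u = bproj (gprod L j k l v w) by rewrite prodprj.
  apply: (bundle_iso_inj (phi_iso i l il)); [exact: Lprod|exact: Lprod|].
  rewrite !phiM//; apply: Massoc => //; rewrite ?prj//; exact: tot.
Qed.

End GerbeTransfer.

Local Open Scope quotient_scope.

(** * The isomorphism between L_ij and E_ij *)

Section BasicGerbeIso.
Variables (R : realType) (n : nat).
Local Notation C := (Cplx R).
Local Notation G := (SU R n).
Local Notation wt i j := (vertex R j - vertex R i).

Lemma chi_is_character (i j : 'I_n) : (i < j)%N -> is_character (wt i j) (chi i j).
Proof.
move=> ij; split.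
- apply/subspace_continuousP => g _; apply: cvg_withinW.
  have c : (fun h : G => omega i j h) @ nbhs g --> omega i j g.
    exact: (cvg_omega (@cvg_id _ (nbhs g))).
  by have /cvg_prodP/(_ (Jset i j)) := c.
- by move=> g h _; exact: chiM.
- by move=> xi h; exact: chi_expt.
Qed.

(** [weight_char] is some character, obtained by choice: [chi] shows that one exists, and
    [character_uniq] that all agree on the stabilizer. *)
Lemma weight_charE (i j : 'I_n) (h : G) : (i < j)%N -> stab (wt i j) h ->
  weight_char (wt i j) h = chi i j h.
Proof.
move=> ij hS; have chP := chi_is_character ij.
rewrite /weight_char; case: xgetP => [c _ cP|H]; last by case: (H _ chP).
exact: (character_uniq cP chP hS).
Qed.

Lemma cls_repr (mu : 'rV[R]_n) (x : assoc_space mu) :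
  cls mu (repr x).1 (repr x).2 = x.
Proof. by rewrite /cls -surjective_pairing reprK. Qed.

Lemma clsP (mu : 'rV[R]_n) (g h : G) (z w : C) : cls mu g z = cls mu h w <->
  exists k, [/\ stab mu k, g = SU_mul h k & w = weight_char mu k * z].
Proof.
split=> [/eqmodP/asboolP[k [kS /= gE wE]]|[k [kS gE wE]]]; first by exists k.
by apply/eqmodP/asboolP; exists k.
Qed.

Lemma cls_mul (mu : 'rV[R]_n) (g k : G) (z : C) : stab mu k ->
  cls mu (SU_mul g k) z = cls mu g (weight_char mu k * z).
Proof. by move=> kS; apply/clsP; exists k. Qed.

Lemma cls_continuous (mu : 'rV[R]_n) :
  continuous (fun p : G * C => cls mu p.1 p.2).
Proof.
have -> : (fun p : G * C => cls mu p.1 p.2) =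
    \pi_(quotient_topology {eq_quot assoc_rel mu}) by apply: funext => -[].
exact: pi_continuous.
Qed.

Section Line.
Variables (i j : 'I_n).
Hypothesis ij : (i < j)%N.

Definition phi_fibre (x : assoc_space (wt i j)) : ext R n :=
  escale (repr x).2 (omega i j (repr x).1).

Lemma phi_fibre_cls g z : phi_fibre (cls _ g z) = escale z (omega i j g).
Proof.
rewrite /phi_fibre; have /clsP := cls_repr (cls (wt i j) g z).
move=> [k [kS rE zE]].
by rewrite rE omegaM_stab// escaleA [in RHS]zE weight_charE// mulrC.
Qed.

Lemma phi_fibre_continuous : continuous phi_fibre.
Proof.
apply: (@repr_comp_continuous _ {eq_quot assoc_rel (wt i j)} _
  (fun p : G * C => escale p.2 (omega i j p.1) : ext R n)).
  move=> [a b].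
  have c1 : (fst : G * C -> G) @ nbhs (a, b) --> a by exact: cvg_fst.
  have c2 : (snd : G * C -> C) @ nbhs (a, b) --> b by exact: cvg_snd.
  exact: (cvg_escale c2 (cvg_omega c1)).
move=> [g z] [h w] /eqP gh; apply/eqP.
by rewrite -!phi_fibre_cls /cls; congr phi_fibre.
Qed.

Definition phi_line (p : bspace (basic_line R i j)) : bspace (GR_line R i j) :=
  (p.1, phi_fibre p.2).

Section Fibre.
Variables (A : G) (g : G) (xi : 'rV[R]_n).
Hypotheses (Ai : alcove_at i xi) (Aj : alcove_at j xi)
  (AE : set_val A = Adj g (expt xi)).

(** If [r, w] lies over the value of [theta] at [A], then [r] and [g] move mu_j - mu_i to the same
    matrix; so [g^-1 r] is in the stabilizer and can be pushed into the scalar. *)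
Lemma basic_fibreP x : btotal (basic_line R i j) (A, x) <->
  exists z, x = cls _ g z.
Proof.
have thE := theta_eq ij Ai Aj AE.
have BA : (V R i `&` V R j) A.
  by split; [exact/(V_eq i (proj1 Ai) AE)|exact/(V_eq j (proj1 Ai) AE)].
split=> [[_ _ /=]|[z ->]].
  rewrite thE => rE; set r := repr x in rE.
  have kS : stab (wt i j) (SU_mul (SU_inv g) r.1).
    by rewrite /stab/= AdjM rE AdjK.
  exists (weight_char (wt i j) (SU_mul (SU_inv g) r.1) * r.2).
  rewrite -cls_mul// SU_mulA SU_mulgV SU_mul1g.
  exact/esym/cls_repr.
split=> //=; rewrite thE.
have /clsP[k [kS -> _]] := cls_repr (cls (wt i j) g z).
by rewrite AdjM; congr Adj.
Qed.

Lemma phi_fibre_inj z w : phi_fibre (cls (wt i j) g z) = phi_fibre (cls (wt i j) g w) ->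
  z = w.
Proof.
rewrite !phi_fibre_cls => e; have [S S0] := omega_neq0 i j g.
by have := congr1 (fun f : ext R n => f S) e; rewrite /escale => /(mulIf S0).
Qed.

End Fibre.

Lemma basic_totalP A x : btotal (basic_line R i j) (A, x) -> exists g xi z,
  [/\ alcove_at i xi, alcove_at j xi, set_val A = Adj g (expt xi) & x = cls _ g z].
Proof.
move=> Ax; have [[/= Vi Vj] _ _] := Ax; have [g [xi [Ai Aj AE]]] := V2_param Vi Vj.
by have /(basic_fibreP Ai Aj AE)[z zE] := Ax; exists g, xi, z.
Qed.

Lemma basic_scale_total z v : btotal (basic_line R i j) v ->
  btotal (basic_line R i j) (bscale z v).
Proof.
case: v => A x /basic_totalP[g [xi [w [Ai Aj AE ->]]]].
apply/(basic_fibreP Ai Aj AE); rewrite /=.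
have /clsP[k [kS -> _]] := cls_repr (cls (wt i j) g w).
by rewrite cls_mul//; eexists.
Qed.

Lemma basic_act_total h v : btotal (basic_line R i j) v ->
  btotal (basic_line R i j) (bact h v).
Proof.
case: v => A x /basic_totalP[g [xi [w [Ai Aj AE ->]]]].
have AE' : set_val (SU_conj h A) = Adj (SU_mul h g) (expt xi).
  by rewrite SU_conjE AE AdjM.
apply/(basic_fibreP Ai Aj AE'); rewrite /=.
have /clsP[k [kS -> _]] := cls_repr (cls (wt i j) g w).
by rewrite SU_mulA cls_mul//; eexists.
Qed.

(** The inverse of [phi_fibre] over [p.1], by choice; the default value concerns only points outside
    the total space, and [psi_eq] gives the value on it. *)
Let psi_fibre (p : G * ext R n) : assoc_space (wt i j) :=
  xget (cls _ (SU_one R n) 0) [set x | btotal (basic_line R i j) (p.1, x) /\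
    phi_fibre x = p.2].

Let psi_eq A g xi z : alcove_at i xi -> alcove_at j xi ->
  set_val A = Adj g (expt xi) ->
  psi_fibre (A, escale z (omega i j g)) = cls _ g z.
Proof.
move=> Ai Aj AE; rewrite /psi_fibre; case: xgetP => [x _ [xt xE]|H]; last first.
  case: (H (cls _ g z)); split; last exact: phi_fibre_cls.
  by apply/(basic_fibreP Ai Aj AE); exists z.
have /(basic_fibreP Ai Aj AE)[w wE] := xt; rewrite wE in xE *.
by congr cls; apply: (@phi_fibre_inj g); exact: etrans xE (esym (phi_fibre_cls _ _)).
Qed.

(** Near a parameter [g] with nonzero coordinate [S] of [omega i j g], the scalar of a vector [w]
    over a matrix of parameter [h] is the quotient of the coordinates [S] of [w] and of
    [omega i j h]. So the inverse is [cls] of [h] and this quotient, continuous in both. *)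
Let psi_cont : {within btotal (GR_line R i j), continuous psi_fibre}.
Proof.
apply/subspace_continuousP => -[A w] Aw.
have c : (fst : G * ext R n -> G) @ within (btotal (GR_line R i j)) (nbhs (A, w)) --> A.
  by apply: cvg_withinW; exact: cvg_fst.
apply: (@cvg_param R n _ _ _ _ psi_fibre (A, w) c) => g xi xiA; rewrite [(A, w).1]/= => AE.
have [Ai Aj] : alcove_at i xi /\ alcove_at j xi.
  by have [[/= Vi Vj] _] := Aw; split; [exact/(V_eq i xiA AE)|exact/(V_eq j xiA AE)].
have [S S0] := omega_neq0 i j g.
have ratio z h : omega i j h S != 0 -> escale z (omega i j h) S / omega i j h S = z.
  by move=> h0; rewrite /escale mulfK.
exists (fun x => cls _ x.1.1 (x.2.2 S / omega i j x.1.1 S)); split.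
  have /(GR_fibreP ij w Ai Aj AE)[z zE] := Aw.
  have -> : psi_fibre (A, w) = cls _ g (w S / omega i j g S).
    by rewrite zE ratio// (psi_eq z Ai Aj AE).
  have d1 : (fun x : (G * 'rV[R]_n) * (G * ext R n) => x.1.1) @
      nbhs ((g, xi), (A, w)) --> g.
    exact: (cvg_comp _ _ (@cvg_fst _ _ (nbhs (g, xi)) (nbhs (A, w)) _)
      (@cvg_fst _ _ (nbhs g) (nbhs xi) _)).
  have d2 : (fun x : (G * 'rV[R]_n) * (G * ext R n) => x.2.2) @
      nbhs ((g, xi), (A, w)) --> w.
    exact: (cvg_comp _ _ (@cvg_snd _ _ (nbhs (g, xi)) (nbhs (A, w)) _)
      (@cvg_snd _ _ (nbhs A) (nbhs w) _)).
  have /cvg_prodP/(_ S) d2S := d2.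
  have d3 : (fun x : (G * 'rV[R]_n) * (G * ext R n) => omega i j x.1.1) @
      nbhs ((g, xi), (A, w)) --> omega i j g by exact: cvg_omega.
  have /cvg_prodP/(_ S) d3S := d3.
  have d4 : (fun x : (G * 'rV[R]_n) * (G * ext R n) => x.2.2 S / omega i j x.1.1 S) @
      nbhs ((g, xi), (A, w)) --> w S / omega i j g S.
    exact: (cvgM d2S (cvgV S0 d3S)).
  pose m (x : (G * 'rV[R]_n) * (G * ext R n)) : G * C :=
    (x.1.1, x.2.2 S / omega i j x.1.1 S).
  have d5 : m @ nbhs ((g, xi), (A, w)) --> m ((g, xi), (A, w)).
    exact: (cvg_pair d1 d4).
  have d6 := @cls_continuous (wt i j) (m ((g, xi), (A, w))).
  exact: (cvg_comp _ _ d5 d6).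
have oc0 : (fun h : G => omega i j h) @ nbhs g --> omega i j g.
  exact: (cvg_omega (@cvg_id _ (nbhs g))).
have oc : (fun h : G => omega i j h S) @ nbhs g --> omega i j g S.
  by move/cvg_prodP: oc0; exact.
have N : \forall h \near g, omega i j h S != 0 by apply: cvgr_neq0 oc S0.
exists ([set gx : G * 'rV[R]_n | omega i j gx.1 S != 0], btotal (GR_line R i j)).
  split=> /=; last exact: withinT.
  by exists ([set h | omega i j h S != 0], setT) => //=;
    [split=> //; exact: filterT|move=> [? ?] []].
move=> [[h eta] [A' w']] /= [hS Aw'] etaA A'E.
have [Ai' Aj'] : alcove_at i eta /\ alcove_at j eta.
  by have [[/= Vi Vj] _] := Aw'; split; [exact/(V_eq i etaA A'E)|exact/(V_eq j etaA A'E)].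
have /(GR_fibreP ij w' Ai' Aj' A'E)[z ->] := Aw'.
by rewrite ratio// (psi_eq z Ai' Aj' A'E).
Qed.

Lemma phi_line_iso : bundle_iso phi_line.
Proof.
split.
- move=> [A x] /basic_totalP[g [xi [z [Ai Aj AE ->]]]]; split=> //.
  by apply/(GR_fibreP ij _ Ai Aj AE); exists z; rewrite phi_fibre_cls.
- move=> z [A x] _; rewrite /phi_line /=; congr (_, _).
  by rewrite phi_fibre_cls -escaleA.
- move=> h [A x] _; rewrite /phi_line /=; congr (_, _).
  by rewrite phi_fibre_cls omegaM -ext_act_scale.
- apply: within_pair; first exact: within_fst.
  apply/subspace_continuousP => -[A x] _; apply: cvg_withinW.
  exact: (cvg_comp _ _ (@cvg_snd _ _ (nbhs A) (nbhs x) _) (@phi_fibre_continuous x)).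
- exists (fun p => (p.1, psi_fibre p)); split.
  + move=> [A w] /(GR_totalP ij)[g [xi [z [Ai Aj AE ->]]]].
    rewrite (psi_eq z Ai Aj AE).
    by apply/(basic_fibreP Ai Aj AE); exists z.
  + move=> [A x] /basic_totalP[g [xi [z [Ai Aj AE ->]]]].
    by rewrite /phi_line /= phi_fibre_cls (psi_eq z Ai Aj AE).
  + move=> [A w] /(GR_totalP ij)[g [xi [z [Ai Aj AE ->]]]].
    by rewrite (psi_eq z Ai Aj AE) /phi_line /= phi_fibre_cls.
  + by apply: within_pair; [exact: within_fst|exact: psi_cont].
Qed.

End Line.

(** Both conclusions need the choice in [basic_prod] to be opened, hence the joint statement. *)
Lemma basic_prodP (i j k : 'I_n) (u : bspace (basic_line R i j))
    (v : bspace (basic_line R j k)) : (i < j < k)%N ->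
  btotal (basic_line R i j) u -> btotal (basic_line R j k) v ->
  bproj u = bproj v ->
  btotal (basic_line R i k) (basic_prod u v) /\
  phi_line (basic_prod u v) = GR_prod (phi_line u) (phi_line v).
Proof.
case: u v => A x [A' y] ijk; rewrite /bproj/= => ut vt AA'.
have /andP[ij jk] := ijk; have ik := ltn_trans ij jk.
rewrite -AA' in vt *.
have [[/= Vi Vj] _ _] := ut; have [[/= _ Vk] _ _] := vt.
have [g [xi [Ai Aj Ak AE]]] := V3_param Vi Vj Vk.
have /(basic_fibreP ij Ai Aj AE)[z zE] := ut.
have /(basic_fibreP jk Aj Ak AE)[w wE] := vt.
rewrite /basic_prod; case: xgetP => [p _|H]; last first.
  by case: (H (A, cls _ g (z * w))); exists g, xi, z, w.
(* The choice may return another parameter [g'] than [g]; this does not matter, since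
   [phi_fibre_cls] evaluates every class in the representative given. *)
move=> [g' [xi' [z' [w' [[Ai' Aj' Ak'] /= AE' -> -> ->]]]]]; split.
  by apply/(basic_fibreP ik Ai' Ak' AE'); exists (z' * w').
rewrite /phi_line /GR_prod /=; congr (_, _).
rewrite !phi_fibre_cls// wedge_scalel wedge_scaler escaleA.
by rewrite omega_wedge.
Qed.

Lemma phi_gerbe_iso :
  @gerbe_iso R n (basic_gerbe R n) (GR_gerbe R n) (fun i j => @phi_line i j).
Proof.
split=> [i j ij|i j k ijk u v ut vt uv]; first exact: phi_line_iso.
by have [] := basic_prodP ijk ut vt uv.
Qed.

Lemma basic_is_gerbe : (0 < n)%N -> is_gerbe (@V R n) (basic_gerbe R n).
Proof.
move=> n0; apply: (gerbe_iso_is_gerbe phi_gerbe_iso (GR_is_gerbe R n0)).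
- by move=> i j ij z v; exact: basic_scale_total.
- by move=> i j ij g v; exact: basic_act_total.
- by move=> i j k ijk u v ut vt uv; have [] := basic_prodP ijk ut vt uv.
Qed.

End BasicGerbeIso.

Unset Implicit Arguments.

Theorem mainTheorem10 (R : realType) (n : nat) (hn : (0 < n)%N) :
  [/\ is_gerbe (@V R n) (basic_gerbe R n),
      is_gerbe (@V R n) (GR_gerbe R n),
      GR_extends R n &
      exists phi : forall i j : 'I_n,
          bspace (gline (basic_gerbe R n) i j) ->
          bspace (gline (GR_gerbe R n) i j),
        gerbe_iso phi].
Proof.
split; [exact: basic_is_gerbe|exact: GR_is_gerbe|exact: GR_extendsP|].
by exists (fun i j => @phi_line R n i j); exact: phi_gerbe_iso.
Qed.
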